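(* Let $m\ge1$ and let $k\ge0$ be an integer. If $k$ is odd, the space of modes of wavenumber $k$ of $S^3/D_m^*$ is $\{0\}$. If $k$ is even, consider the polynomials $(\alpha^2\beta^2)^a(\alpha^{2m}+\beta^{2m})^b(\alpha\beta(\alpha^{2m}-\beta^{2m}))^c$ if $m$ is even, or $(\alpha^2\beta^2)^a(\alpha^{2m}-\beta^{2m})^b(\alpha\beta(\alpha^{2m}+\beta^{2m}))^c$ if $m$ is odd, over all integers $a\ge0$, $b\ge0$, $c\in\{0,1\}$ with $4a+2mb+(2m+2)c=k$. These polynomials together with all their siblings (restricted to $S^3$) form a basis of the space of modes of wavenumber $k$ of $S^3/D_m^*$, and this space has dimension $$\left(2\left\lfloor\frac{k/2}{2}\right\rfloor+\left\lfloor\frac{k/2}{m}\right\rfloor-\frac k2+1\right)(k+1).$$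
   Context: Identify $\mathbb R^4$ with $\mathbb C^2$ via $\alpha=x+iy$, $\beta=z+iw$, $S^3=\{|\alpha|^2+|\beta|^2=1\}$. Wirtinger derivatives $\frac{\partial}{\partial\alpha}=\frac12(\partial_x-i\partial_y)$, similarly for $\beta$ with $(z,w)$. $\mathrm{twist}_-=-\bar\beta\frac{\partial}{\partial\alpha}+\bar\alpha\frac{\partial}{\partial\beta}$. For a polynomial $f$ in $\alpha,\beta$ only, homogeneous of degree $k$, its siblings are $\mathrm{twist}_-^j f$, $j=0,\dots,k$. $\gamma\in SU(2)$ acts on $\mathbb C^2$ by $(\alpha,\beta)^T\mapsto\gamma(\alpha,\beta)^T$ and on functions by $(R_\gamma F)(x)=F(\gamma^{-1}x)$. For a finite subgroup $\Gamma\subset SU(2)$, the space of modes of wavenumber $k$ of $S^3/\Gamma$ is the complex vector space of $\Gamma$-invariant $F:S^3\to\mathbb C$ with $\Delta_{S^3}F=-k(k+2)F$. The binary dihedral group $D_m^*$ (order $4m$) is the subgroup of $SU(2)$ generated by $\begin{pmatrix}0&i\\ i&0\end{pmatrix}$ and $\mathrm{diag}(e^{i\pi/m},e^{-i\pi/m})$. *)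

(* Defs.v *)
From Stdlib Require Import Reals Lra List ZArith.
From Coquelicot Require Import Coquelicot.
Open Scope R_scope.

Definition fn := R -> R -> R -> R -> C.

Definition alpha (x y z w : R) : C := (x, y).
Definition beta (x y z w : R) : C := (z, w).

Definition on_S3 (x y z w : R) : Prop := x^2 + y^2 + z^2 + w^2 = 1.

Definition slice (i : nat) (G : fn) (x y z w t : R) : C :=
  match i with
  | O => G (x + t) y z w
  | 1%nat => G x (y + t) z w
  | 2%nat => G x y (z + t) w
  | _ => G x y z (w + t)
  end.

Definition partial (i : nat) (G : fn) : fn := fun x y z w =>
  (Derive (fun t => fst (slice i G x y z w t)) 0,
   Derive (fun t => snd (slice i G x y z w t)) 0).

Definition ex_partial (i : nat) (G : fn) (x y z w : R) : Prop :=
  ex_derive (fun t => fst (slice i G x y z w t)) 0 /\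
  ex_derive (fun t => snd (slice i G x y z w t)) 0.

Definition cont_at (G : fn) (x y z w : R) : Prop :=
  forall eps : R, 0 < eps -> exists delta : R, 0 < delta /\
    forall x' y' z' w' : R,
      Rabs (x' - x) < delta -> Rabs (y' - y) < delta ->
      Rabs (z' - z) < delta -> Rabs (w' - w) < delta ->
      Cmod (Cminus (G x' y' z' w') (G x y z w)) < eps.

Definition C2_away0 (G : fn) : Prop :=
  forall x y z w : R, x^2 + y^2 + z^2 + w^2 <> 0 ->
    (forall i, (i < 4)%nat -> ex_partial i G x y z w) /\
    (forall i j, (i < 4)%nat -> (j < 4)%nat ->
       ex_partial j (partial i G) x y z w /\
       cont_at (partial j (partial i G)) x y z w).

Definition Lap4 (G : fn) : fn := fun x y z w =>
  Cplus (Cplus (partial 0 (partial 0 G) x y z w) (partial 1 (partial 1 G) x y z w))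
        (Cplus (partial 2 (partial 2 G) x y z w) (partial 3 (partial 3 G) x y z w)).

Definition ext (F : fn) : fn := fun x y z w =>
  let r := sqrt (x^2 + y^2 + z^2 + w^2) in F (x / r) (y / r) (z / r) (w / r).

(* Laplace-Beltrami operator of S^3: on the unit sphere it coincides with
   the Euclidean Laplacian of the degree-0 homogeneous extension. *)
Definition LapS3 (F : fn) : fn := Lap4 (ext F).

Record mat2 := Mat2 { m11 : C; m12 : C; m21 : C; m22 : C }.

Definition mmul (g h : mat2) : mat2 :=
  Mat2 (Cplus (Cmult (m11 g) (m11 h)) (Cmult (m12 g) (m21 h)))
       (Cplus (Cmult (m11 g) (m12 h)) (Cmult (m12 g) (m22 h)))
       (Cplus (Cmult (m21 g) (m11 h)) (Cmult (m22 g) (m21 h)))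
       (Cplus (Cmult (m21 g) (m12 h)) (Cmult (m22 g) (m22 h))).

Definition mdet (g : mat2) : C :=
  Cminus (Cmult (m11 g) (m22 g)) (Cmult (m12 g) (m21 g)).

Definition minv (g : mat2) : mat2 :=
  let d := Cinv (mdet g) in
  Mat2 (Cmult d (m22 g)) (Cmult d (Copp (m12 g)))
       (Cmult d (Copp (m21 g))) (Cmult d (m11 g)).

Definition cexp_i (t : R) : C := (cos t, sin t).

Definition Dgen1 : mat2 := Mat2 (RtoC 0) Ci Ci (RtoC 0).
Definition Dgen2 (m : nat) : mat2 :=
  Mat2 (cexp_i (PI / INR m)) (RtoC 0) (RtoC 0) (cexp_i (- (PI / INR m))).

Inductive in_Dstar (m : nat) : mat2 -> Prop :=
  | Dstar_gen1 : in_Dstar m Dgen1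
  | Dstar_gen2 : in_Dstar m (Dgen2 m)
  | Dstar_mul : forall g h, in_Dstar m g -> in_Dstar m h -> in_Dstar m (mmul g h)
  | Dstar_inv : forall g, in_Dstar m g -> in_Dstar m (minv g).

Definition rot (g : mat2) (F : fn) : fn := fun x y z w =>
  let gi := minv g in
  let a := alpha x y z w in let b := beta x y z w in
  let a' := Cplus (Cmult (m11 gi) a) (Cmult (m12 gi) b) in
  let b' := Cplus (Cmult (m21 gi) a) (Cmult (m22 gi) b) in
  F (fst a') (snd a') (fst b') (snd b').

Definition invariant (Gam : mat2 -> Prop) (F : fn) : Prop :=
  forall g, Gam g -> forall x y z w, on_S3 x y z w -> rot g F x y z w = F x y z w.

(* Modes of wavenumber k of S^3/Gam (F matters only through its values on S^3). *)
Definition is_mode (Gam : mat2 -> Prop) (k : nat) (F : fn) : Prop :=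
  C2_away0 (ext F) /\
  (forall x y z w, on_S3 x y z w ->
     LapS3 F x y z w = Cmult (RtoC (- (INR k * (INR k + 2)))) (F x y z w)) /\
  invariant Gam F.

Definition dalpha (G : fn) : fn := fun x y z w =>
  Cmult (RtoC (1/2)) (Cminus (partial 0 G x y z w) (Cmult Ci (partial 1 G x y z w))).
Definition dbeta (G : fn) : fn := fun x y z w =>
  Cmult (RtoC (1/2)) (Cminus (partial 2 G x y z w) (Cmult Ci (partial 3 G x y z w))).
Definition twist_minus (G : fn) : fn := fun x y z w =>
  Cplus (Cmult (Copp (Cconj (beta x y z w))) (dalpha G x y z w))
        (Cmult (Cconj (alpha x y z w)) (dbeta G x y z w)).

Fixpoint Cpow (z : C) (n : nat) : C :=
  match n with O => RtoC 1 | S n => Cmult z (Cpow z n) end.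

Definition Dpoly (m a b c : nat) : fn := fun x y z w =>
  let A := alpha x y z w in let B := beta x y z w in
  let A2m := Cpow A (2 * m) in let B2m := Cpow B (2 * m) in
  let AB := Cmult A B in
  if Nat.even m then
    Cmult (Cmult (Cpow (Cmult (Cpow A 2) (Cpow B 2)) a) (Cpow (Cplus A2m B2m) b))
          (Cpow (Cmult AB (Cminus A2m B2m)) c)
  else
    Cmult (Cmult (Cpow (Cmult (Cpow A 2) (Cpow B 2)) a) (Cpow (Cminus A2m B2m) b))
          (Cpow (Cmult AB (Cplus A2m B2m)) c).

Definition Didx (m k : nat) : list (nat * nat * nat * nat) :=
  flat_map (fun a =>
    flat_map (fun b =>
      flat_map (fun c =>
        if Nat.eqb (4 * a + 2 * m * b + (2 * m + 2) * c) k
        then map (fun j => (a, b, c, j)) (seq 0 (k + 1)) else nil)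
      (0 :: 1 :: nil)%nat)
    (seq 0 (k + 1)))
  (seq 0 (k + 1)).

(* Member (a,b,c,j): the sibling twist_-^j of the polynomial (a,b,c). *)
Definition Dfamily (m : nat) (i : nat * nat * nat * nat) : fn :=
  let '(a, b, c, j) := i in Nat.iter j twist_minus (Dpoly m a b c).

Definition lin_comb {I : Type} (L : list I) (coef : I -> C) (f : I -> fn) : fn :=
  fun x y z w =>
    fold_right (fun i acc => Cplus (Cmult (coef i) (f i x y z w)) acc) (RtoC 0) L.

Definition is_basis {I : Type} (P : fn -> Prop) (L : list I) (f : I -> fn) : Prop :=
  NoDup L /\
  (forall i, In i L -> P (f i)) /\
  (forall coef : I -> C,
     (forall x y z w, on_S3 x y z w -> lin_comb L coef f x y z w = RtoC 0) ->
     forall i, In i L -> coef i = RtoC 0) /\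
  (forall F, P F -> exists coef : I -> C,
     forall x y z w, on_S3 x y z w -> F x y z w = lin_comb L coef f x y z w).

Definition has_dim (P : fn -> Prop) (n : nat) : Prop :=
  exists f : nat -> fn, is_basis P (seq 0 n) f.

(* Main.v *)
(** Let F be a mode of wavenumber k and H = r^k F(x/r).  Since F is an
    eigenfunction, H is C^2, harmonic and of growth r^k on R^4 minus the origin.
    That H is a polynomial is a Liouville argument that needs no integration and
    no further regularity: the difference of H and its mirror image in a
    coordinate hyperplane vanishes on that hyperplane, and comparing it with an
    explicit quadratic barrier by the maximum principle shows that every
    difference H(x + t e_i) - H(x) is of growth r^(k-1).  (The origin and its
    translates are harmless isolated singularities, because 1/r^2 is harmonic in
    dimension four.)  Hence the (k+1)-st differences vanish, and a continuous
    function with this property is a polynomial (Frechet).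

    In the variables alpha, conj alpha, beta, conj beta, harmonicity of a
    homogeneous polynomial with coefficients p(a,b,c,d) says that
    (-1)^d a! b! c! d! p(a,b,c,d) depends only on the margins a+d, b+c, b+d of
    the table (a,b,c,d), and the siblings of alpha^(k-i) beta^i are, up to
    scalars, exactly the polynomials supported on one set of margins.  So each
    harmonic polynomial is uniquely a sum of twist_-^j g_j with g_j homogeneous of
    degree k in alpha, beta, and it is invariant iff all the g_j are.  Finally the
    invariants in alpha, beta are spanned by the sums of a monomial and its mirror
    image, which are power sums in alpha^(2m) and (-1)^m beta^(2m); they are
    independent because their orders in beta are distinct. *)

From Stdlib Require Import Reals List ZArith Lra Lia ClassicalEpsilon
  FunctionalExtensionality Permutation.
From Coquelicot Require Import Coquelicot.
Require Import Defs.
Open Scope R_scope.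
Set Bullet Behavior "Strict Subproofs".

(** * The maximum principle on a box in R^4 *)

(** A mode is assumed [C^2] off the origin and nothing more, so the analytic part uses only first
    and second derivatives along coordinate lines, and polynomiality has to come out of size
    estimates. The decisive estimate scales: if [M] bounds a harmonic function on a box of size [l],
    its difference over a step [t] is at most a constant times [M t / l]; taking [l] comparable to
    [1 + |p|] trades the division by [l] for one power of growth. Interpolation then yields some
    polynomial without control of its degree, and homogeneity is recovered afterwards from the
    scaling of H by the factor 2.

    On the algebraic side the conjugates are independent variables, so derivatives, twists and the
    two generators of the group become operations on tables of coefficients. A single closed formula
    for the coefficients of an iterated twist serves both directions: its weights never vanish,
    which gives independence, and apart from the weight it depends only on the margins of the table,
    which gives completeness and the transfer of invariance. *)

Definition rfn := R -> R -> R -> R -> R.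

Definition near4 (d x y z w x' y' z' w' : R) : Prop :=
  Rabs (x' - x) < d /\ Rabs (y' - y) < d /\ Rabs (z' - z) < d /\ Rabs (w' - w) < d.

Definition in_box (a b l x y z w : R) : Prop :=
  a <= x <= b /\ - l <= y <= l /\ - l <= z <= l /\ - l <= w <= l.

Definition in_open_box (a b l x y z w : R) : Prop :=
  a < x < b /\ - l < y < l /\ - l < z < l /\ - l < w < l.

Definition cont4 (g : rfn) (x y z w : R) : Prop :=
  forall eps, 0 < eps -> exists d, 0 < d /\
    forall x' y' z' w', near4 d x y z w x' y' z' w' ->
      Rabs (g x' y' z' w' - g x y z w) < eps.

(** Compactness as a passage from local to uniform: since [Q d] weakens as [d] shrinks, one small
    radius serves the whole box. The uses take [Q] of the form [G <= / d] or [G <= M - d]. *)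
Lemma box_compact (a b l : R) (Q : R -> R -> R -> R -> R -> Prop) :
  (forall d d' x y z w, 0 < d' -> d' <= d -> Q d x y z w -> Q d' x y z w) ->
  (forall x y z w, in_box a b l x y z w -> exists d, 0 < d /\
     forall x' y' z' w', in_box a b l x' y' z' w' ->
       near4 d x y z w x' y' z' w' -> Q d x' y' z' w') ->
  exists d, 0 < d /\ forall x y z w, in_box a b l x y z w -> Q d x y z w.
Proof.
  intros mono loc.
  assert (H : forall p : Compactness.Tn 4 R, exists d : posreal,
    let '(x, (y, (z, (w, _)))) := p in
    in_box a b l x y z w ->
     forall x' y' z' w', in_box a b l x' y' z' w' ->
       near4 d x y z w x' y' z' w' -> Q d x' y' z' w').
  { intros [x [y [z [w u]]]].
    destruct (classic (in_box a b l x y z w)) as [Hb | Hb].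
    - destruct (loc _ _ _ _ Hb) as [d [Hd HQ]]. exists (mkposreal d Hd). intros _. exact HQ.
    - exists (mkposreal 1 Rlt_0_1). intros Hb'. contradiction. }
  pose (delta := fun p => proj1_sig (constructive_indefinite_description _ (H p))).
  destruct (compactness_value 4 (a, (-l, (-l, (-l, tt)))) (b, (l, (l, (l, tt)))) delta)
    as [d Hd].
  exists d. split. apply cond_pos.
  (* [compactness_value] provides its centre only under a double negation, hence the proof by
     contradiction. *)
  intros x y z w Hb. apply NNPP. intros HQ.
  apply (Hd (x, (y, (z, (w, tt))))).
  { destruct Hb as [? [? [? ?]]]. simpl. repeat split; lra. }
  intros [[x0 [y0 [z0 [w0 u0]]]] [Hb0 [Hc Hle]]].
  apply HQ. revert Hc Hle. unfold delta.
  destruct (constructive_indefinite_description _ _) as [d0 Hd0]. simpl. intros Hc Hle.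
  apply (mono d0); [apply cond_pos | exact Hle |].
  simpl in Hb0. apply Hd0; auto; unfold in_box, near4; intuition.
Qed.

(** Both values are arguments, so that the rules for sums, products and substitutions compute them.
    The first derivative is required only near [x], because the functions involved are singular
    elsewhere. *)
Definition D2 (f : R -> R) (x d1 d2 : R) : Prop :=
  exists f' : R -> R, locally x (fun t : R => is_derive f t (f' t)) /\ f' x = d1 /\ is_derive f' x d2.

Lemma derive_pos_sign (f : R -> R) (x l : R) :
  is_derive f x l -> 0 < l ->
  exists d, 0 < d /\ forall h, h <> 0 -> Rabs h < d -> 0 < (f (x + h) - f x) * h.
Proof.
  intros Hf Hl. apply is_derive_Reals in Hf.
  destruct (Hf l Hl) as [d Hd]. exists d. split. apply cond_pos.
  intros h Hh Hhd. specialize (Hd h Hh Hhd).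
  apply Rabs_def2 in Hd.
  replace ((f (x + h) - f x) * h) with ((f (x + h) - f x) / h * (h * h)) by (field; auto).
  apply Rmult_lt_0_compat. lra. nra.
Qed.

Lemma second_derivative_test (f : R -> R) (x d1 d2 : R) :
  D2 f x d1 d2 -> locally x (fun t => f t <= f x) -> d2 <= 0.
Proof.
  intros [f' [Hf' [Hx Hd2]]] [r Hr].
  assert (Hmax : forall h, Rabs h < r -> f (x + h) <= f x).
  { intros h Hh. apply Hr. change (Rabs (x + h + - x) < r).
    replace (x + h + - x) with h by ring. exact Hh. }
  (* Fermat: a nonzero slope would give a larger value on one side of [x]. *)
  assert (H1 : d1 = 0).
  { assert (Hd1 : is_derive f x d1) by (rewrite <- Hx; apply (locally_singleton _ _ Hf')).
    destruct (Rtotal_order d1 0) as [Hn | [H0 | Hp]]; auto; exfalso.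
    - assert (Hd1' : is_derive (fun t => - f t) x (- d1)) by (apply (is_derive_opp f); auto).
      destruct (derive_pos_sign _ _ _ Hd1') as [d [Hd H]]. lra.
      pose proof (cond_pos r).
      set (h := - (Rmin d r / 2)).
      assert (0 < Rmin d r) by (apply Rmin_glb_lt; auto).
      assert (Rmin d r <= d) by apply Rmin_l. assert (Rmin d r <= r) by apply Rmin_r.
      assert (Hh : Rabs h = Rmin d r / 2).
      { unfold h. rewrite Rabs_Ropp. apply Rabs_pos_eq. lra. }
      specialize (H h). specialize (Hmax h).
      assert (h < 0) by (unfold h; lra).
      assert (h <> 0) by lra.
      specialize (H H5). rewrite Hh in *. nra.
    - destruct (derive_pos_sign _ _ _ Hd1) as [d [Hd H]]. lra.
      pose proof (cond_pos r).
      set (h := (Rmin d r / 2)).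
      assert (0 < Rmin d r) by (apply Rmin_glb_lt; auto).
      assert (Rmin d r <= d) by apply Rmin_l. assert (Rmin d r <= r) by apply Rmin_r.
      assert (Hh : Rabs h = Rmin d r / 2).
      { unfold h. apply Rabs_pos_eq. lra. }
      specialize (H h). specialize (Hmax h).
      assert (h > 0) by (unfold h; lra).
      assert (h <> 0) by lra.
      specialize (H H5). rewrite Hh in *. nra. }
  (* If the second derivative were positive, the first would be positive just to the right of [x],
     and by the mean value theorem [f] would increase there. *)
  destruct (Rle_or_lt d2 0) as [H | Hpos]; auto. exfalso.
  destruct (derive_pos_sign _ _ _ Hd2 Hpos) as [d [Hd H]].
  destruct Hf' as [r' Hr'].
  pose proof (cond_pos r). pose proof (cond_pos r').
  set (h := Rmin d (Rmin r r') / 2).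
  assert (0 < Rmin d (Rmin r r')) by (repeat apply Rmin_glb_lt; auto).
  assert (Rmin d (Rmin r r') <= d) by apply Rmin_l.
  assert (Rmin d (Rmin r r') <= Rmin r r') by apply Rmin_r.
  assert (Rmin r r' <= r) by apply Rmin_l. assert (Rmin r r' <= r') by apply Rmin_r.
  assert (Hh : 0 < h) by (unfold h; lra).
  destruct (MVT_cor2 f f' x (x + h)) as [c [Hc1 Hc2]]. lra.
  { intros c Hc. apply is_derive_Reals. apply Hr'.
    change (Rabs (c + - x) < r'). rewrite Rabs_pos_eq; unfold h in *; lra. }
  specialize (Hmax h). rewrite Rabs_pos_eq in Hmax by lra.
  specialize (H (c - x)). rewrite Rabs_pos_eq in H by lra.
  replace (x + (c - x)) with c in H by ring.
  assert (h < d) by (unfold h; lra). assert (h < r) by (unfold h; lra).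
  assert (0 < (f' c - f' x) * (c - x)) by (apply H; lra).
  assert (0 < f' c) by nra. nra.
Qed.

(* [L] is the value at the point of the Laplacian of [g]. *)
Definition lap (g : rfn) (x y z w L : R) : Prop :=
  exists d0 d1 d2 d3 e0 e1 e2 e3,
    D2 (fun t => g t y z w) x d0 e0 /\ D2 (fun t => g x t z w) y d1 e1 /\
    D2 (fun t => g x y t w) z d2 e2 /\ D2 (fun t => g x y z t) w d3 e3 /\
    L = e0 + e1 + e2 + e3.

Lemma Rabs_diag_lt (t d : R) : 0 < d -> Rabs (t - t) < d.
Proof. intros. replace (t - t) with 0 by ring. rewrite Rabs_R0. auto. Qed.

Lemma in_open_box_margin (a b l x y z w : R) :
  in_open_box a b l x y z w -> exists d, 0 < d /\
  forall x' y' z' w', near4 d x y z w x' y' z' w' -> in_box a b l x' y' z' w'.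
Proof.
  intros [[? ?] [[? ?] [[? ?] [? ?]]]].
  exists (Rmin (Rmin (Rmin (x - a) (b - x)) (Rmin (y + l) (l - y)))
               (Rmin (Rmin (z + l) (l - z)) (Rmin (w + l) (l - w)))).
  split. { repeat apply Rmin_glb_lt; lra. }
  intros x' y' z' w' [K1 [K2 [K3 K4]]].
  repeat match goal with
  | H : Rabs _ < Rmin _ _ |- _ =>
     let A := fresh in let B := fresh in
     pose proof (Rlt_le_trans _ _ _ H (Rmin_l _ _)) as A;
     pose proof (Rlt_le_trans _ _ _ H (Rmin_r _ _)) as B; clear H
  | H : Rabs _ < _ |- _ => apply Rabs_def2 in H
  end.
  unfold in_box. repeat split; lra.
Qed.

(** [G] tends to minus infinity at the singular set [S], so a positive supremum is attained off [S].
    It is not attained inside the box, since there the Laplacian is positive while all second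
    derivatives at a maximum are at most 0. *)
Lemma strict_max_principle (a b l : R) (G : rfn) (S : R -> R -> R -> R -> Prop) :
  (forall x y z w, in_box a b l x y z w -> S x y z w -> forall N, exists d, 0 < d /\
     forall x' y' z' w', in_box a b l x' y' z' w' -> ~ S x' y' z' w' ->
       near4 d x y z w x' y' z' w' -> G x' y' z' w' <= N) ->
  (forall x y z w, in_box a b l x y z w -> ~ S x y z w ->
     cont4 G x y z w /\ exists d, 0 < d /\
       forall x' y' z' w', near4 d x y z w x' y' z' w' -> ~ S x' y' z' w') ->
  (forall x y z w, in_open_box a b l x y z w -> ~ S x y z w ->
     exists L, lap G x y z w L /\ 0 < L) ->
  (forall x y z w, in_box a b l x y z w -> ~ S x y z w ->
     ~ in_open_box a b l x y z w -> G x y z w <= 0) ->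
  forall x y z w, in_box a b l x y z w -> ~ S x y z w -> G x y z w <= 0.
Proof.
  intros Hsing Hcont Hlap Hbd x0 y0 z0 w0 Hb0 HS0.
  destruct (Rle_or_lt (G x0 y0 z0 w0) 0) as [H | Hpos]; auto. exfalso.
  set (E := fun v => exists x y z w, in_box a b l x y z w /\ ~ S x y z w /\ v = G x y z w).
  assert (HE : bound E).
  { destruct (box_compact a b l (fun d x y z w => ~ S x y z w -> G x y z w <= / d)) as [d [Hd HQ]].
    - intros d d' x y z w Hd' Hle H HS. specialize (H HS).
      apply Rle_trans with (1 := H). apply Rinv_le_contravar; auto.
    - intros x y z w Hb. destruct (classic (S x y z w)) as [HS | HS].
      + destruct (Hsing _ _ _ _ Hb HS 1) as [d [Hd H]].
        exists (Rmin d 1). split. apply Rmin_glb_lt; lra.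
        intros x' y' z' w' Hb' [H1 [H2 [H3 H4]]] HS'.
        apply Rle_trans with 1.
        * pose proof (Rmin_l d 1). apply H; auto. unfold near4. repeat split; lra.
        * rewrite <- Rinv_1 at 1. apply Rinv_le_contravar. apply Rmin_glb_lt; lra. apply Rmin_r.
      + destruct (proj1 (Hcont _ _ _ _ Hb HS) 1 Rlt_0_1) as [d [Hd H]].
        set (B := Rabs (G x y z w) + 1).
        assert (0 < B) by (unfold B; pose proof (Rabs_pos (G x y z w)); lra).
        exists (Rmin d (/ B)). split. { apply Rmin_glb_lt; auto. apply Rinv_0_lt_compat; auto. }
        intros x' y' z' w' Hb' [H1 [H2 [H3 H4]]] HS'.
        apply Rle_trans with B.
        * pose proof (Rmin_l d (/ B)).
          assert (Hn : near4 d x y z w x' y' z' w') by (unfold near4; repeat split; lra).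
          specialize (H _ _ _ _ Hn). apply Rabs_def2 in H. unfold B.
          pose proof (Rle_abs (G x y z w)). lra.
        * rewrite <- (Rinv_inv B) at 1. apply Rinv_le_contravar.
          apply Rmin_glb_lt; auto. apply Rinv_0_lt_compat; auto. apply Rmin_r.
    - exists (/ d). intros v [x [y [z [w [Hb [HS Hv]]]]]]. subst v. auto. }
  assert (HE' : exists v, E v) by (exists (G x0 y0 z0 w0); exists x0, y0, z0, w0; auto).
  destruct (completeness E HE HE') as [M [HM1 HM2]].
  assert (HMpos : 0 < M).
  { apply Rlt_le_trans with (1 := Hpos). apply HM1. exists x0, y0, z0, w0; auto. }
  assert (Hle : forall x y z w, in_box a b l x y z w -> ~ S x y z w -> G x y z w <= M).
  { intros x y z w Hb HS. apply HM1. exists x, y, z, w; auto. }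
  destruct (classic (exists x y z w, in_box a b l x y z w /\ ~ S x y z w /\ G x y z w = M))
    as [[x [y [z [w [Hb [HS HG]]]]]] | Hno].
  - assert (Ho : in_open_box a b l x y z w).
    { apply NNPP. intros Hno. specialize (Hbd _ _ _ _ Hb HS Hno). lra. }
    destruct (Hlap _ _ _ _ Ho HS) as [L [HL HLpos]].
    destruct (in_open_box_margin _ _ _ _ _ _ _ Ho) as [d [Hd Hm]].
    destruct (proj2 (Hcont _ _ _ _ Hb HS)) as [d' [Hd' HS']].
    assert (Hmax : forall x' y' z' w', near4 (Rmin d d') x y z w x' y' z' w' ->
      G x' y' z' w' <= G x y z w).
    { intros x' y' z' w' [H1 [H2 [H3 H4]]]. rewrite HG.
      pose proof (Rmin_l d d'). pose proof (Rmin_r d d').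
      apply Hle; [apply Hm | apply HS']; unfold near4; repeat split; lra. }
    assert (Hdd : 0 < Rmin d d') by (apply Rmin_glb_lt; auto).
    destruct HL as [d0 [d1 [d2 [d3 [e0 [e1 [e2 [e3 [D0 [D1 [D2' [D3 HLe]]]]]]]]]]]].
    apply second_derivative_test in D0, D1, D2', D3; try lra;
    exists (mkposreal _ Hdd); intros t Ht; apply Hmax; unfold near4;
    repeat split; try (apply Rabs_diag_lt; auto); exact Ht.
  (* If the supremum [M] were not attained, compactness would give a uniform gap [d] below it, and
     [M - d] would be a smaller upper bound. *)
  - destruct (box_compact a b l (fun d x y z w => ~ S x y z w -> G x y z w <= M - d)) as [d [Hd HQ]].
    + intros d d' x y z w Hd' Hdd H HS. specialize (H HS). lra.
    + intros x y z w Hb. destruct (classic (S x y z w)) as [HS | HS].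
      * destruct (Hsing _ _ _ _ Hb HS (M - 1)) as [d [Hd H]].
        exists (Rmin d 1). split. apply Rmin_glb_lt; lra.
        intros x' y' z' w' Hb' [H1 [H2 [H3 H4]]] HS'.
        pose proof (Rmin_l d 1). pose proof (Rmin_r d 1).
        apply Rle_trans with (M - 1); try lra. apply H; auto. unfold near4. repeat split; lra.
      * assert (HG : G x y z w < M).
        { destruct (Hle _ _ _ _ Hb HS); auto. exfalso. apply Hno. exists x, y, z, w; auto. }
        set (e := (M - G x y z w) / 2). assert (He : 0 < e) by (unfold e; lra).
        destruct (proj1 (Hcont _ _ _ _ Hb HS) e He) as [d [Hd H]].
        exists (Rmin d e). split. apply Rmin_glb_lt; lra.
        intros x' y' z' w' Hb' [H1 [H2 [H3 H4]]] HS'.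
        pose proof (Rmin_l d e). pose proof (Rmin_r d e).
        assert (Hn : near4 d x y z w x' y' z' w') by (unfold near4; repeat split; lra).
        specialize (H _ _ _ _ Hn). apply Rabs_def2 in H. unfold e in *. lra.
    + assert (M <= M - d); try lra. apply HM2.
      intros v [x [y [z [w [Hb [HS Hv]]]]]]. subst v. auto.
Qed.

(** * Continuity of functions of four real variables *)

Lemma cont4_continuous (g : rfn) (x y z w : R) :
  cont4 g x y z w <->
  continuous (fun p : R * R * R * R => g (fst (fst (fst p))) (snd (fst (fst p))) (snd (fst p)) (snd p))
    (x, y, z, w).
Proof.
  split.
  - intros H P [e He]. destruct (H e (cond_pos e)) as [d [Hd Hg]].
    exists (mkposreal d Hd). intros [[[x' y'] z'] w'] [[[H1 H2] H3] H4].
    apply He. apply Hg. unfold near4. repeat split; assumption.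
  - intros H e He.
    destruct (H (fun v => Rabs (v - g x y z w) < e)) as [d Hd].
    { exists (mkposreal e He). intros v Hv. exact Hv. }
    exists d. split. apply cond_pos. intros x' y' z' w' [H1 [H2 [H3 H4]]].
    apply (Hd (x', y', z', w')). repeat split; assumption.
Qed.

Lemma cont4_const (c x y z w : R) : cont4 (fun _ _ _ _ => c) x y z w.
Proof. apply cont4_continuous. apply continuous_const. Qed.

Lemma cont4_x (x y z w : R) : cont4 (fun x _ _ _ => x) x y z w.
Proof. intros e He. exists e. split; auto. intros ? ? ? ? [H _]; auto. Qed.

Lemma cont4_y (x y z w : R) : cont4 (fun _ y _ _ => y) x y z w.
Proof. intros e He. exists e. split; auto. intros ? ? ? ? [_ [H _]]; auto. Qed.

Lemma cont4_z (x y z w : R) : cont4 (fun _ _ z _ => z) x y z w.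
Proof. intros e He. exists e. split; auto. intros ? ? ? ? [_ [_ [H _]]]; auto. Qed.

Lemma cont4_w (x y z w : R) : cont4 (fun _ _ _ w => w) x y z w.
Proof. intros e He. exists e. split; auto. intros ? ? ? ? [_ [_ [_ H]]]; auto. Qed.

Lemma cont4_plus (g h : rfn) (x y z w : R) :
  cont4 g x y z w -> cont4 h x y z w ->
  cont4 (fun x y z w => g x y z w + h x y z w) x y z w.
Proof.
  rewrite !cont4_continuous. intros. apply (continuous_plus (V := R_NormedModule)); auto.
Qed.

Lemma cont4_mult (g h : rfn) (x y z w : R) :
  cont4 g x y z w -> cont4 h x y z w ->
  cont4 (fun x y z w => g x y z w * h x y z w) x y z w.
Proof.
  rewrite !cont4_continuous. intros. apply (continuous_mult (K := R_AbsRing)); auto.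
Qed.

Lemma cont4_minus (g h : rfn) (x y z w : R) :
  cont4 g x y z w -> cont4 h x y z w ->
  cont4 (fun x y z w => g x y z w - h x y z w) x y z w.
Proof.
  rewrite !cont4_continuous. intros. apply (continuous_minus (V := R_NormedModule)); auto.
Qed.

Lemma cont4_comp (f : R -> R) (g : rfn) (x y z w : R) :
  cont4 g x y z w -> continuous f (g x y z w) ->
  cont4 (fun x y z w => f (g x y z w)) x y z w.
Proof.
  rewrite !cont4_continuous. intros.
  apply (continuous_comp (fun p : R * R * R * R => g (fst (fst (fst p))) (snd (fst (fst p))) (snd (fst p)) (snd p)) f); auto.
Qed.

Ltac cont4_tac := repeat match goal with
  | |- cont4 (fun x y z w => @?f x y z w - @?g x y z w) _ _ _ _ => apply (cont4_minus f g)
  | |- cont4 (fun x y z w => @?f x y z w + @?g x y z w) _ _ _ _ => apply (cont4_plus f g)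
  | |- cont4 (fun x y z w => @?f x y z w * @?g x y z w) _ _ _ _ => apply (cont4_mult f g)
  | |- cont4 (fun x y z w => ?c) _ _ _ _ => apply (cont4_const c)
  | |- cont4 (fun x _ _ _ => x) _ _ _ _ => apply cont4_x
  | |- cont4 (fun _ y _ _ => y) _ _ _ _ => apply cont4_y
  | |- cont4 (fun _ _ z _ => z) _ _ _ _ => apply cont4_z
  | |- cont4 (fun _ _ _ w => w) _ _ _ _ => apply cont4_w
  end.

Lemma cont4_ext_near (g h : rfn) (x y z w d : R) : 0 < d ->
  (forall x' y' z' w', near4 d x y z w x' y' z' w' -> g x' y' z' w' = h x' y' z' w') ->
  cont4 g x y z w -> cont4 h x y z w.
Proof.
  intros Hd E H e He. destruct (H e He) as [d' [Hd' H']].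
  exists (Rmin d d'). split. apply Rmin_glb_lt; auto.
  intros x' y' z' w' [H1 [H2 [H3 H4]]].
  pose proof (Rmin_l d d'). pose proof (Rmin_r d d').
  rewrite <- !E. apply H'.
  all: unfold near4; repeat split; try lra; apply Rabs_diag_lt; auto.
Qed.

(** Covers the translations ([s0 = 1]) and the reflection of the first coordinate ([s0 = -1]) at
    once. *)
Lemma cont4_affine (g : rfn) (a0 s0 a1 a2 a3 x y z w : R) : Rabs s0 = 1 ->
  cont4 g (a0 + s0 * x) (a1 + y) (a2 + z) (a3 + w) ->
  cont4 (fun x y z w => g (a0 + s0 * x) (a1 + y) (a2 + z) (a3 + w)) x y z w.
Proof.
  intros Hs H e He. destruct (H e He) as [d [Hd H']]. exists d. split; auto.
  intros x' y' z' w' [H1 [H2 [H3 H4]]]. apply H'. unfold near4. repeat split.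
  - replace (a0 + s0 * x' - (a0 + s0 * x)) with (s0 * (x' - x)) by ring.
    rewrite Rabs_mult, Hs. lra.
  - replace (a1 + y' - (a1 + y)) with (y' - y) by ring. auto.
  - replace (a2 + z' - (a2 + z)) with (z' - z) by ring. auto.
  - replace (a3 + w' - (a3 + w)) with (w' - w) by ring. auto.
Qed.

(** * Rules for second derivatives and Laplacians *)

Lemma D2_intro (f f' : R -> R) (x d1 d2 : R) :
  (forall t, is_derive f t (f' t)) -> f' x = d1 -> is_derive f' x d2 -> D2 f x d1 d2.
Proof. intros H H1 H2. exists f'. split; [apply filter_forall; auto|split; auto]. Qed.

Lemma D2_plus (f g : R -> R) (x a b c d : R) :
  D2 f x a b -> D2 g x c d -> D2 (fun t => f t + g t) x (a + c) (b + d).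
Proof.
  intros [f' [Hf [Hf1 Hf2]]] [g' [Hg [Hg1 Hg2]]].
  exists (fun t => f' t + g' t). split; [|split].
  - generalize (filter_and _ _ Hf Hg). apply filter_imp. intros t [H1 H2].
    apply (is_derive_plus f g); auto.
  - congruence.
  - apply (is_derive_plus f' g'); auto.
Qed.

Lemma is_derive_mult_R (f g : R -> R) (x a b : R) :
  is_derive f x a -> is_derive g x b ->
  is_derive (fun t => f t * g t) x (a * g x + f x * b).
Proof. intros. apply (is_derive_mult f g); auto. intros; apply Rmult_comm. Qed.

Lemma D2_mult (f g : R -> R) (x a b c d : R) :
  D2 f x a b -> D2 g x c d ->
  D2 (fun t => f t * g t) x (a * g x + f x * c) (b * g x + 2 * a * c + f x * d).
Proof.
  intros [f' [Hf [Hf1 Hf2]]] [g' [Hg [Hg1 Hg2]]].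
  exists (fun t => f' t * g t + f t * g' t). split; [|split].
  - generalize (filter_and _ _ Hf Hg). apply filter_imp. intros t [H1 H2].
    apply is_derive_mult_R; auto.
  - congruence.
  - pose proof (locally_singleton _ _ Hf) as Hf0. pose proof (locally_singleton _ _ Hg) as Hg0.
    simpl in Hf0, Hg0. rewrite Hf1 in Hf0. rewrite Hg1 in Hg0.
    replace (b * g x + 2 * a * c + f x * d)
      with ((b * g x + f' x * c) + (a * g' x + f x * d)) by (rewrite Hf1, Hg1; ring).
    apply (is_derive_plus (fun t => f' t * g t) (fun t => f t * g' t));
    apply is_derive_mult_R; auto.
Qed.

Lemma D2_const (c x : R) : D2 (fun _ => c) x 0 0.
Proof.
  apply (D2_intro _ (fun _ => 0)); auto; intros; apply (@is_derive_const R_AbsRing R_NormedModule).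
Qed.

Lemma D2_scal (c : R) (f : R -> R) (x a b : R) :
  D2 f x a b -> D2 (fun t => c * f t) x (c * a) (c * b).
Proof.
  intros H. pose proof (D2_mult _ _ _ _ _ _ _ (D2_const c x) H) as K. simpl in K.
  replace (c * a) with (0 * f x + c * a) by ring.
  replace (c * b) with (0 * f x + 2 * 0 * a + c * b) by ring. exact K.
Qed.

Lemma D2_ext_loc (f g : R -> R) (x a b : R) :
  locally x (fun t => f t = g t) -> D2 f x a b -> D2 g x a b.
Proof.
  intros E [f' [Hf [Hf1 Hf2]]]. exists f'. split; [|split; auto].
  apply locally_locally in E. generalize (filter_and _ _ E Hf). apply filter_imp.
  intros t [H1 H2]. apply (is_derive_ext_loc f); auto.
Qed.

Lemma D2_affine (f : R -> R) (c s x a b : R) :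
  D2 f (c + s * x) a b -> D2 (fun t => f (c + s * t)) x (s * a) (s * s * b).
Proof.
  intros [f' [Hf [Hf1 Hf2]]]. exists (fun t => s * f' (c + s * t)).
  assert (Haff : forall t, is_derive (fun t => c + s * t) t s) by (intros; auto_derive; auto; ring).
  split; [|split].
  - assert (Hc : continuous (fun t => c + s * t) x)
      by (apply (ex_derive_continuous (fun t => c + s * t)); exists s; auto).
    pose proof (Hc _ Hf) as K. unfold filtermap in K. revert K. apply filter_imp. intros t Ht.
    apply (is_derive_comp f (fun t => c + s * t)); auto.
  - now rewrite Hf1.
  - replace (s * s * b) with (s * (s * b)) by ring.
    apply (is_derive_scal (fun t => f' (c + s * t)) x s (s * b)).
    apply (is_derive_comp f' (fun t => c + s * t)); auto.
Qed.

Lemma D2_unique (f : R -> R) (x a b a' b' : R) :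
  D2 f x a b -> D2 f x a' b' -> a = a' /\ b = b'.
Proof.
  intros [f' [Hf [Hf1 Hf2]]] [g' [Hg [Hg1 Hg2]]].
  assert (E : locally x (fun t => f' t = g' t)).
  { generalize (filter_and _ _ Hf Hg). apply filter_imp. intros t [H1 H2].
    rewrite <- (is_derive_unique _ _ _ H1). apply is_derive_unique; auto. }
  split.
  - rewrite <- Hf1, <- Hg1. apply (locally_singleton _ _ E).
  - rewrite <- (is_derive_unique _ _ _ Hg2). symmetry.
    apply is_derive_unique. apply (is_derive_ext_loc f'); auto.
Qed.

Lemma locally_of_near (P : R -> Prop) (x d : R) : 0 < d ->
  (forall t, Rabs (t - x) < d -> P t) -> locally x P.
Proof. intros Hd H. exists (mkposreal d Hd). intros t Ht. apply H. exact Ht. Qed.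

Lemma lap_unique (g : rfn) (x y z w L L' : R) : lap g x y z w L -> lap g x y z w L' -> L = L'.
Proof.
  intros [d0 [d1 [d2 [d3 [e0 [e1 [e2 [e3 [A0 [A1 [A2 [A3 HL]]]]]]]]]]]]
    [d0' [d1' [d2' [d3' [e0' [e1' [e2' [e3' [B0 [B1 [B2 [B3 HL']]]]]]]]]]]].
  apply (D2_unique _ _ _ _ _ _ A0) in B0. apply (D2_unique _ _ _ _ _ _ A1) in B1.
  apply (D2_unique _ _ _ _ _ _ A2) in B2. apply (D2_unique _ _ _ _ _ _ A3) in B3.
  destruct B0 as [_ <-], B1 as [_ <-], B2 as [_ <-], B3 as [_ <-]. congruence.
Qed.

Lemma lap_ext_near (g h : rfn) (x y z w d L : R) : 0 < d ->
  (forall x' y' z' w', near4 d x y z w x' y' z' w' -> g x' y' z' w' = h x' y' z' w') ->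
  lap g x y z w L -> lap h x y z w L.
Proof.
  intros Hd E [d0 [d1 [d2 [d3 [e0 [e1 [e2 [e3 [A0 [A1 [A2 [A3 HL]]]]]]]]]]]].
  assert (Z : forall s, Rabs (s - s) < d) by (intros; apply Rabs_diag_lt; auto).
  exists d0, d1, d2, d3, e0, e1, e2, e3.
  split; [|split; [|split; [|split]]]; auto;
  (eapply D2_ext_loc; [|eassumption]); apply (locally_of_near _ _ d Hd); intros t Ht;
  apply E; unfold near4; auto.
Qed.

Lemma lap_plus (g h : rfn) (x y z w L L' : R) :
  lap g x y z w L -> lap h x y z w L' ->
  lap (fun x y z w => g x y z w + h x y z w) x y z w (L + L').
Proof.
  intros [d0 [d1 [d2 [d3 [e0 [e1 [e2 [e3 [A0 [A1 [A2 [A3 HL]]]]]]]]]]]]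
    [d0' [d1' [d2' [d3' [e0' [e1' [e2' [e3' [B0 [B1 [B2 [B3 HL']]]]]]]]]]]].
  exists (d0 + d0'), (d1 + d1'), (d2 + d2'), (d3 + d3'),
    (e0 + e0'), (e1 + e1'), (e2 + e2'), (e3 + e3').
  repeat split; try (apply (D2_plus (fun t => _) (fun t => _)); assumption). lra.
Qed.

Lemma lap_scal (c : R) (g : rfn) (x y z w L : R) :
  lap g x y z w L -> lap (fun x y z w => c * g x y z w) x y z w (c * L).
Proof.
  intros [d0 [d1 [d2 [d3 [e0 [e1 [e2 [e3 [A0 [A1 [A2 [A3 HL]]]]]]]]]]]].
  exists (c * d0), (c * d1), (c * d2), (c * d3), (c * e0), (c * e1), (c * e2), (c * e3).
  repeat split; try (apply D2_scal; assumption). subst L. ring.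
Qed.

Lemma lap_affine (g : rfn) (a0 s0 a1 a2 a3 x y z w L : R) : s0 * s0 = 1 ->
  lap g (a0 + s0 * x) (a1 + y) (a2 + z) (a3 + w) L ->
  lap (fun x y z w => g (a0 + s0 * x) (a1 + y) (a2 + z) (a3 + w)) x y z w L.
Proof.
  intros Hs [d0 [d1 [d2 [d3 [e0 [e1 [e2 [e3 [A0 [A1 [A2 [A3 HL]]]]]]]]]]]].
  exists (s0 * d0), d1, d2, d3, e0, e1, e2, e3.
  repeat split; auto.
  - apply D2_affine in A0. rewrite Hs, Rmult_1_l in A0. exact A0.
  - replace (a1 + y) with (a1 + 1 * y) in A1 by ring. apply D2_affine in A1.
    rewrite !Rmult_1_l in A1.
    apply (D2_ext_loc (fun t => g (a0 + s0 * x) (a1 + 1 * t) (a2 + z) (a3 + w))); auto.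
    apply filter_forall. intros; rewrite Rmult_1_l; auto.
  - replace (a2 + z) with (a2 + 1 * z) in A2 by ring. apply D2_affine in A2.
    rewrite !Rmult_1_l in A2.
    apply (D2_ext_loc (fun t => g (a0 + s0 * x) (a1 + y) (a2 + 1 * t) (a3 + w))); auto.
    apply filter_forall. intros; rewrite Rmult_1_l; auto.
  - replace (a3 + w) with (a3 + 1 * w) in A3 by ring. apply D2_affine in A3.
    rewrite !Rmult_1_l in A3.
    apply (D2_ext_loc (fun t => g (a0 + s0 * x) (a1 + y) (a2 + z) (a3 + 1 * t))); auto.
    apply filter_forall. intros; rewrite Rmult_1_l; auto.
Qed.

(** * Poles and removable singularities *)

Definition pt := (R * R * R * R)%type.

Definition dist2 (p : pt) (x y z w : R) : R :=
  let '(a, b, c, d) := p in (x - a) ^ 2 + (y - b) ^ 2 + (z - c) ^ 2 + (w - d) ^ 2.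

Definition pole (S : list pt) : rfn := fun x y z w =>
  fold_right (fun p acc => / dist2 p x y z w + acc) 0 S.

Lemma pow2_gt_0 (s : R) : s <> 0 -> 0 < s ^ 2.
Proof. intros H. pose proof (pow2_ge_0 s). pose proof (pow_nonzero s 2 H). lra. Qed.

Lemma dist2_pos (p : pt) (x y z w : R) : p <> (x, y, z, w) -> 0 < dist2 p x y z w.
Proof.
  destruct p as [[[a b] c] d]. unfold dist2. intros H.
  pose proof (pow2_ge_0 (x - a)). pose proof (pow2_ge_0 (y - b)).
  pose proof (pow2_ge_0 (z - c)). pose proof (pow2_ge_0 (w - d)).
  destruct (Req_dec (x - a) 0) as [Hx | Hx]; [|apply pow2_gt_0 in Hx; lra].
  destruct (Req_dec (y - b) 0) as [Hy | Hy]; [|apply pow2_gt_0 in Hy; lra].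
  destruct (Req_dec (z - c) 0) as [Hz | Hz]; [|apply pow2_gt_0 in Hz; lra].
  destruct (Req_dec (w - d) 0) as [Hw | Hw]; [|apply pow2_gt_0 in Hw; lra].
  exfalso. apply H. repeat f_equal; lra.
Qed.

Lemma dist2_inv_nonneg (p : pt) (x y z w : R) : 0 <= / dist2 p x y z w.
Proof.
  assert (H : 0 <= dist2 p x y z w).
  { destruct p as [[[a b] c] d]. unfold dist2.
    pose proof (pow2_ge_0 (x - a)). pose proof (pow2_ge_0 (y - b)).
    pose proof (pow2_ge_0 (z - c)). pose proof (pow2_ge_0 (w - d)). lra. }
  (* At the point itself the inverse is [/ 0 = 0], so the bound still holds. *)
  destruct H as [H | H]. left; apply Rinv_0_lt_compat; auto. rewrite <- H, Rinv_0; lra.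
Qed.

Lemma pole_nonneg (S : list pt) (x y z w : R) : 0 <= pole S x y z w.
Proof.
  induction S as [|p S IH]; simpl; [lra|].
  pose proof (dist2_inv_nonneg p x y z w). unfold pole in *. simpl. lra.
Qed.

Lemma pole_ge (S : list pt) (p : pt) (x y z w : R) :
  In p S -> / dist2 p x y z w <= pole S x y z w.
Proof.
  induction S as [|q S IH]; simpl; [tauto|]. intros [H | H].
  - subst q. pose proof (pole_nonneg S x y z w). unfold pole in *; simpl; lra.
  - specialize (IH H). pose proof (dist2_inv_nonneg q x y z w). unfold pole in *; simpl; lra.
Qed.

Lemma cont4_dist2 (p : pt) (x y z w : R) : cont4 (dist2 p) x y z w.
Proof.
  destruct p as [[[a b] c] d]. unfold dist2. simpl.
  cont4_tac.
Qed.

Lemma cont4_pole (S : list pt) (x y z w : R) :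
  ~ In (x, y, z, w) S -> cont4 (pole S) x y z w.
Proof.
  induction S as [|p S IH]; simpl; intros H.
  - apply cont4_const.
  - apply (cont4_plus (fun x y z w => / dist2 p x y z w) (pole S)); [|tauto].
    apply cont4_comp. apply cont4_dist2.
    assert (0 < dist2 p x y z w) by (apply dist2_pos; tauto).
    apply (ex_derive_continuous Rinv). auto_derive. lra.
Qed.

Lemma D2_inv_quadratic (a m x : R) : 0 < m + (x - a) ^ 2 ->
  D2 (fun t => / (m + (t - a) ^ 2)) x (- 2 * (x - a) / (m + (x - a) ^ 2) ^ 2)
    (- 2 / (m + (x - a) ^ 2) ^ 2 + 8 * (x - a) ^ 2 / (m + (x - a) ^ 2) ^ 3).
Proof.
  intros H. exists (fun t => - 2 * (t - a) / (m + (t - a) ^ 2) ^ 2).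
  split; [|split]; auto.
  - assert (Hc : continuous (fun t => m + (t - a) ^ 2) x)
      by (apply (ex_derive_continuous (fun t => m + (t - a) ^ 2)); auto_derive; auto).
    pose proof (Hc _ (open_gt 0 _ H)) as K. unfold filtermap in K. revert K. apply filter_imp. intros t Ht.
    auto_derive. simpl in *. lra. field. simpl in *; lra.
  - auto_derive. simpl in *. nra. field. simpl in *; lra.
Qed.

(** With [r] the squared distance, the four terms [-2 / r^2] add up to [-8 / r^2] and the terms
    [8 s^2 / r^3] to [8 / r^2]; the cancellation is special to four coordinates. *)
Lemma lap_inv_dist2 (p : pt) (x y z w : R) : p <> (x, y, z, w) ->
  lap (fun x y z w => / dist2 p x y z w) x y z w 0.
Proof.
  intros H. pose proof (dist2_pos _ _ _ _ _ H) as Hp. revert Hp.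
  destruct p as [[[a b] c] d]. unfold dist2.
  set (r := (x - a) ^ 2 + (y - b) ^ 2 + (z - c) ^ 2 + (w - d) ^ 2). intros Hp.
  assert (E : forall s v m, m + (s - v) ^ 2 = r ->
    D2 (fun t => / (m + (t - v) ^ 2)) s (- 2 * (s - v) / r ^ 2)
      (- 2 / r ^ 2 + 8 * (s - v) ^ 2 / r ^ 3)).
  { intros s v m E. rewrite <- E. apply D2_inv_quadratic. lra. }
  exists (- 2 * (x - a) / r ^ 2), (- 2 * (y - b) / r ^ 2), (- 2 * (z - c) / r ^ 2), (- 2 * (w - d) / r ^ 2),
    (- 2 / r ^ 2 + 8 * (x - a) ^ 2 / r ^ 3), (- 2 / r ^ 2 + 8 * (y - b) ^ 2 / r ^ 3),
    (- 2 / r ^ 2 + 8 * (z - c) ^ 2 / r ^ 3), (- 2 / r ^ 2 + 8 * (w - d) ^ 2 / r ^ 3).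
  split; [|split; [|split; [|split]]].
  - eapply D2_ext_loc; [|apply (E x a (r - (x - a) ^ 2)); ring].
    apply filter_forall; intros; f_equal; unfold r; ring.
  - eapply D2_ext_loc; [|apply (E y b (r - (y - b) ^ 2)); ring].
    apply filter_forall; intros; f_equal; unfold r; ring.
  - eapply D2_ext_loc; [|apply (E z c (r - (z - c) ^ 2)); ring].
    apply filter_forall; intros; f_equal; unfold r; ring.
  - eapply D2_ext_loc; [|apply (E w d (r - (w - d) ^ 2)); ring].
    apply filter_forall; intros; f_equal; unfold r; ring.
  - replace ((x - a) ^ 2) with (r - (y - b) ^ 2 - (z - c) ^ 2 - (w - d) ^ 2) by (unfold r; ring).
    field. lra.
Qed.

Lemma lap_const (c x y z w : R) : lap (fun _ _ _ _ => c) x y z w 0.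
Proof.
  exists 0, 0, 0, 0, 0, 0, 0, 0. repeat split; try apply D2_const. ring.
Qed.

Lemma lap_pole (S : list pt) (x y z w : R) :
  ~ In (x, y, z, w) S -> lap (pole S) x y z w 0.
Proof.
  induction S as [|p S IH]; simpl; intros H.
  - apply lap_const.
  - replace 0 with (0 + 0) by ring.
    apply (lap_plus (fun x y z w => / dist2 p x y z w) (pole S)); [|tauto].
    apply lap_inv_dist2. tauto.
Qed.

Lemma near_avoids (S : list pt) (x y z w : R) : ~ In (x, y, z, w) S ->
  exists d, 0 < d /\ forall x' y' z' w', near4 d x y z w x' y' z' w' -> ~ In (x', y', z', w') S.
Proof.
  induction S as [|p S IH]; intros H.
  - exists 1. split. lra. intros; simpl; tauto.
  - destruct IH as [d [Hd IH]]. { intros K. apply H. right; auto. }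
    assert (Hp : p <> (x, y, z, w)) by (intros K; apply H; left; auto).
    destruct (cont4_dist2 p x y z w _ (dist2_pos _ _ _ _ _ Hp)) as [d' [Hd' H']].
    exists (Rmin d d'). split. apply Rmin_glb_lt; auto.
    intros x' y' z' w' [H1 [H2 [H3 H4]]] [K | K].
    + pose proof (Rmin_r d d').
      assert (Hn : near4 d' x y z w x' y' z' w') by (unfold near4; repeat split; lra).
      specialize (H' _ _ _ _ Hn). subst p. unfold dist2 in H' at 1.
      apply Rabs_def2 in H'. lra.
    + pose proof (Rmin_l d d'). revert K. apply IH. unfold near4; repeat split; lra.
Qed.

Lemma lap_square_norm (c Q x y z w : R) :
  lap (fun x y z w => c * (x ^ 2 + y ^ 2 + z ^ 2 + w ^ 2 - Q)) x y z w (8 * c).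
Proof.
  replace (8 * c) with (c * 8) by ring. apply lap_scal.
  assert (E : forall m s, D2 (fun t => t ^ 2 + m) s (2 * s) 2).
  { intros m s. apply (D2_intro _ (fun t => 2 * t)); auto; intros; auto_derive; auto; ring. }
  exists (2 * x), (2 * y), (2 * z), (2 * w), 2, 2, 2, 2. split; [|split; [|split; [|split]]].
  - eapply D2_ext_loc; [|apply (E (y ^ 2 + z ^ 2 + w ^ 2 - Q))]. apply filter_forall; intros; ring.
  - eapply D2_ext_loc; [|apply (E (x ^ 2 + z ^ 2 + w ^ 2 - Q))]. apply filter_forall; intros; ring.
  - eapply D2_ext_loc; [|apply (E (x ^ 2 + y ^ 2 + w ^ 2 - Q))]. apply filter_forall; intros; ring.
  - eapply D2_ext_loc; [|apply (E (x ^ 2 + y ^ 2 + z ^ 2 - Q))]. apply filter_forall; intros; ring.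
  - ring.
Qed.

Lemma pow2_le_between (a b x : R) : a <= x <= b -> x ^ 2 <= a ^ 2 + b ^ 2.
Proof.
  intros [H1 H2]. pose proof (pow2_ge_0 a). pose proof (pow2_ge_0 b).
  destruct (Rle_or_lt 0 x).
  - assert (x ^ 2 <= b ^ 2) by (apply pow_incr; lra). lra.
  - assert ((- x) ^ 2 <= (- a) ^ 2) by (apply pow_incr; lra).
    replace ((- x) ^ 2) with (x ^ 2) in * by ring. replace ((- a) ^ 2) with (a ^ 2) in * by ring. lra.
Qed.

(* Isolated singularities do not matter for functions bounded above, since the
   poles 1/|p - s|^2 are harmonic in dimension four. *)
Lemma max_principle (a b l B : R) (g : rfn) (S : list pt) :
  (forall x y z w, in_box a b l x y z w -> ~ In (x, y, z, w) S -> cont4 g x y z w) ->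
  (forall x y z w, in_open_box a b l x y z w -> ~ In (x, y, z, w) S ->
     exists L, lap g x y z w L /\ 0 <= L) ->
  (forall x y z w, in_box a b l x y z w -> ~ In (x, y, z, w) S -> g x y z w <= B) ->
  (forall x y z w, in_box a b l x y z w -> ~ In (x, y, z, w) S ->
     ~ in_open_box a b l x y z w -> g x y z w <= 0) ->
  forall x y z w, in_box a b l x y z w -> ~ In (x, y, z, w) S -> g x y z w <= 0.
Proof.
  intros Hc Hl HB Hbd x0 y0 z0 w0 Hb0 HS0.
  destruct (Rle_or_lt (g x0 y0 z0 w0) 0) as [H | Hpos]; auto. exfalso.
  set (eta := g x0 y0 z0 w0) in *.
  (* [Q] dominates the squared norm on the box, so a small multiple of [|p|^2 - Q] makes the
     Laplacian strictly positive without raising the function. *)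
  set (Q := a ^ 2 + b ^ 2 + 6 * l ^ 2).
  assert (HQ : forall x y z w, in_box a b l x y z w -> x ^ 2 + y ^ 2 + z ^ 2 + w ^ 2 - Q <= 0).
  { intros x y z w [H1 [H2 [H3 H4]]]. unfold Q.
    apply pow2_le_between in H1, H2, H3, H4.
    replace ((- l) ^ 2) with (l ^ 2) in * by ring. lra. }
  set (q0 := x0 ^ 2 + y0 ^ 2 + z0 ^ 2 + w0 ^ 2 - Q).
  set (P0 := pole S x0 y0 z0 w0).
  assert (Hq0 : q0 <= 0) by (apply HQ; auto).
  assert (HP0 : 0 <= P0) by apply pole_nonneg.
  (* At the chosen point the quadratic term and the poles cost at most [eta / 4] each, so the
     perturbed function stays positive there. *)
  set (del := eta / (4 * (1 - q0))). set (eps := eta / (4 * (1 + P0))).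
  assert (Hdel : 0 < del) by (apply Rdiv_lt_0_compat; lra).
  assert (Heps : 0 < eps) by (apply Rdiv_lt_0_compat; lra).
  assert (Hdq : - del * q0 <= eta / 4).
  { unfold del. apply Rmult_le_reg_r with (1 - q0). lra.
    replace (- (eta / (4 * (1 - q0))) * q0 * (1 - q0)) with (eta / 4 * (- q0)) by (field; lra). nra. }
  assert (HeP : eps * P0 <= eta / 4).
  { unfold eps. apply Rmult_le_reg_r with (1 + P0). lra.
    replace (eta / (4 * (1 + P0)) * P0 * (1 + P0)) with (eta / 4 * P0) by (field; lra). nra. }
  set (G := fun x y z w => g x y z w +
     (del * (x ^ 2 + y ^ 2 + z ^ 2 + w ^ 2 - Q) + (- eps) * pole S x y z w)).
  assert (HG : forall x y z w, in_box a b l x y z w -> G x y z w <= g x y z w - eps * pole S x y z w).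
  { intros x y z w Hb. unfold G. specialize (HQ _ _ _ _ Hb). nra. }
  assert (HG' : forall x y z w, in_box a b l x y z w -> G x y z w <= g x y z w).
  { intros x y z w Hb. specialize (HG _ _ _ _ Hb). pose proof (pole_nonneg S x y z w). nra. }
  assert (HG0 : G x0 y0 z0 w0 <= 0).
  { apply (strict_max_principle a b l G (fun x y z w => In (x, y, z, w) S)); auto.
    - intros x y z w Hb HS N.
      (* The radius below is at most 1, so squares of coordinate differences do not exceed it. Hence
         the squared distance is at most [eps / K], and the pole term is at least [K], which exceeds
         [B - N]. *)
      set (K := Rabs (B - N) + 1).
      assert (HK : 1 <= K) by (unfold K; pose proof (Rabs_pos (B - N)); lra).
      exists (Rmin 1 (eps / (4 * K))).
      assert (0 < eps / (4 * K)) by (apply Rdiv_lt_0_compat; lra).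
      split. apply Rmin_glb_lt; lra.
      intros x' y' z' w' Hb' HS' [H1 [H2 [H3 H4]]].
      specialize (HG _ _ _ _ Hb'). specialize (HB _ _ _ _ Hb' HS').
      assert (HD : 0 < dist2 (x, y, z, w) x' y' z' w').
      { apply dist2_pos. intros E. apply HS'. rewrite <- E. auto. }
      assert (HD' : dist2 (x, y, z, w) x' y' z' w' <= eps / K).
      { set (d := Rmin 1 (eps / (4 * K))) in *.
        assert (Hd1 : d <= 1) by apply Rmin_l.
        assert (Hd2 : d <= eps / (4 * K)) by apply Rmin_r.
        unfold dist2.
        assert (T : forall s, Rabs s < d -> s ^ 2 <= d).
        { intros s Hs. rewrite <- (pow2_abs s). pose proof (Rabs_pos s). nra. }
        apply T in H1, H2, H3, H4.
        replace (eps / K) with (4 * (eps / (4 * K))) by (field; lra). lra. }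
      assert (HE : K <= eps * / dist2 (x, y, z, w) x' y' z' w').
      { apply Rmult_le_reg_r with (dist2 (x, y, z, w) x' y' z' w'); auto.
        rewrite Rmult_assoc, Rinv_l by lra.
        apply Rmult_le_compat_l with (r := K) in HD'; [|lra].
        replace (K * (eps / K)) with eps in HD' by (field; lra). lra. }
      pose proof (pole_ge S _ x' y' z' w' HS).
      pose proof (Rle_abs (B - N)). unfold K in *. nra.
    - intros x y z w Hb HS. split; [|apply near_avoids; auto].
      apply cont4_plus; [auto|]. apply cont4_plus; apply cont4_mult; try apply cont4_const;
        [|apply cont4_pole; auto].
      simpl. cont4_tac.
    - intros x y z w Ho HS. destruct (Hl _ _ _ _ Ho HS) as [L [HL HLp]].
      exists (L + (8 * del + (- eps) * 0)). split; [|lra].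
      apply lap_plus; auto. apply lap_plus. apply lap_square_norm.
      apply lap_scal. apply lap_pole; auto.
    - intros x y z w Hb HS Ho. specialize (Hbd _ _ _ _ Hb HS Ho).
      specialize (HG' _ _ _ _ Hb). lra. }
  unfold G in HG0. fold q0 in HG0. fold P0 in HG0. fold eta in HG0. lra.
Qed.

(** * Liouville: differences of harmonic functions *)

Definition harm_off (S : list pt) (u : rfn) : Prop :=
  forall x y z w, ~ In (x, y, z, w) S -> cont4 u x y z w /\ lap u x y z w 0.

Lemma pt_eq (a b c d x y z w : R) : a = x -> b = y -> c = z -> d = w -> (a, b, c, d) = (x, y, z, w).
Proof. intros; subst; auto. Qed.

(** The coefficient -3 balances the three squares of the other coordinates; the coefficient 4 then
    makes the value 1 at [x = l]. *)
Lemma lap_barrier (l x y z w : R) : l <> 0 ->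
  lap (fun x y z w => 4 * x / l - 3 * x ^ 2 / l ^ 2 + (y ^ 2 + z ^ 2 + w ^ 2) / l ^ 2) x y z w 0.
Proof.
  intros Hl.
  assert (E : forall p q r s, D2 (fun t => p + q * t + r * t ^ 2) s (q + 2 * r * s) (2 * r)).
  { intros p q r s. apply (D2_intro _ (fun t => q + 2 * r * t)); auto; intros; auto_derive; auto; ring. }
  exists (4 / l + 2 * (- 3 / l ^ 2) * x), (0 + 2 * / l ^ 2 * y), (0 + 2 * / l ^ 2 * z), (0 + 2 * / l ^ 2 * w),
    (2 * (- 3 / l ^ 2)), (2 * / l ^ 2), (2 * / l ^ 2), (2 * / l ^ 2).
  split; [|split; [|split; [|split]]].
  - eapply D2_ext_loc; [|apply (E ((y ^ 2 + z ^ 2 + w ^ 2) / l ^ 2))].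
    apply filter_forall; intros; field; auto.
  - eapply D2_ext_loc; [|apply (E (4 * x / l - 3 * x ^ 2 / l ^ 2 + (z ^ 2 + w ^ 2) / l ^ 2))].
    apply filter_forall; intros; field; auto.
  - eapply D2_ext_loc; [|apply (E (4 * x / l - 3 * x ^ 2 / l ^ 2 + (y ^ 2 + w ^ 2) / l ^ 2))].
    apply filter_forall; intros; field; auto.
  - eapply D2_ext_loc; [|apply (E (4 * x / l - 3 * x ^ 2 / l ^ 2 + (y ^ 2 + z ^ 2) / l ^ 2))].
    apply filter_forall; intros; field; auto.
  - field; auto.
Qed.

(** In units of [l] the barrier is [4 p - 3 p^2 + q^2 + r^2 + s^2], and [4 p - 3 p^2 >= p] on
    [[0, 1]]; on each side face one of the squares is at least 1. The face [x = 0] is the mirror,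
    where the function to be compared vanishes. *)
Lemma barrier_ge (l x y z w : R) : 0 < l -> in_box 0 l l x y z w ->
  0 <= 4 * x / l - 3 * x ^ 2 / l ^ 2 + (y ^ 2 + z ^ 2 + w ^ 2) / l ^ 2 /\
  (x <> 0 -> ~ in_open_box 0 l l x y z w ->
   1 <= 4 * x / l - 3 * x ^ 2 / l ^ 2 + (y ^ 2 + z ^ 2 + w ^ 2) / l ^ 2).
Proof.
  intros Hl [H1 [H2 [H3 H4]]].
  assert (E : exists p q r s, x = p * l /\ y = q * l /\ z = r * l /\ w = s * l).
  { exists (x / l), (y / l), (z / l), (w / l). repeat split; field; lra. }
  destruct E as [p [q [r [s [Ex [Ey [Ez Ew]]]]]]]. subst x y z w.
  replace (4 * (p * l) / l - 3 * (p * l) ^ 2 / l ^ 2 + ((q * l) ^ 2 + (r * l) ^ 2 + (s * l) ^ 2) / l ^ 2)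
    with (4 * p - 3 * p ^ 2 + q ^ 2 + r ^ 2 + s ^ 2) by (field; lra).
  assert (Hp : 0 <= p <= 1) by nra.
  pose proof (pow2_ge_0 q). pose proof (pow2_ge_0 r). pose proof (pow2_ge_0 s).
  assert (Hp' : p <= 4 * p - 3 * p ^ 2) by nra.
  split; [lra|]. intros Hx Ho.
  assert (T : forall v, - l <= v * l <= l -> ~ (- l < v * l < l) -> 1 <= v ^ 2).
  { intros v Hv Hn. destruct (Rle_or_lt l (v * l)) as [K | K].
    - assert (1 <= v) by nra. nra.
    - assert (v <= -1) by (apply Rmult_le_reg_r with l; lra). nra. }
  destruct (classic (- l < q * l < l)) as [Hq | Hq]; [|apply T in Hq; auto; lra].
  destruct (classic (- l < r * l < l)) as [Hr | Hr]; [|apply T in Hr; auto; lra].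
  destruct (classic (- l < s * l < l)) as [Hs | Hs]; [|apply T in Hs; auto; lra].
  assert (p * l = l). { apply NNPP. intros K. apply Ho. unfold in_open_box. repeat split; lra. }
  nra.
Qed.

(* The difference of [u] and its mirror image in the hyperplane through the
   centre vanishes on that hyperplane, and is compared there with a barrier. *)
Lemma reflection_bound_one_sided (u : rfn) (S : list pt) (c0 c1 c2 c3 l M s sg : R) :
  harm_off S u -> 0 < l -> 0 <= s <= l -> 0 <= M -> Rabs sg = 1 ->
  (forall x y z w, Rabs (x - c0) <= l -> Rabs (y - c1) <= l -> Rabs (z - c2) <= l ->
     Rabs (w - c3) <= l -> ~ In (x, y, z, w) S -> Rabs (u x y z w) <= M) ->
  ~ In (c0 + s, c1, c2, c3) S -> ~ In (c0 - s, c1, c2, c3) S ->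
  sg * (u (c0 + s) c1 c2 c3 - u (c0 - s) c1 c2 c3) <= 8 * M * s / l.
Proof.
  intros Hu Hl Hs HM Hsg Hbd Hin1 Hin2.
  (* The singularities of [u] and their mirror images, in coordinates centred at [c]. *)
  set (T := map (fun p : pt => let '(a, b, c, d) := p in (a - c0, b - c1, c - c2, d - c3)) S ++
            map (fun p : pt => let '(a, b, c, d) := p in (c0 - a, b - c1, c - c2, d - c3)) S).
  assert (HT1 : forall x y z w, ~ In (x, y, z, w) T -> ~ In (c0 + 1 * x, c1 + y, c2 + z, c3 + w) S).
  { intros x y z w H K. apply H. apply in_or_app. left.
    apply (in_map (fun p : pt => let '(a, b, c, d) := p in (a - c0, b - c1, c - c2, d - c3))) in K.
    cbv beta iota in K.
    replace (x, y, z, w) with (c0 + 1 * x - c0, c1 + y - c1, c2 + z - c2, c3 + w - c3); auto.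
    apply pt_eq; ring. }
  assert (HT2 : forall x y z w, ~ In (x, y, z, w) T -> ~ In (c0 + (-1) * x, c1 + y, c2 + z, c3 + w) S).
  { intros x y z w H K. apply H. apply in_or_app. right.
    apply (in_map (fun p : pt => let '(a, b, c, d) := p in (c0 - a, b - c1, c - c2, d - c3))) in K.
    cbv beta iota in K.
    replace (x, y, z, w) with (c0 - (c0 + -1 * x), c1 + y - c1, c2 + z - c2, c3 + w - c3); auto.
    apply pt_eq; ring. }
  (* The difference of the two values of [u] is at most [2 M], so [2 M] times the barrier dominates
     it on the faces away from the mirror. *)
  set (g := fun x y z w => (sg * u (c0 + 1 * x) (c1 + y) (c2 + z) (c3 + w) +
      (- sg) * u (c0 + (-1) * x) (c1 + y) (c2 + z) (c3 + w)) +
      (- (2 * M)) * (4 * x / l - 3 * x ^ 2 / l ^ 2 + (y ^ 2 + z ^ 2 + w ^ 2) / l ^ 2)).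
  assert (HuM : forall x y z w, in_box 0 l l x y z w -> ~ In (x, y, z, w) T ->
    Rabs (u (c0 + 1 * x) (c1 + y) (c2 + z) (c3 + w)) <= M /\
    Rabs (u (c0 + (-1) * x) (c1 + y) (c2 + z) (c3 + w)) <= M).
  { intros x y z w [H1 [H2 [H3 H4]]] HT.
    split; apply Hbd; auto; apply Rabs_le; lra. }
  assert (Hup : forall x y z w, in_box 0 l l x y z w -> ~ In (x, y, z, w) T ->
     sg * u (c0 + 1 * x) (c1 + y) (c2 + z) (c3 + w) +
      (- sg) * u (c0 + (-1) * x) (c1 + y) (c2 + z) (c3 + w) <= 2 * M).
  { intros x y z w Hb HT. destruct (HuM _ _ _ _ Hb HT) as [K1 K2].
    assert (V : forall v, Rabs v <= M -> sg * v <= M /\ (- sg) * v <= M).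
    { intros v Hv. assert (Rabs (sg * v) <= M) by (rewrite Rabs_mult, Hsg; lra).
      apply Rabs_le_between in H. lra. }
    apply V in K1, K2. lra. }
  assert (HG : g s 0 0 0 <= 0).
  { apply (max_principle 0 l l (2 * M) g T).
    - intros x y z w Hb HT. unfold g.
      apply cont4_plus; [apply cont4_plus|]; apply cont4_mult; try apply cont4_const.
      + apply (cont4_affine u c0 1 c1 c2 c3). apply Rabs_R1. apply Hu; auto.
      + apply (cont4_affine u c0 (-1) c1 c2 c3). rewrite Rabs_left; lra. apply Hu; auto.
      + unfold Rdiv. simpl.
        cont4_tac.
    - intros x y z w Ho HT. exists ((sg * 0 + (- sg) * 0) + (- (2 * M)) * 0). split; [|lra].
      apply lap_plus; [apply lap_plus|]; apply lap_scal.
      + apply lap_affine. ring. apply Hu; auto.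
      + apply lap_affine. ring. apply Hu; auto.
      + apply lap_barrier. lra.
    - intros x y z w Hb HT. unfold g. specialize (Hup _ _ _ _ Hb HT).
      destruct (barrier_ge _ _ _ _ _ Hl Hb) as [K _]. nra.
    - intros x y z w Hb HT Ho. unfold g. specialize (Hup _ _ _ _ Hb HT).
      destruct (barrier_ge _ _ _ _ _ Hl Hb) as [K1 K2].
      destruct (Req_dec x 0) as [Hx | Hx].
      + subst x. replace (c0 + -1 * 0) with (c0 + 1 * 0) by ring. nra.
      + specialize (K2 Hx Ho). nra.
    - unfold in_box; lra.
    - unfold T. intros K. apply in_app_or in K. destruct K as [K | K]; apply in_map_iff in K;
      destruct K as [[[[a b] c] d] [E K]]; inversion E.
      + apply Hin1. replace (c0 + s, c1, c2, c3) with (a, b, c, d); auto. apply pt_eq; lra.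
      + apply Hin2. replace (c0 - s, c1, c2, c3) with (a, b, c, d); auto. apply pt_eq; lra. }
  unfold g in HG.
  replace (c0 + 1 * s) with (c0 + s) in HG by ring. replace (c0 + -1 * s) with (c0 - s) in HG by ring.
  rewrite !Rplus_0_r in HG.
  (* At [(s, 0, 0, 0)] the barrier is at most [4 s / l]; times [2 M] this gives the constant 8. *)
  assert (4 * s / l - 3 * s ^ 2 / l ^ 2 + (0 ^ 2 + 0 ^ 2 + 0 ^ 2) / l ^ 2 <= 4 * s / l).
  { replace ((0 ^ 2 + 0 ^ 2 + 0 ^ 2) / l ^ 2) with 0 by (field; lra).
    assert (0 <= 3 * s ^ 2 / l ^ 2). { apply Rdiv_le_0_compat. nra. apply pow_lt; auto. } lra. }
  replace (8 * M * s / l) with (2 * M * (4 * s / l)) by (field; lra). nra.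
Qed.

Lemma reflection_bound (u : rfn) (S : list pt) (c0 c1 c2 c3 l M s : R) :
  harm_off S u -> 0 < l -> 0 <= s <= l -> 0 <= M ->
  (forall x y z w, Rabs (x - c0) <= l -> Rabs (y - c1) <= l -> Rabs (z - c2) <= l ->
     Rabs (w - c3) <= l -> ~ In (x, y, z, w) S -> Rabs (u x y z w) <= M) ->
  ~ In (c0 + s, c1, c2, c3) S -> ~ In (c0 - s, c1, c2, c3) S ->
  Rabs (u (c0 + s) c1 c2 c3 - u (c0 - s) c1 c2 c3) <= 8 * M * s / l.
Proof.
  intros Hu Hl Hs HM Hbd H1 H2.
  assert (E1 : Rabs (-1) = 1) by (rewrite Rabs_left; lra).
  pose proof (reflection_bound_one_sided u S c0 c1 c2 c3 l M s 1 Hu Hl Hs HM Rabs_R1 Hbd H1 H2).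
  pose proof (reflection_bound_one_sided u S c0 c1 c2 c3 l M s (-1) Hu Hl Hs HM E1 Hbd H1 H2).
  apply Rabs_le. lra.
Qed.

(** * Differences lower the growth exponent *)

Definition fwd (t : R) (u : rfn) : rfn := fun x y z w => u (x + t) y z w - u x y z w.

Definition shifted (t : R) (S : list pt) : list pt :=
  S ++ map (fun p : pt => let '(a, b, c, d) := p in (a - t, b, c, d)) S.

Lemma shifted_notin (t : R) (S : list pt) (x y z w : R) :
  ~ In (x, y, z, w) (shifted t S) -> ~ In (x, y, z, w) S /\ ~ In (x + t, y, z, w) S.
Proof.
  intros H. split; intros K; apply H; apply in_or_app; [left; auto | right].
  apply (in_map (fun p : pt => let '(a, b, c, d) := p in (a - t, b, c, d))) in K.
  cbv beta iota in K. replace (x, y, z, w) with (x + t - t, y, z, w); auto. apply pt_eq; ring.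
Qed.

Lemma cont4_fwd (t : R) (u : rfn) (x y z w : R) :
  cont4 u x y z w -> cont4 u (x + t) y z w -> cont4 (fwd t u) x y z w.
Proof.
  intros H1 H2. apply cont4_minus; auto.
  apply (cont4_ext_near (fun x y z w => u (t + 1 * x) (0 + y) (0 + z) (0 + w)) _ _ _ _ _ 1); try lra.
  - intros. f_equal; ring.
  - apply (cont4_affine u t 1 0 0 0). apply Rabs_R1.
    replace (t + 1 * x) with (x + t) by ring. rewrite !Rplus_0_l. auto.
Qed.

Lemma harm_off_fwd (t : R) (S : list pt) (u : rfn) :
  harm_off S u -> harm_off (shifted t S) (fwd t u).
Proof.
  intros Hu x y z w H. apply shifted_notin in H. destruct H as [H1 H2]. split.
  - apply cont4_fwd; apply Hu; auto.
  - apply (lap_ext_near (fun x y z w => u (t + 1 * x) (0 + y) (0 + z) (0 + w) + (-1) * u x y z w) _ _ _ _ _ 1); [lra| |].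
    { intros. unfold fwd. rewrite !Rplus_0_l.
      replace (t + 1 * x') with (x' + t) by ring. ring. }
    assert (K1 : lap (fun x y z w => u (t + 1 * x) (0 + y) (0 + z) (0 + w)) x y z w 0).
    { apply (lap_affine u t 1 0 0 0). ring.
      replace (t + 1 * x) with (x + t) by ring. rewrite !Rplus_0_l. apply Hu; auto. }
    pose proof (lap_scal (-1) _ _ _ _ _ _ (proj2 (Hu _ _ _ _ H1))) as K2.
    pose proof (lap_plus _ _ _ _ _ _ _ _ K1 K2) as K.
    rewrite Rmult_0_r, Rplus_0_l in K. exact K.
Qed.

Definition norm1 (x y z w : R) : R := Rabs x + Rabs y + Rabs z + Rabs w.

Lemma norm1_nonneg (x y z w : R) : 0 <= norm1 x y z w.
Proof.
  unfold norm1. pose proof (Rabs_pos x). pose proof (Rabs_pos y).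
  pose proof (Rabs_pos z). pose proof (Rabs_pos w). lra.
Qed.

Definition growth (S : list pt) (u : rfn) (C : R) (n : nat) : Prop :=
  forall x y z w, ~ In (x, y, z, w) S -> Rabs (u x y z w) <= C * (1 + norm1 x y z w) ^ n.

(** The mirror is put halfway between the points [x] and [x + t]. On a box of half-width [l] around
    the midpoint [norm1] increases by at most [t / 2 + 4 l], one [l] for each coordinate. *)
Lemma fwd_bound (t : R) (S : list pt) (u : rfn) (C l : R) (n : nat) (x y z w : R) :
  harm_off S u -> 0 <= C -> growth S u C n -> 0 < t -> t <= l ->
  ~ In (x, y, z, w) (shifted t S) ->
  Rabs (fwd t u x y z w) <= 4 * C * (1 + norm1 x y z w + t + 4 * l) ^ n * t / l.
Proof.
  intros Hu HC Hg Ht Hl Hin. apply shifted_notin in Hin. destruct Hin as [H1 H2].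
  set (M := C * (1 + norm1 x y z w + t + 4 * l) ^ n).
  assert (HM : 0 <= M).
  { unfold M. pose proof (norm1_nonneg x y z w). apply Rmult_le_pos; auto. apply pow_le. lra. }
  pose proof (reflection_bound u S (x + t / 2) y z w l M (t / 2) Hu) as K.
  replace (x + t / 2 + t / 2) with (x + t) in K by field.
  replace (x + t / 2 - t / 2) with x in K by field.
  unfold fwd. replace (4 * C * (1 + norm1 x y z w + t + 4 * l) ^ n * t / l)
    with (8 * M * (t / 2) / l) by (unfold M; field; lra).
  apply K; auto; try lra.
  intros x' y' z' w' E1 E2 E3 E4 Hin. specialize (Hg _ _ _ _ Hin).
  apply Rle_trans with (1 := Hg). unfold M. apply Rmult_le_compat_l; auto.
  apply pow_incr. pose proof (norm1_nonneg x' y' z' w'). split; [lra|].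
  unfold norm1.
  assert (T : forall a b, Rabs a <= Rabs b + Rabs (a - b)).
  { intros a b. replace a with (b + (a - b)) at 1 by ring. apply Rabs_triang. }
  pose proof (T x' (x + t / 2)). pose proof (T y' y). pose proof (T z' z). pose proof (T w' w).
  pose proof (Rabs_triang x (t / 2)). rewrite (Rabs_pos_eq (t / 2)) in * by lra. lra.
Qed.

(** The box grows with the point: [l = 1 + N + t] with [N] the norm keeps the bound on the box of
    order [(1 + N)^(n+1)], and the division by [l] removes one power. The constant comes from
    [5 (1 + N + t) <= (5 + 5 t) (1 + N)]. *)
Lemma growth_fwd (t : R) (S : list pt) (u : rfn) (C : R) (n : nat) :
  harm_off S u -> 0 <= C -> growth S u C (Datatypes.S n) -> 0 < t ->
  exists C', 0 <= C' /\ growth (shifted t S) (fwd t u) C' n.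
Proof.
  intros Hu HC Hg Ht. exists (4 * C * (5 + 5 * t) ^ (Datatypes.S n) * t).
  assert (0 <= (5 + 5 * t) ^ (Datatypes.S n)) by (apply pow_le; lra).
  split. { apply Rmult_le_pos; [apply Rmult_le_pos; [lra | assumption] | lra]. }
  intros x y z w Hin. pose proof (norm1_nonneg x y z w) as HN.
  set (N := norm1 x y z w) in *.
  assert (K : Rabs (fwd t u x y z w) <=
    4 * C * (1 + N + t + 4 * (1 + N + t)) ^ (Datatypes.S n) * t / (1 + N + t)).
  { apply (fwd_bound t S); auto. lra. }
  apply Rle_trans with (1 := K). clear K.
  apply Rle_trans with (4 * C * ((5 + 5 * t) * (1 + N)) ^ (Datatypes.S n) * t / (1 + N)).
  - apply Rmult_le_compat.
    + apply Rmult_le_pos; [|lra]. apply Rmult_le_pos; [lra|]. apply pow_le. lra.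
    + left. apply Rinv_0_lt_compat. lra.
    + apply Rmult_le_compat_r; [lra|]. apply Rmult_le_compat_l; [lra|]. apply pow_incr. nra.
    + apply Rinv_le_contravar; lra.
  - right. rewrite Rpow_mult_distr. simpl. field. lra.
Qed.

Lemma growth0_fwd (t : R) (S : list pt) (u : rfn) (C : R) (x y z w : R) :
  harm_off S u -> 0 <= C -> growth S u C 0 -> 0 < t -> ~ In (x, y, z, w) (shifted t S) ->
  fwd t u x y z w = 0.
Proof.
  intros Hu HC Hg Ht Hin. apply NNPP. intros Hne.
  set (v := Rabs (fwd t u x y z w)). assert (Hv : 0 < v) by (apply Rabs_pos_lt; auto).
  (* For a bounded function the estimate is [4 C t / l], and this [l] is large enough to push it
     below the supposed value [v]. *)
  set (l := t + 8 * C * t / v).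
  assert (0 <= 8 * C * t / v) by (apply Rdiv_le_0_compat; nra).
  assert (K : v <= 4 * C * (1 + norm1 x y z w + t + 4 * l) ^ 0 * t / l).
  { apply (fwd_bound t S); auto. unfold l; lra. }
  simpl in K.
  assert (Hl : 0 < l) by (unfold l; lra).
  apply Rmult_le_compat_r with (r := l) in K; [|lra].
  replace (4 * C * 1 * t / l * l) with (4 * C * t) in K by (field; lra).
  unfold l in K. replace (v * (t + 8 * C * t / v)) with (v * t + 8 * C * t) in K by (field; lra).
  nra.
Qed.

(** [n] differences bring the exponent down to 0 and one more gives zero. The exceptional set
    collects translates but stays finite. *)
Lemma liouville_differences (n : nat) : forall (t : R) (S : list pt) (u : rfn) (C : R),
  harm_off S u -> 0 <= C -> growth S u C n -> 0 < t ->
  exists T, forall x y z w, ~ In (x, y, z, w) T -> Nat.iter (Datatypes.S n) (fwd t) u x y z w = 0.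
Proof.
  induction n as [|n IH]; intros t S u C Hu HC Hg Ht.
  - exists (shifted t S). intros. apply (growth0_fwd t S u C); auto.
  - destruct (growth_fwd t S u C n Hu HC Hg Ht) as [C' [HC' Hg']].
    destruct (IH t (shifted t S) (fwd t u) C' (harm_off_fwd _ _ _ Hu) HC' Hg' Ht) as [T HT].
    exists T. intros x y z w H. rewrite Nat.iter_succ_r. apply HT; auto.
Qed.

Lemma right_avoids (S : list pt) (x y z w : R) :
  exists d, 0 < d /\ forall h, 0 < h < d -> ~ In (x + h, y, z, w) S.
Proof.
  induction S as [|[[[a b] c] e] S [d [Hd IH]]].
  - exists 1. split; [lra|]. simpl; tauto.
  - destruct (Rle_or_lt a x) as [H | H].
    + exists d. split; auto. intros h Hh [K | K]. inversion K; lra. revert K. apply IH; auto.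
    + exists (Rmin d (a - x)). split. apply Rmin_glb_lt; lra.
      intros h Hh. pose proof (Rmin_l d (a - x)). pose proof (Rmin_r d (a - x)).
      intros [K | K]. inversion K; lra. revert K. apply IH; lra.
Qed.

Lemma cont4_zero_off_finite (S : list pt) (g : rfn) (x y z w : R) :
  cont4 g x y z w -> (forall x y z w, ~ In (x, y, z, w) S -> g x y z w = 0) -> g x y z w = 0.
Proof.
  intros Hc H0. apply NNPP. intros Hne.
  destruct (Hc _ (Rabs_pos_lt _ Hne)) as [d [Hd H]].
  destruct (right_avoids S x y z w) as [d' [Hd' HS]].
  set (h := Rmin d d' / 2).
  assert (0 < Rmin d d') by (apply Rmin_glb_lt; auto).
  pose proof (Rmin_l d d'). pose proof (Rmin_r d d').
  specialize (H (x + h) y z w). rewrite H0 in H by (apply HS; unfold h; lra).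
  rewrite Rminus_0_l, Rabs_Ropp in H. apply (Rlt_irrefl (Rabs (g x y z w))). apply H.
  unfold near4. repeat split; try (apply Rabs_diag_lt; auto).
  replace (x + h - x) with h by ring. rewrite Rabs_pos_eq; unfold h; lra.
Qed.

Lemma liouville_continuous (n : nat) (t : R) (S : list pt) (u : rfn) (C : R) (x y z w : R) :
  harm_off S u -> (forall x y z w, cont4 u x y z w) -> 0 <= C -> growth S u C n -> 0 < t ->
  Nat.iter (Datatypes.S n) (fwd t) u x y z w = 0.
Proof.
  intros Hu Hc HC Hg Ht.
  destruct (liouville_differences n t S u C Hu HC Hg Ht) as [T HT].
  apply (cont4_zero_off_finite T); auto.
  assert (K : forall k x y z w, cont4 (Nat.iter k (fwd t) u) x y z w).
  { induction k; intros; simpl; auto. apply cont4_fwd; auto. }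
  apply K.
Qed.

(** * Frechet: vanishing differences and polynomials *)

Definition fd (t : R) (f : R -> R) : R -> R := fun x => f (x + t) - f x.

Lemma iter_fd_ext (n : nat) (t : R) (f g : R -> R) :
  (forall x, f x = g x) -> forall x, Nat.iter n (fd t) f x = Nat.iter n (fd t) g x.
Proof. intros E. induction n; simpl; auto. intros; unfold fd at 1 3; rewrite !IHn; auto. Qed.

Lemma iter_fd_lin (n : nat) (t c : R) (f g : R -> R) (x : R) :
  Nat.iter n (fd t) (fun x => f x + c * g x) x = Nat.iter n (fd t) f x + c * Nat.iter n (fd t) g x.
Proof. revert x. induction n; intros; simpl; auto. unfold fd at 1 3 5; rewrite !IHn; ring. Qed.

Lemma iter_fd_zero (n : nat) (t x : R) : Nat.iter n (fd t) (fun _ => 0) x = 0.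
Proof. revert x. induction n; intros; simpl; auto. unfold fd at 1; rewrite !IHn; ring. Qed.

Lemma iter_fd_shift (n : nat) (t s : R) (f : R -> R) (x : R) :
  Nat.iter n (fd t) (fun x => f (x + s)) x = Nat.iter n (fd t) f (x + s).
Proof.
  revert x. induction n; intros; simpl; auto. unfold fd at 1 3; rewrite !IHn.
  replace (x + t + s) with (x + s + t) by ring. auto.
Qed.

Lemma iter_fd_mono (n m : nat) (t : R) (f : R -> R) : (n <= m)%nat ->
  (forall x, Nat.iter n (fd t) f x = 0) -> forall x, Nat.iter m (fd t) f x = 0.
Proof.
  induction 1; intros H0; auto. intros x. simpl. unfold fd at 1. rewrite !IHle; auto. ring.
Qed.

(** Discrete Leibniz rule: the difference of [(x - c) d f] is [(x - c) d] times the difference of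
    [f], plus [t d f (x + t)]. So an affine factor costs one more difference. *)
Lemma iter_fd_affine_mult (n : nat) (t c d : R) : forall f : R -> R,
  (forall x, Nat.iter n (fd t) f x = 0) ->
  forall x, Nat.iter (S n) (fd t) (fun x => (x - c) * d * f x) x = 0.
Proof.
  induction n; intros f H x.
  - simpl in *. unfold fd. rewrite !H. ring.
  - rewrite Nat.iter_succ_r.
    rewrite (iter_fd_ext (S n) t _ (fun x => (x - c) * d * fd t f x + (t * d) * f (x + t))).
    2: { intros s. unfold fd. ring. }
    rewrite (iter_fd_lin (S n) t (t * d) (fun x => (x - c) * d * fd t f x) (fun x => f (x + t))).
    rewrite IHn. 2: { intros s. rewrite <- Nat.iter_succ_r. apply H. }
    rewrite iter_fd_shift, H. ring.
Qed.

Definition zdiff (a : Z -> R) : Z -> R := fun i => a (i + 1)%Z - a i.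

Lemma iter_zdiff_sum (n : nat) (a b : Z -> R) (i : Z) :
  Nat.iter n zdiff (fun i => a i + b i) i = Nat.iter n zdiff a i + Nat.iter n zdiff b i.
Proof. revert i. induction n; intros; simpl; auto. unfold zdiff at 1 3 5; rewrite !IHn; ring. Qed.

Lemma iter_zdiff_shift (n : nat) (a : Z -> R) (i : Z) :
  Nat.iter n zdiff (fun i => a (i + 1)%Z) i = Nat.iter n zdiff a (i + 1)%Z.
Proof. revert i. induction n; intros; simpl; auto. unfold zdiff at 1 3; rewrite !IHn; auto. Qed.

Lemma zdiff_zero_const (a : Z -> R) : (forall i, zdiff a i = 0) -> forall i, a i = a 0%Z.
Proof.
  intros H i. assert (E : forall i, a (i + 1)%Z = a i) by (intros j; specialize (H j); unfold zdiff in H; lra).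
  induction i using Z.peano_ind; auto.
  - rewrite <- Z.add_1_r, E; auto.
  - rewrite <- IHi. rewrite <- (E (Z.pred i)). f_equal. lia.
Qed.

Lemma zdiff_vanish (n : nat) : forall a : Z -> R,
  (forall i, Nat.iter n zdiff a i = 0) -> (forall j, (j < n)%nat -> a (Z.of_nat j) = 0) ->
  forall i, a i = 0.
Proof.
  induction n; intros a H H0 i; auto.
  rewrite (zdiff_zero_const a). { apply (H0 0%nat). lia. }
  apply IHn.
  - intros j. rewrite <- Nat.iter_succ_r. apply H.
  - intros j Hj. unfold zdiff. rewrite (H0 j) by lia.
    replace (Z.of_nat j + 1)%Z with (Z.of_nat (S j)) by lia. rewrite H0 by lia. ring.
Qed.

(* A sequence that is polynomial of degree [< n] and vanishes at the even
   integers vanishes: by induction it is 2-periodic, and then [zdiff] acts on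
   its differences as multiplication by [-2]. *)
Lemma zdiff_vanish_even (n : nat) : forall a : Z -> R,
  (forall i, Nat.iter n zdiff a i = 0) -> (forall i, a (2 * i)%Z = 0) -> forall i, a i = 0.
Proof.
  induction n; intros a H H0; auto.
  assert (Hp : forall i, zdiff a (i + 1)%Z + zdiff a i = 0).
  { apply (IHn (fun i => zdiff a (i + 1)%Z + zdiff a i)).
    - intros i. rewrite (iter_zdiff_sum n (fun i => zdiff a (i + 1)%Z)), iter_zdiff_shift.
      rewrite <- !Nat.iter_succ_r, !H. ring.
    - intros i. unfold zdiff.
      replace (2 * i + 1 + 1)%Z with (2 * (i + 1))%Z by lia. rewrite !H0. ring. }
  assert (Hm : forall m i, Nat.iter (S m) zdiff a i = (-2) ^ m * zdiff a i).
  { induction m; intros i. { simpl. ring. }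
    change (zdiff (Nat.iter (S m) zdiff a) i = (-2) ^ S m * zdiff a i).
    unfold zdiff at 1. rewrite !IHm. specialize (Hp i).
    simpl. replace (zdiff a (i + 1)) with (- zdiff a i) by lra. ring. }
  assert (Hz : forall i, zdiff a i = 0).
  { intros i. specialize (H i). rewrite Hm in H. apply Rmult_integral in H. destruct H; auto.
    exfalso. revert H. apply pow_nonzero. lra. }
  intros i. rewrite (zdiff_zero_const a Hz). apply (H0 0%Z).
Qed.

Lemma iter_fd_lattice (n : nat) (h : R) (f : R -> R) (i : Z) :
  Nat.iter n zdiff (fun i => f (IZR i * h)) i = Nat.iter n (fd h) f (IZR i * h).
Proof.
  revert i. induction n; intros; simpl; auto. unfold zdiff at 1; unfold fd at 1. rewrite !IHn.
  rewrite plus_IZR. replace ((IZR i + 1) * h) with (IZR i * h + h) by ring. auto.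
Qed.

(** Vanishing spreads from the nodes to all integers by [zdiff_vanish], to the dyadic numbers by
    halving the mesh with [zdiff_vanish_even], and to the whole line by continuity. *)
Lemma frechet_zero (n : nat) (f : R -> R) :
  (forall x, continuous f x) -> (forall t x, 0 < t -> Nat.iter n (fd t) f x = 0) ->
  (forall j, (j < n)%nat -> f (INR j) = 0) -> forall x, f x = 0.
Proof.
  intros Hc Hd H0.
  assert (Hlat : forall p i, f (IZR i * (/ 2) ^ p) = 0).
  { induction p; intros i.
    - simpl. apply (zdiff_vanish n (fun i => f (IZR i * 1))).
      + intros j. rewrite iter_fd_lattice. apply Hd. lra.
      + intros j Hj. rewrite <- INR_IZR_INZ, Rmult_1_r. auto.
    - apply (zdiff_vanish_even n (fun i => f (IZR i * (/ 2) ^ S p))).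
      + intros j. rewrite iter_fd_lattice. apply Hd. apply pow_lt. lra.
      + intros j. rewrite mult_IZR. simpl pow.
        replace (2 * IZR j * (/ 2 * (/ 2) ^ p)) with (IZR j * (/ 2) ^ p) by field. auto. }
  intros x. apply NNPP. intros Hne.
  pose proof (proj2 (continuity_pt_filterlim f x) (Hc x)) as K.
  destruct (K (Rabs (f x)) (Rabs_pos_lt _ Hne)) as [d [Hd0 Hdx]].
  destruct (pow_lt_1_zero (/ 2) ) with (y := d) as [p Hp]; auto.
  { rewrite Rabs_pos_eq; lra. }
  specialize (Hp p (Nat.le_refl p)).
  assert (Hpp : 0 < (/ 2) ^ p) by (apply pow_lt; lra).
  rewrite Rabs_pos_eq in Hp by lra.
  (* The lattice point just to the right of [x]; its distance to [x] is at most [2^(-p) < d]. *)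
  set (i := up (x / (/ 2) ^ p)).
  destruct (archimed (x / (/ 2) ^ p)) as [A1 A2]. fold i in A1, A2.
  assert (B1 : x < IZR i * (/ 2) ^ p).
  { apply Rmult_lt_reg_r with (/ (/ 2) ^ p). apply Rinv_0_lt_compat; auto.
    rewrite Rmult_assoc, Rinv_r by lra. unfold Rdiv in A1. lra. }
  assert (B2 : IZR i * (/ 2) ^ p - x <= (/ 2) ^ p).
  { apply Rmult_le_reg_r with (/ (/ 2) ^ p). apply Rinv_0_lt_compat; auto.
    rewrite Rmult_minus_distr_r, Rmult_assoc, Rinv_r by lra. unfold Rdiv in A2. lra. }
  specialize (Hdx (IZR i * (/ 2) ^ p)). simpl in Hdx. unfold Rdist in Hdx. rewrite Hlat in Hdx.
  rewrite Rminus_0_l, Rabs_Ropp in Hdx.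
  apply (Rlt_irrefl (Rabs (f x))). apply Hdx. split.
  - split. exact I. lra.
  - rewrite Rabs_pos_eq; lra.
Qed.

(** * Lagrange interpolation at the nodes 0, ..., n - 1 *)

Definition rsum (l : list nat) (f : nat -> R) : R := fold_right (fun j acc => f j + acc) 0 l.

(** Built one affine factor at a time, so that [iter_fd_affine_mult] bounds the degree by the length
    of the list. [lagrange] removes the node [j], whose factor would be degenerate. *)
Definition affine_prod (l : list nat) (j : nat) (x : R) : R :=
  fold_right (fun i acc => (x - INR i) * / (INR j - INR i) * acc) 1 l.

Definition lagrange (n j : nat) (x : R) : R :=
  affine_prod (filter (fun i => negb (Nat.eqb i j)) (seq 0 n)) j x.

Lemma affine_prod_self (l : list nat) (j : nat) : ~ In j l -> affine_prod l j (INR j) = 1.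
Proof.
  induction l as [|i l IH]; simpl; intros H; auto. rewrite IH by tauto.
  rewrite Rinv_r. ring. intros E. apply H. left. apply INR_eq. lra.
Qed.

Lemma affine_prod_root (l : list nat) (i j : nat) : In i l -> affine_prod l j (INR i) = 0.
Proof.
  induction l as [|i' l IH]; simpl; [tauto|]. intros [H | H].
  - subst. ring.
  - rewrite IH by auto. ring.
Qed.

Lemma affine_prod_degree (l : list nat) (j : nat) (t x : R) :
  Nat.iter (S (length l)) (fd t) (affine_prod l j) x = 0.
Proof.
  revert x. induction l as [|i l IH]; intros x.
  - simpl. unfold fd, affine_prod. simpl. ring.
  - apply (iter_fd_affine_mult (S (length l)) t (INR i) (/ (INR j - INR i)) (affine_prod l j)). auto.
Qed.

Lemma affine_prod_continuous (l : list nat) (j : nat) (x : R) : continuous (affine_prod l j) x.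
Proof.
  induction l as [|i l IH].
  - apply continuous_const.
  - apply (continuous_mult (fun x => (x - INR i) * / (INR j - INR i)) (affine_prod l j)); auto.
    apply (ex_derive_continuous (fun x => (x - INR i) * / (INR j - INR i))). auto_derive. auto.
Qed.

Lemma lagrange_self (n j : nat) : lagrange n j (INR j) = 1.
Proof.
  apply affine_prod_self. rewrite filter_In, Nat.eqb_refl. simpl. intros [_ H]; discriminate.
Qed.

Lemma lagrange_other (n i j : nat) : (i < n)%nat -> i <> j -> lagrange n j (INR i) = 0.
Proof.
  intros H1 H2. apply affine_prod_root. apply filter_In. split.
  - apply in_seq. lia.
  - apply Bool.negb_true_iff. apply Nat.eqb_neq. auto.
Qed.

Lemma filter_neq_length (j : nat) (l : list nat) : In j l ->
  (length (filter (fun i => negb (Nat.eqb i j)) l) < length l)%nat.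
Proof.
  induction l as [|i l IH]; simpl; [tauto|]. intros [H | H].
  - subst. rewrite Nat.eqb_refl. simpl. pose proof (filter_length_le (fun i => negb (i =? j)%nat) l). lia.
  - specialize (IH H). destruct (negb (i =? j)%nat); simpl; lia.
Qed.

Lemma lagrange_degree (n j : nat) (t x : R) : (j < n)%nat -> Nat.iter n (fd t) (lagrange n j) x = 0.
Proof.
  intros Hj. revert x. apply (iter_fd_mono (S (length (filter (fun i => negb (Nat.eqb i j)) (seq 0 n))))).
  - pose proof (filter_neq_length j (seq 0 n)) as H. rewrite length_seq in H. apply H. apply in_seq. lia.
  - intros x. apply affine_prod_degree.
Qed.

Lemma rsum_lagrange_node (l : list nat) (n i : nat) (f : nat -> R) : (i < n)%nat -> NoDup l ->
  rsum l (fun j => f j * lagrange n j (INR i)) = if in_dec Nat.eq_dec i l then f i else 0.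
Proof.
  intros Hi. induction 1 as [|j l Hj Hl IH]; auto.
  simpl rsum. rewrite IH. simpl.
  destruct (Nat.eq_dec j i) as [E | E].
  - subst j. rewrite lagrange_self. destruct (in_dec Nat.eq_dec i l); [contradiction|].
    ring.
  - rewrite lagrange_other by auto. destruct (in_dec Nat.eq_dec i l); ring.
Qed.

(** The difference of [f] and its interpolant vanishes at the nodes and inherits the other
    hypotheses of [frechet_zero]. *)
Lemma frechet (n : nat) (f : R -> R) :
  (forall x, continuous f x) -> (forall t x, 0 < t -> Nat.iter n (fd t) f x = 0) ->
  forall x, f x = rsum (seq 0 n) (fun j => f (INR j) * lagrange n j x).
Proof.
  intros Hc Hd x.
  assert (Hsc : forall l x, continuous (fun x => rsum l (fun j => f (INR j) * lagrange n j x)) x).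
  { induction l as [|j l IH]; intros s. apply continuous_const.
    apply (continuous_plus (fun x => f (INR j) * lagrange n j x)); auto.
    apply (continuous_mult (fun _ => f (INR j)) (lagrange n j)).
    apply continuous_const. apply affine_prod_continuous. }
  assert (Hsd : forall l t x, (forall j, In j l -> (j < n)%nat) ->
     Nat.iter n (fd t) (fun x => rsum l (fun j => f (INR j) * lagrange n j x)) x = 0).
  { induction l as [|j l IH]; intros t s Hl. apply iter_fd_zero.
    rewrite (iter_fd_ext n t _ (fun x => rsum l (fun j => f (INR j) * lagrange n j x)
       + f (INR j) * lagrange n j x)) by (intros; simpl; ring).
    rewrite (iter_fd_lin n t (f (INR j)) (fun x => rsum l (fun j => f (INR j) * lagrange n j x))
      (lagrange n j)).
    rewrite IH, lagrange_degree. ring. apply Hl; left; auto. intros; apply Hl; right; auto. }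
  assert (H : forall x, f x + (-1) * rsum (seq 0 n) (fun j => f (INR j) * lagrange n j x) = 0).
  { apply (frechet_zero n).
    - intros s. apply (continuous_plus f); auto.
      apply (continuous_mult (fun _ => -1) (fun x => rsum (seq 0 n) (fun j => f (INR j) * lagrange n j x))).
      apply continuous_const. auto.
    - intros t s Ht.
      rewrite (iter_fd_lin n t (-1) f (fun x => rsum (seq 0 n) (fun j => f (INR j) * lagrange n j x))).
      rewrite Hd by auto. rewrite Hsd. ring. intros j Hj. apply in_seq in Hj. lia.
    - intros i Hi. rewrite (rsum_lagrange_node _ _ _ (fun j => f (INR j))); auto using seq_NoDup.
      destruct (in_dec Nat.eq_dec i (seq 0 n)) as [K | K]. ring.
      exfalso. apply K. apply in_seq. lia. }
  specialize (H x). lra.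
Qed.

(** * Partial derivatives of C^2 functions *)

Definition rho (x y z w : R) : R := x ^ 2 + y ^ 2 + z ^ 2 + w ^ 2.

Lemma rho_nonneg (x y z w : R) : 0 <= rho x y z w.
Proof.
  unfold rho. pose proof (pow2_ge_0 x). pose proof (pow2_ge_0 y).
  pose proof (pow2_ge_0 z). pose proof (pow2_ge_0 w). lra.
Qed.

Lemma cont4_rho (x y z w : R) : cont4 rho x y z w.
Proof. unfold rho. simpl. cont4_tac. Qed.

Lemma rho_near (x y z w : R) : 0 < rho x y z w -> exists d, 0 < d /\
  forall x' y' z' w', near4 d x y z w x' y' z' w' -> 0 < rho x' y' z' w'.
Proof.
  intros H. destruct (cont4_rho x y z w _ H) as [d [Hd K]]. exists d. split; auto.
  intros x' y' z' w' Hn. specialize (K _ _ _ _ Hn). apply Rabs_def2 in K. lra.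
Qed.

(** Differentiates at the point itself, whereas [partial] differentiates a shifted slice at 0; this
    is the form that fits [D2]. *)
Definition pd (i : nat) (g : rfn) : rfn := fun x y z w =>
  match i with
  | O => Derive (fun t => g t y z w) x
  | 1%nat => Derive (fun t => g x t z w) y
  | 2%nat => Derive (fun t => g x y t w) z
  | _ => Derive (fun t => g x y z t) w
  end.

Definition ex_pd (i : nat) (g : rfn) (x y z w : R) : Prop :=
  match i with
  | O => ex_derive (fun t => g t y z w) x
  | 1%nat => ex_derive (fun t => g x t z w) y
  | 2%nat => ex_derive (fun t => g x y t w) z
  | _ => ex_derive (fun t => g x y z t) w
  end.

Lemma Derive_shift0 (f : R -> R) (x : R) : Derive (fun t => f (x + t)) 0 = Derive f x.
Proof.
  unfold Derive. f_equal. apply Lim_ext. intros h. rewrite Rplus_0_l, Rplus_0_r. auto.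
Qed.

Lemma ex_derive_shift0 (f : R -> R) (x : R) : ex_derive (fun t => f (x + t)) 0 <-> ex_derive f x.
Proof.
  split; intros [l Hl]; exists l; apply is_derive_Reals in Hl; apply is_derive_Reals;
  intros e He; destruct (Hl e He) as [d Hd]; exists d; intros h H1 H2; specialize (Hd h H1 H2);
  rewrite Rplus_0_l, Rplus_0_r in *; auto.
Qed.

Lemma partial_eq (i : nat) (G : fn) (x y z w : R) :
  partial i G x y z w = (pd i (fun x y z w => fst (G x y z w)) x y z w,
                         pd i (fun x y z w => snd (G x y z w)) x y z w).
Proof.
  unfold partial, pd, slice. destruct i as [|[|[|i]]]; f_equal.
  - apply (Derive_shift0 (fun t => fst (G t y z w))).
  - apply (Derive_shift0 (fun t => snd (G t y z w))).
  - apply (Derive_shift0 (fun t => fst (G x t z w))).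
  - apply (Derive_shift0 (fun t => snd (G x t z w))).
  - apply (Derive_shift0 (fun t => fst (G x y t w))).
  - apply (Derive_shift0 (fun t => snd (G x y t w))).
  - apply (Derive_shift0 (fun t => fst (G x y z t))).
  - apply (Derive_shift0 (fun t => snd (G x y z t))).
Qed.

Lemma ex_partial_iff (i : nat) (G : fn) (x y z w : R) :
  ex_partial i G x y z w <->
  ex_pd i (fun x y z w => fst (G x y z w)) x y z w /\ ex_pd i (fun x y z w => snd (G x y z w)) x y z w.
Proof.
  unfold ex_partial, ex_pd, slice. destruct i as [|[|[|i]]].
  - rewrite (ex_derive_shift0 (fun t => fst (G t y z w))), (ex_derive_shift0 (fun t => snd (G t y z w))). tauto.
  - rewrite (ex_derive_shift0 (fun t => fst (G x t z w))), (ex_derive_shift0 (fun t => snd (G x t z w))). tauto.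
  - rewrite (ex_derive_shift0 (fun t => fst (G x y t w))), (ex_derive_shift0 (fun t => snd (G x y t w))). tauto.
  - rewrite (ex_derive_shift0 (fun t => fst (G x y z t))), (ex_derive_shift0 (fun t => snd (G x y z t))). tauto.
Qed.

Lemma cont_at_iff (G : fn) (x y z w : R) :
  cont_at G x y z w <->
  cont4 (fun x y z w => fst (G x y z w)) x y z w /\ cont4 (fun x y z w => snd (G x y z w)) x y z w.
Proof.
  assert (E : forall a b : C, fst (Cminus a b) = fst a - fst b /\ snd (Cminus a b) = snd a - snd b).
  { intros [a1 a2] [b1 b2]. split; reflexivity. }
  split.
  - intros H. split; intros e He; destruct (H e He) as [d [Hd K]]; exists d; split; auto;
    intros x' y' z' w' [H1 [H2 [H3 H4]]]; specialize (K _ _ _ _ H1 H2 H3 H4);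
    eapply Rle_lt_trans; try exact K; eapply Rle_trans; try apply Rmax_Cmod;
    destruct (E (G x' y' z' w') (G x y z w)) as [E1 E2]; rewrite E1, E2.
    apply Rmax_l. apply Rmax_r.
  - intros [Hf Hs] e He. assert (He2 : 0 < e / 2) by lra.
    destruct (Hf _ He2) as [d [Hd K]]. destruct (Hs _ He2) as [d' [Hd' K']].
    exists (Rmin d d'). split. apply Rmin_glb_lt; auto.
    intros x' y' z' w' H1 H2 H3 H4. pose proof (Rmin_l d d'). pose proof (Rmin_r d d').
    specialize (K x' y' z' w'). specialize (K' x' y' z' w').
    set (D := Cminus (G x' y' z' w') (G x y z w)).
    destruct (E (G x' y' z' w') (G x y z w)) as [E1 E2]. fold D in E1, E2.
    replace D with (Cplus (RtoC (fst D)) (Cmult Ci (RtoC (snd D)))).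
    2: { destruct D as [d1 d2]. unfold Cplus, Cmult, Ci, RtoC. simpl. f_equal; ring. }
    eapply Rle_lt_trans. apply Cmod_triangle. rewrite Cmod_mult, !Cmod_R.
    replace (Cmod Ci) with 1.
    2: { unfold Cmod, Ci. simpl. rewrite <- sqrt_1 at 1. f_equal. ring. }
    rewrite E1, E2.
    assert (near4 d x y z w x' y' z' w') by (unfold near4; repeat split; lra).
    assert (near4 d' x y z w x' y' z' w') by (unfold near4; repeat split; lra).
    specialize (K H5). specialize (K' H6). lra.
Qed.

Definition C2r (g : rfn) : Prop := forall x y z w, 0 < rho x y z w ->
  (forall i, (i < 4)%nat -> ex_pd i g x y z w) /\
  (forall i j, (i < 4)%nat -> (j < 4)%nat ->
     ex_pd j (pd i g) x y z w /\ cont4 (pd j (pd i g)) x y z w).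

Lemma partial_fst (i : nat) (G : fn) :
  (fun x y z w => fst (partial i G x y z w)) = pd i (fun x y z w => fst (G x y z w)).
Proof. repeat (apply functional_extensionality; intro). rewrite partial_eq. auto. Qed.

Lemma partial_snd (i : nat) (G : fn) :
  (fun x y z w => snd (partial i G x y z w)) = pd i (fun x y z w => snd (G x y z w)).
Proof. repeat (apply functional_extensionality; intro). rewrite partial_eq. auto. Qed.

Lemma C2_away0_iff (G : fn) :
  C2_away0 G <-> C2r (fun x y z w => fst (G x y z w)) /\ C2r (fun x y z w => snd (G x y z w)).
Proof.
  split.
  - intros H. split; intros x y z w Hp; unfold rho in Hp;
    destruct (H x y z w) as [H1 H2]; try lra; split; intros.
    + apply (proj1 (ex_partial_iff i G x y z w)). auto.
    + destruct (H2 i j) as [K1 K2]; auto. apply ex_partial_iff in K1. apply cont_at_iff in K2.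
      rewrite !partial_fst in K1. rewrite !partial_fst in K2. tauto.
    + apply (proj1 (ex_partial_iff i G x y z w)). auto.
    + destruct (H2 i j) as [K1 K2]; auto. apply ex_partial_iff in K1. apply cont_at_iff in K2.
      rewrite !partial_snd in K1. rewrite !partial_snd in K2. tauto.
  - intros [H1 H2] x y z w Hp. assert (Hp' : 0 < rho x y z w).
    { pose proof (rho_nonneg x y z w). unfold rho in *. lra. }
    destruct (H1 _ _ _ _ Hp') as [A1 A2]. destruct (H2 _ _ _ _ Hp') as [B1 B2].
    split; intros.
    + apply ex_partial_iff. auto.
    + destruct (A2 i j); auto. destruct (B2 i j); auto.
      rewrite ex_partial_iff, cont_at_iff, !partial_fst, !partial_snd. auto.
Qed.

(** * Continuous partial derivatives and differentiability *)

Lemma increment_bound (f : R -> R) (a b A e : R) :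
  (forall c, Rabs (c - a) <= Rabs (b - a) -> ex_derive f c /\ Rabs (Derive f c - A) <= e) ->
  Rabs (f b - f a - A * (b - a)) <= e * Rabs (b - a).
Proof.
  intros H.
  assert (Hc : forall c, Rmin a b <= c <= Rmax a b -> Rabs (c - a) <= Rabs (b - a)).
  { intros c. unfold Rmin, Rmax, Rabs. destruct (Rle_dec a b); repeat destruct Rcase_abs; lra. }
  destruct (MVT_gen f a b (Derive f)) as [c [Hc1 Hc2]].
  - intros c Hc1. apply Derive_correct. apply H. apply Hc. lra.
  - intros c Hc1. apply continuity_pt_filterlim. apply (ex_derive_continuous f). apply H. auto.
  - rewrite Hc2. replace (Derive f c * (b - a) - A * (b - a)) with ((Derive f c - A) * (b - a)) by ring.
    rewrite Rabs_mult. apply Rmult_le_compat_r. apply Rabs_pos. apply H. auto.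
Qed.

(** The increment is split into four steps along the coordinate axes, and the mean value theorem is
    applied to each. *)
Lemma partials_differentiable (g : rfn) (x y z w d0 : R) : 0 < d0 ->
  (forall x' y' z' w', near4 d0 x y z w x' y' z' w' ->
     forall i, (i < 4)%nat -> ex_pd i g x' y' z' w') ->
  (forall i, (i < 4)%nat -> cont4 (pd i g) x y z w) ->
  forall e, 0 < e -> exists d, 0 < d /\ forall x' y' z' w', near4 d x y z w x' y' z' w' ->
    Rabs (g x' y' z' w' - g x y z w -
      (pd 0 g x y z w * (x' - x) + pd 1 g x y z w * (y' - y) +
       pd 2 g x y z w * (z' - z) + pd 3 g x y z w * (w' - w)))
    <= e * norm1 (x' - x) (y' - y) (z' - z) (w' - w).
Proof.
  intros Hd0 Hex Hc e He.
  destruct (Hc 0%nat ltac:(lia) e He) as [e0 [P0 K0]].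
  destruct (Hc 1%nat ltac:(lia) e He) as [e1 [P1 K1]].
  destruct (Hc 2%nat ltac:(lia) e He) as [e2 [P2 K2]].
  destruct (Hc 3%nat ltac:(lia) e He) as [e3 [P3 K3]].
  set (d := Rmin d0 (Rmin (Rmin e0 e1) (Rmin e2 e3))).
  assert (Hd : 0 < d) by (repeat apply Rmin_glb_lt; auto).
  assert (L0 : d <= d0) by apply Rmin_l.
  assert (L : d <= Rmin (Rmin e0 e1) (Rmin e2 e3)) by apply Rmin_r.
  pose proof (Rmin_l (Rmin e0 e1) (Rmin e2 e3)). pose proof (Rmin_r (Rmin e0 e1) (Rmin e2 e3)).
  pose proof (Rmin_l e0 e1). pose proof (Rmin_r e0 e1).
  pose proof (Rmin_l e2 e3). pose proof (Rmin_r e2 e3).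
  exists d. split; auto. intros x' y' z' w' [N1 [N2 [N3 N4]]].
  assert (Z : forall s, Rabs (s - s) < d) by (intros; apply Rabs_diag_lt; auto).
  assert (B0 : Rabs (g x' y' z' w' - g x y' z' w' - pd 0 g x y z w * (x' - x)) <= e * Rabs (x' - x)).
  { apply (increment_bound (fun t => g t y' z' w')). intros c Hcc. split.
    - apply (Hex c y' z' w' ltac:(unfold near4; repeat split; lra) 0%nat). lia.
    - left. apply (K0 c y' z' w'). unfold near4; repeat split; lra. }
  assert (B1 : Rabs (g x y' z' w' - g x y z' w' - pd 1 g x y z w * (y' - y)) <= e * Rabs (y' - y)).
  { apply (increment_bound (fun t => g x t z' w')). intros c Hcc. specialize (Z x). split.
    - apply (Hex x c z' w' ltac:(unfold near4; repeat split; lra) 1%nat). lia.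
    - left. apply (K1 x c z' w'). unfold near4; repeat split; lra. }
  assert (B2 : Rabs (g x y z' w' - g x y z w' - pd 2 g x y z w * (z' - z)) <= e * Rabs (z' - z)).
  { apply (increment_bound (fun t => g x y t w')). intros c Hcc. pose proof (Z x). pose proof (Z y). split.
    - apply (Hex x y c w' ltac:(unfold near4; repeat split; lra) 2%nat). lia.
    - left. apply (K2 x y c w'). unfold near4; repeat split; lra. }
  assert (B3 : Rabs (g x y z w' - g x y z w - pd 3 g x y z w * (w' - w)) <= e * Rabs (w' - w)).
  { apply (increment_bound (fun t => g x y z t)). intros c Hcc. pose proof (Z x). pose proof (Z y). pose proof (Z z). split.
    - apply (Hex x y z c ltac:(unfold near4; repeat split; lra) 3%nat). lia.
    - left. apply (K3 x y z c). unfold near4; repeat split; lra. }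
  unfold norm1.
  apply Rabs_le_between in B0, B1, B2, B3. apply Rabs_le. lra.
Qed.

(** [C2r] grants continuity of the second partial derivatives only. Used twice, this lemma brings it
    down to the first ones and to the function itself. *)
Lemma partials_cont4 (g : rfn) (x y z w d0 : R) : 0 < d0 ->
  (forall x' y' z' w', near4 d0 x y z w x' y' z' w' ->
     forall i, (i < 4)%nat -> ex_pd i g x' y' z' w') ->
  (forall i, (i < 4)%nat -> cont4 (pd i g) x y z w) -> cont4 g x y z w.
Proof.
  intros Hd0 Hex Hc e He.
  destruct (partials_differentiable g x y z w d0 Hd0 Hex Hc 1 Rlt_0_1) as [d [Hd K]].
  set (A := 1 + Rabs (pd 0 g x y z w) + Rabs (pd 1 g x y z w) + Rabs (pd 2 g x y z w) + Rabs (pd 3 g x y z w)).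
  pose proof (Rabs_pos (pd 0 g x y z w)). pose proof (Rabs_pos (pd 1 g x y z w)).
  pose proof (Rabs_pos (pd 2 g x y z w)). pose proof (Rabs_pos (pd 3 g x y z w)).
  assert (HA : 1 <= A) by (unfold A; lra).
  exists (Rmin d (e / (4 * A))).
  assert (HeA : 0 < e / (4 * A)) by (apply Rdiv_lt_0_compat; lra).
  split. apply Rmin_glb_lt; auto.
  intros x' y' z' w' [N1 [N2 [N3 N4]]].
  pose proof (Rmin_l d (e / (4 * A))). pose proof (Rmin_r d (e / (4 * A))).
  specialize (K x' y' z' w' ltac:(unfold near4; repeat split; lra)).
  assert (T : forall p s, 1 + Rabs p <= A -> Rabs s < e / (4 * A) -> Rabs (p * s) + Rabs s < e / 4).
  { intros p s Hp Hs. rewrite Rabs_mult. pose proof (Rabs_pos s).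
    replace (e / 4) with (A * (e / (4 * A))) by (field; lra). nra. }
  assert (T0 := T (pd 0 g x y z w) (x' - x) ltac:(unfold A; lra) ltac:(lra)).
  assert (T1 := T (pd 1 g x y z w) (y' - y) ltac:(unfold A; lra) ltac:(lra)).
  assert (T2 := T (pd 2 g x y z w) (z' - z) ltac:(unfold A; lra) ltac:(lra)).
  assert (T3 := T (pd 3 g x y z w) (w' - w) ltac:(unfold A; lra) ltac:(lra)).
  unfold norm1 in K.
  pose proof (Rle_abs (pd 0 g x y z w * (x' - x))). pose proof (Rle_abs (- (pd 0 g x y z w * (x' - x)))).
  pose proof (Rle_abs (pd 1 g x y z w * (y' - y))). pose proof (Rle_abs (- (pd 1 g x y z w * (y' - y)))).
  pose proof (Rle_abs (pd 2 g x y z w * (z' - z))). pose proof (Rle_abs (- (pd 2 g x y z w * (z' - z)))).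
  pose proof (Rle_abs (pd 3 g x y z w * (w' - w))). pose proof (Rle_abs (- (pd 3 g x y z w * (w' - w)))).
  rewrite Rabs_Ropp in *.
  apply Rabs_le_between in K. apply Rabs_def1; lra.
Qed.

Section C2Facts.
Variable g : rfn.
Hypothesis Hg : C2r g.

Lemma C2r_pd_cont (i : nat) (x y z w : R) : (i < 4)%nat -> 0 < rho x y z w -> cont4 (pd i g) x y z w.
Proof.
  intros Hi Hp. destruct (rho_near _ _ _ _ Hp) as [d [Hd K]].
  apply (partials_cont4 _ _ _ _ _ d Hd).
  - intros x' y' z' w' Hn j Hj. apply (proj2 (Hg _ _ _ _ (K _ _ _ _ Hn)) i j Hi Hj).
  - intros j Hj. apply (proj2 (Hg _ _ _ _ Hp) i j Hi Hj).
Qed.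

Lemma C2r_cont (x y z w : R) : 0 < rho x y z w -> cont4 g x y z w.
Proof.
  intros Hp. destruct (rho_near _ _ _ _ Hp) as [d [Hd K]].
  apply (partials_cont4 _ _ _ _ _ d Hd).
  - intros x' y' z' w' Hn j Hj. apply (proj1 (Hg _ _ _ _ (K _ _ _ _ Hn)) j Hj).
  - intros j Hj. apply C2r_pd_cont; auto.
Qed.

Lemma C2r_D2 (x y z w : R) : 0 < rho x y z w ->
  D2 (fun t => g t y z w) x (pd 0 g x y z w) (pd 0 (pd 0 g) x y z w) /\
  D2 (fun t => g x t z w) y (pd 1 g x y z w) (pd 1 (pd 1 g) x y z w) /\
  D2 (fun t => g x y t w) z (pd 2 g x y z w) (pd 2 (pd 2 g) x y z w) /\
  D2 (fun t => g x y z t) w (pd 3 g x y z w) (pd 3 (pd 3 g) x y z w).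
Proof.
  intros Hp. destruct (rho_near _ _ _ _ Hp) as [d [Hd K]].
  assert (Z : forall s, Rabs (s - s) < d) by (intros; apply Rabs_diag_lt; auto).
  split; [|split; [|split]].
  - exists (fun t => pd 0 g t y z w). split; [|split]; auto.
    + apply (locally_of_near _ _ d Hd). intros t Ht. apply Derive_correct.
      apply (proj1 (Hg t y z w (K t y z w ltac:(unfold near4; auto))) 0%nat). lia.
    + apply Derive_correct. apply (proj2 (Hg x y z w Hp) 0%nat 0%nat); lia.
  - exists (fun t => pd 1 g x t z w). split; [|split]; auto.
    + apply (locally_of_near _ _ d Hd). intros t Ht. apply Derive_correct.
      apply (proj1 (Hg x t z w (K x t z w ltac:(unfold near4; auto))) 1%nat). lia.
    + apply Derive_correct. apply (proj2 (Hg x y z w Hp) 1%nat 1%nat); lia.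
  - exists (fun t => pd 2 g x y t w). split; [|split]; auto.
    + apply (locally_of_near _ _ d Hd). intros t Ht. apply Derive_correct.
      apply (proj1 (Hg x y t w (K x y t w ltac:(unfold near4; auto))) 2%nat). lia.
    + apply Derive_correct. apply (proj2 (Hg x y z w Hp) 2%nat 2%nat); lia.
  - exists (fun t => pd 3 g x y z t). split; [|split]; auto.
    + apply (locally_of_near _ _ d Hd). intros t Ht. apply Derive_correct.
      apply (proj1 (Hg x y z t (K x y z t ltac:(unfold near4; auto))) 3%nat). lia.
    + apply Derive_correct. apply (proj2 (Hg x y z w Hp) 3%nat 3%nat); lia.
Qed.

Hypothesis Hhom : forall s x y z w, 0 < s -> 0 < rho x y z w ->
  g (s * x) (s * y) (s * z) (s * w) = g x y z w.

(** The function takes the same value at [p] and [(1 + s) p], while its linear part changes by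
    [s E]. The error [e s N] would have to make up for that, but [e] is chosen with [e N < |E|]; the
    [N + 1] in the denominators keeps them positive. *)
Lemma euler_degree0 (x y z w : R) : 0 < rho x y z w ->
  x * pd 0 g x y z w + y * pd 1 g x y z w + z * pd 2 g x y z w + w * pd 3 g x y z w = 0.
Proof.
  intros Hp. set (E := _ + _). apply NNPP. intros HE.
  destruct (rho_near _ _ _ _ Hp) as [d [Hd K]].
  set (N := norm1 x y z w). assert (HN : 0 <= N) by apply norm1_nonneg.
  set (e := Rabs E / (2 * (N + 1))).
  assert (He : 0 < e). { apply Rdiv_lt_0_compat. apply Rabs_pos_lt; auto. lra. }
  destruct (partials_differentiable g x y z w d Hd) with (e := e) as [d' [Hd' H]]; auto.
  { intros x' y' z' w' Hn j Hj. apply (proj1 (Hg _ _ _ _ (K _ _ _ _ Hn)) j Hj). }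
  { intros j Hj. apply C2r_pd_cont; auto. }
  set (s := d' / (2 * (N + 1))).
  assert (Hs : 0 < s) by (apply Rdiv_lt_0_compat; lra).
  assert (HsN : s * N < d').
  { unfold s. replace (d' / (2 * (N + 1)) * N) with (d' / 2 * (N / (N + 1))) by (field; lra).
    assert (N / (N + 1) < 1). { apply Rmult_lt_reg_r with (N + 1). lra. unfold Rdiv. rewrite Rmult_assoc, Rinv_l; lra. }
    assert (0 <= N / (N + 1)) by (apply Rdiv_le_0_compat; lra). nra. }
  assert (D : forall v, Rabs v <= N -> Rabs ((1 + s) * v - v) < d').
  { intros v Hv. replace ((1 + s) * v - v) with (s * v) by ring.
    rewrite Rabs_mult, (Rabs_pos_eq s) by lra. nra. }
  assert (NN : Rabs x <= N /\ Rabs y <= N /\ Rabs z <= N /\ Rabs w <= N).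
  { unfold N, norm1. pose proof (Rabs_pos x). pose proof (Rabs_pos y).
    pose proof (Rabs_pos z). pose proof (Rabs_pos w). lra. }
  specialize (H ((1 + s) * x) ((1 + s) * y) ((1 + s) * z) ((1 + s) * w)
     ltac:(unfold near4; repeat split; apply D; tauto)).
  rewrite Hhom in H by (auto; lra).
  assert (Q : s * Rabs E <= e * (s * N)).
  { replace (s * Rabs E) with (Rabs (s * E)) by (rewrite Rabs_mult, (Rabs_pos_eq s); lra).
    replace (s * N) with (norm1 ((1 + s) * x - x) ((1 + s) * y - y) ((1 + s) * z - z) ((1 + s) * w - w)).
    - eapply Rle_trans; [|exact H]. right. rewrite <- Rabs_Ropp. f_equal. unfold E. ring.
    - unfold N, norm1.
      assert (V : forall v, Rabs ((1 + s) * v - v) = s * Rabs v).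
      { intros v. replace ((1 + s) * v - v) with (s * v) by ring.
        rewrite Rabs_mult, (Rabs_pos_eq s); lra. }
      rewrite !V. ring. }
  assert (HEp := Rabs_pos_lt _ HE).
  assert (e * N < Rabs E).
  { unfold e. replace (Rabs E / (2 * (N + 1)) * N) with (Rabs E / 2 * (N / (N + 1))) by (field; lra).
    assert (N / (N + 1) < 1). { apply Rmult_lt_reg_r with (N + 1). lra. unfold Rdiv. rewrite Rmult_assoc, Rinv_l; lra. }
    assert (0 <= N / (N + 1)) by (apply Rdiv_le_0_compat; lra). nra. }
  nra.
Qed.

Lemma rho_scale (s x y z w : R) : rho (s * x) (s * y) (s * z) (s * w) = s ^ 2 * rho x y z w.
Proof. unfold rho. ring. Qed.

(** Second derivatives of a function of degree 0 have degree -2. This carries the eigenvalue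
    equation from the unit sphere to every point off the origin. *)
Lemma laplacian_scale (s x y z w : R) : 0 < s -> 0 < rho x y z w ->
  pd 0 (pd 0 g) x y z w + pd 1 (pd 1 g) x y z w + pd 2 (pd 2 g) x y z w + pd 3 (pd 3 g) x y z w =
  s ^ 2 * (pd 0 (pd 0 g) (s * x) (s * y) (s * z) (s * w) + pd 1 (pd 1 g) (s * x) (s * y) (s * z) (s * w) +
           pd 2 (pd 2 g) (s * x) (s * y) (s * z) (s * w) + pd 3 (pd 3 g) (s * x) (s * y) (s * z) (s * w)).
Proof.
  intros Hs Hp.
  assert (Hp' : 0 < rho (s * x) (s * y) (s * z) (s * w)).
  { rewrite rho_scale. apply Rmult_lt_0_compat; auto. apply pow_lt; auto. }
  destruct (C2r_D2 _ _ _ _ Hp) as [A0 [A1 [A2 A3]]].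
  destruct (C2r_D2 _ _ _ _ Hp') as [B0 [B1 [B2 B3]]].
  destruct (rho_near _ _ _ _ Hp) as [d [Hd K]].
  assert (Z : forall s, Rabs (s - s) < d) by (intros; apply Rabs_diag_lt; auto).
  assert (C : forall f f' t a b a' b', D2 f t a b -> D2 f' (s * t) a' b' ->
     (forall v, Rabs (v - t) < d -> f' (s * v) = f v) -> b = s ^ 2 * b').
  { intros f f' t a b a' b' H1 H2 H3. replace (s * t) with (0 + s * t) in H2 by ring.
    apply D2_affine in H2.
    apply (D2_ext_loc _ f) in H2.
    2: { apply (locally_of_near _ _ d Hd). intros v Hv. rewrite Rplus_0_l. auto. }
    destruct (D2_unique _ _ _ _ _ _ H1 H2) as [_ E]. rewrite E. ring. }
  rewrite (C _ _ _ _ _ _ _ A0 B0), (C _ _ _ _ _ _ _ A1 B1), (C _ _ _ _ _ _ _ A2 B2), (C _ _ _ _ _ _ _ A3 B3).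
  - ring.
  - intros v Hv. apply Hhom; auto. apply K. unfold near4; auto.
  - intros v Hv. apply Hhom; auto. apply K. unfold near4; auto.
  - intros v Hv. apply Hhom; auto. apply K. unfold near4; auto.
  - intros v Hv. apply Hhom; auto. apply K. unfold near4; auto.
Qed.

End C2Facts.

(** * Eigenfunctions extend to polynomials *)

(** The power [|p|^kap]. A real exponent is needed because [kap = k] turns the degree-0 extension
    into H and [kap = - k] leads back from a polynomial to the extension. *)
Definition psi (kap : R) : rfn := fun x y z w => Rpower (rho x y z w) (kap / 2).

Lemma is_derive_Rpower_quadratic (kap m x : R) : 0 < m + x ^ 2 ->
  is_derive (fun t => Rpower (m + t ^ 2) (kap / 2)) x
    (kap * x * Rpower (m + x ^ 2) (kap / 2) / (m + x ^ 2)).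
Proof.
  intros H. unfold Rpower. auto_derive. simpl in *. lra. simpl. field. simpl in H. lra.
Qed.

Lemma D2_Rpower_quadratic (kap m x : R) : 0 < m + x ^ 2 ->
  D2 (fun t => Rpower (m + t ^ 2) (kap / 2)) x
    (kap * x * Rpower (m + x ^ 2) (kap / 2) / (m + x ^ 2))
    (kap * Rpower (m + x ^ 2) (kap / 2) / (m + x ^ 2) +
     kap * (kap - 2) * x ^ 2 * Rpower (m + x ^ 2) (kap / 2) / (m + x ^ 2) ^ 2).
Proof.
  intros H. exists (fun t => kap * t * Rpower (m + t ^ 2) (kap / 2) / (m + t ^ 2)).
  split; [|split]; auto.
  - assert (Hc : continuous (fun t => m + t ^ 2) x)
      by (apply (ex_derive_continuous (fun t => m + t ^ 2)); auto_derive; auto).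
    pose proof (Hc _ (open_gt 0 _ H)) as K. unfold filtermap in K. revert K. apply filter_imp.
    intros t Ht. apply is_derive_Rpower_quadratic. exact Ht.
  - unfold Rpower. auto_derive. simpl in *. split; lra. simpl. field. simpl in H. lra.
Qed.

(** Product rule for the Laplacian: the gradient of [psi] is [kap psi p / rho], so the mixed term is
    an Euler sum, and the Laplacian of [psi] is [kap (kap + 2) psi / rho]. For [deg = 0], [kap = k]
    the last term cancels the eigenvalue; for [deg = k], [kap = - k] it produces the factor
    [- k (k + 2)]. *)
Lemma lap_psi_mult (kap : R) (g : rfn) (x y z w d0 d1 d2 d3 e0 e1 e2 e3 deg L : R) :
  0 < rho x y z w ->
  D2 (fun t => g t y z w) x d0 e0 -> D2 (fun t => g x t z w) y d1 e1 ->
  D2 (fun t => g x y t w) z d2 e2 -> D2 (fun t => g x y z t) w d3 e3 ->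
  x * d0 + y * d1 + z * d2 + w * d3 = deg * g x y z w -> e0 + e1 + e2 + e3 = L ->
  lap (fun x y z w => psi kap x y z w * g x y z w) x y z w
    (psi kap x y z w * (L + (2 * kap * deg + kap * (kap + 2)) * g x y z w / rho x y z w)).
Proof.
  intros Hp A0 A1 A2 A3 HE HL.
  set (r := rho x y z w) in *. set (ps := psi kap x y z w).
  assert (E : forall s m, m + s ^ 2 = r ->
    D2 (fun t => Rpower (m + t ^ 2) (kap / 2)) s (kap * s * ps / r)
      (kap * ps / r + kap * (kap - 2) * s ^ 2 * ps / r ^ 2)).
  { intros s m E. unfold ps, psi. fold r. rewrite <- E. apply D2_Rpower_quadratic. lra. }
  assert (B0 : D2 (fun t => psi kap t y z w) x (kap * x * ps / r)
      (kap * ps / r + kap * (kap - 2) * x ^ 2 * ps / r ^ 2)).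
  { eapply D2_ext_loc; [|apply (E x (r - x ^ 2)); ring].
    apply filter_forall; intros. unfold psi. f_equal. unfold r, rho. ring. }
  assert (B1 : D2 (fun t => psi kap x t z w) y (kap * y * ps / r)
      (kap * ps / r + kap * (kap - 2) * y ^ 2 * ps / r ^ 2)).
  { eapply D2_ext_loc; [|apply (E y (r - y ^ 2)); ring].
    apply filter_forall; intros. unfold psi. f_equal. unfold r, rho. ring. }
  assert (B2 : D2 (fun t => psi kap x y t w) z (kap * z * ps / r)
      (kap * ps / r + kap * (kap - 2) * z ^ 2 * ps / r ^ 2)).
  { eapply D2_ext_loc; [|apply (E z (r - z ^ 2)); ring].
    apply filter_forall; intros. unfold psi. f_equal. unfold r, rho. ring. }
  assert (B3 : D2 (fun t => psi kap x y z t) w (kap * w * ps / r)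
      (kap * ps / r + kap * (kap - 2) * w ^ 2 * ps / r ^ 2)).
  { eapply D2_ext_loc; [|apply (E w (r - w ^ 2)); ring].
    apply filter_forall; intros. unfold psi. f_equal. unfold r, rho. ring. }
  pose proof (D2_mult _ _ _ _ _ _ _ B0 A0) as C0.
  pose proof (D2_mult _ _ _ _ _ _ _ B1 A1) as C1.
  pose proof (D2_mult _ _ _ _ _ _ _ B2 A2) as C2.
  pose proof (D2_mult _ _ _ _ _ _ _ B3 A3) as C3.
  do 8 eexists. split; [exact C0 | split; [exact C1 | split; [exact C2 | split; [exact C3 |]]]].
  cbv beta. fold ps. set (G := g x y z w) in *.
  transitivity (ps * (e0 + e1 + e2 + e3) + 2 * kap * ps / r * (x * d0 + y * d1 + z * d2 + w * d3)
    + (4 * kap * ps / r + kap * (kap - 2) * ps / r ^ 2 * (x ^ 2 + y ^ 2 + z ^ 2 + w ^ 2)) * G).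
  - rewrite HE, HL. change (x ^ 2 + y ^ 2 + z ^ 2 + w ^ 2) with r. field. lra.
  - field. lra.
Qed.

Lemma sqrt_pow_psi (k : nat) (x y z w : R) : 0 < rho x y z w ->
  sqrt (rho x y z w) ^ k = psi (INR k) x y z w.
Proof.
  intros H. unfold psi. rewrite <- Rpower_sqrt, <- Rpower_pow, Rpower_mult; auto.
  - f_equal. field.
  - apply exp_pos.
Qed.

(** Degrees are deliberately left out; the scaling of H determines them later. *)
Inductive rpoly : rfn -> Prop :=
  | rpoly_const c : rpoly (fun _ _ _ _ => c)
  | rpoly_x : rpoly (fun x _ _ _ => x)
  | rpoly_y : rpoly (fun _ y _ _ => y)
  | rpoly_z : rpoly (fun _ _ z _ => z)
  | rpoly_w : rpoly (fun _ _ _ w => w)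
  | rpoly_plus f g : rpoly f -> rpoly g -> rpoly (fun x y z w => f x y z w + g x y z w)
  | rpoly_mult f g : rpoly f -> rpoly g -> rpoly (fun x y z w => f x y z w * g x y z w).

Lemma rpoly_rsum (l : list nat) (f : nat -> rfn) :
  (forall j, rpoly (f j)) -> rpoly (fun x y z w => rsum l (fun j => f j x y z w)).
Proof.
  intros H. induction l as [|j l IH].
  - apply (rpoly_const 0).
  - apply (rpoly_plus (f j) (fun x y z w => rsum l (fun j => f j x y z w))); auto.
Qed.

Lemma rpoly_lagrange (n j : nat) (g : rfn) : rpoly g -> rpoly (fun x y z w => lagrange n j (g x y z w)).
Proof.
  intros Hg. unfold lagrange. induction (filter _ (seq 0 n)) as [|i l IH].
  - apply (rpoly_const 1).
  - simpl. apply rpoly_mult; auto. apply rpoly_mult; [|apply rpoly_const].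
    apply (rpoly_plus g (fun _ _ _ _ => - INR i)); auto. apply rpoly_const.
Qed.

Lemma iter_fwd_fd (n : nat) (t : R) (u : rfn) (x y z w : R) :
  Nat.iter n (fwd t) u x y z w = Nat.iter n (fd t) (fun s => u s y z w) x.
Proof. revert x. induction n; intros; simpl; auto. unfold fwd at 1, fd at 1. rewrite !IHn. auto. Qed.

Lemma cont4_continuous_x (u : rfn) (x y z w : R) : cont4 u x y z w -> continuous (fun s => u s y z w) x.
Proof.
  intros H. apply continuity_pt_filterlim. intros e He. destruct (H e He) as [d [Hd K]].
  exists d. split; auto. intros s [_ Hs]. apply K. unfold near4.
  repeat split; try (apply Rabs_diag_lt; auto). exact Hs.
Qed.

Definition O4 : list pt := (0, 0, 0, 0) :: nil.

Lemma O4_notin (x y z w : R) : ~ In (x, y, z, w) O4 <-> 0 < rho x y z w.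
Proof.
  unfold O4; simpl. split.
  - intros H. assert (K : (0, 0, 0, 0) <> (x, y, z, w)) by tauto.
    apply dist2_pos in K. unfold dist2 in K. rewrite !Rminus_0_r in K. exact K.
  - intros H [K | []]. inversion K. subst. unfold rho in H. lra.
Qed.

Lemma interpolation_x (u : rfn) (C : R) (k : nat) (x y z w : R) :
  harm_off O4 u -> (forall x y z w, cont4 u x y z w) -> 0 <= C -> growth O4 u C k ->
  u x y z w = rsum (seq 0 (S k)) (fun j => u (INR j) y z w * lagrange (S k) j x).
Proof.
  intros Hu Hc HC Hg. apply (frechet (S k) (fun s => u s y z w)).
  - intros s. apply cont4_continuous_x. auto.
  - intros t s Ht. rewrite <- iter_fwd_fd. apply (liouville_continuous k t O4 u C); auto.
Qed.

(** Differences were taken along the first coordinate only; the transpositions carry the results to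
    the other three. *)
Lemma lap_swap_xy (u : rfn) x y z w L : lap u y x z w L -> lap (fun x y z w => u y x z w) x y z w L.
Proof.
  intros [d0 [d1 [d2 [d3 [e0 [e1 [e2 [e3 [A0 [A1 [A2 [A3 HL]]]]]]]]]]]].
  exists d1, d0, d2, d3, e1, e0, e2, e3. repeat (split; [assumption|]). lra.
Qed.

Lemma lap_swap_xz (u : rfn) x y z w L : lap u z y x w L -> lap (fun x y z w => u z y x w) x y z w L.
Proof.
  intros [d0 [d1 [d2 [d3 [e0 [e1 [e2 [e3 [A0 [A1 [A2 [A3 HL]]]]]]]]]]]].
  exists d2, d1, d0, d3, e2, e1, e0, e3. repeat (split; [assumption|]). lra.
Qed.

Lemma lap_swap_xw (u : rfn) x y z w L : lap u w y z x L -> lap (fun x y z w => u w y z x) x y z w L.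
Proof.
  intros [d0 [d1 [d2 [d3 [e0 [e1 [e2 [e3 [A0 [A1 [A2 [A3 HL]]]]]]]]]]]].
  exists d3, d1, d2, d0, e3, e1, e2, e0. repeat (split; [assumption|]). lra.
Qed.

Lemma cont4_swap_xy (u : rfn) x y z w : cont4 u y x z w -> cont4 (fun x y z w => u y x z w) x y z w.
Proof.
  intros H e He. destruct (H e He) as [d [Hd K]]. exists d. split; auto.
  intros x' y' z' w' [H1 [H2 [H3 H4]]]. apply K. unfold near4; auto.
Qed.

Lemma cont4_swap_xz (u : rfn) x y z w : cont4 u z y x w -> cont4 (fun x y z w => u z y x w) x y z w.
Proof.
  intros H e He. destruct (H e He) as [d [Hd K]]. exists d. split; auto.
  intros x' y' z' w' [H1 [H2 [H3 H4]]]. apply K. unfold near4; auto.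
Qed.

Lemma cont4_swap_xw (u : rfn) x y z w : cont4 u w y z x -> cont4 (fun x y z w => u w y z x) x y z w.
Proof.
  intros H e He. destruct (H e He) as [d [Hd K]]. exists d. split; auto.
  intros x' y' z' w' [H1 [H2 [H3 H4]]]. apply K. unfold near4; auto.
Qed.

Lemma harm_off_swap (u : rfn) : harm_off O4 u ->
  harm_off O4 (fun x y z w => u y x z w) /\ harm_off O4 (fun x y z w => u z y x w) /\
  harm_off O4 (fun x y z w => u w y z x).
Proof.
  intros H. split; [|split]; intros x y z w Hp; apply O4_notin in Hp; unfold rho in Hp.
  - destruct (H y x z w) as [K1 K2]. { apply O4_notin. unfold rho. lra. }
    split; [apply cont4_swap_xy | apply lap_swap_xy]; auto.
  - destruct (H z y x w) as [K1 K2]. { apply O4_notin. unfold rho. lra. }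
    split; [apply cont4_swap_xz | apply lap_swap_xz]; auto.
  - destruct (H w y z x) as [K1 K2]. { apply O4_notin. unfold rho. lra. }
    split; [apply cont4_swap_xw | apply lap_swap_xw]; auto.
Qed.

Lemma growth_swap (u : rfn) (C : R) (k : nat) : growth O4 u C k ->
  growth O4 (fun x y z w => u y x z w) C k /\ growth O4 (fun x y z w => u z y x w) C k /\
  growth O4 (fun x y z w => u w y z x) C k.
Proof.
  intros H. split; [|split]; intros x y z w Hp; apply O4_notin in Hp; unfold rho in Hp.
  - replace (norm1 x y z w) with (norm1 y x z w) by (unfold norm1; ring).
    apply H. apply O4_notin. unfold rho. lra.
  - replace (norm1 x y z w) with (norm1 z y x w) by (unfold norm1; ring).
    apply H. apply O4_notin. unfold rho. lra.
  - replace (norm1 x y z w) with (norm1 w y z x) by (unfold norm1; ring).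
    apply H. apply O4_notin. unfold rho. lra.
Qed.

(** Nested interpolation: the coefficients of the interpolant in [x] are values of [u] at fixed [x],
    which are interpolated in [y], and so on. [P3], [P2] and [P1] treat three, two and one frozen
    coordinates. *)
Lemma liouville_polynomial (u : rfn) (C : R) (k : nat) :
  harm_off O4 u -> (forall x y z w, cont4 u x y z w) -> 0 <= C -> growth O4 u C k -> rpoly u.
Proof.
  intros Hu Hc HC Hg.
  destruct (harm_off_swap u Hu) as [U1 [U2 U3]]. destruct (growth_swap u C k Hg) as [G1 [G2 G3]].
  pose proof (fun x y z w => interpolation_x u C k x y z w Hu Hc HC Hg) as Ex.
  pose proof (fun x y z w => interpolation_x _ C k y x z w U1
     (fun x y z w => cont4_swap_xy u x y z w (Hc y x z w)) HC G1) as Ey.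
  pose proof (fun x y z w => interpolation_x _ C k z y x w U2
     (fun x y z w => cont4_swap_xz u x y z w (Hc z y x w)) HC G2) as Ez.
  pose proof (fun x y z w => interpolation_x _ C k w y z x U3
     (fun x y z w => cont4_swap_xw u x y z w (Hc w y z x)) HC G3) as Ew.
  cbv beta in Ex, Ey, Ez, Ew.
  assert (P3 : forall a b c, rpoly (fun x y z w => u a b c w)).
  { intros a b c.
    replace (fun x y z w : R => u a b c w) with
      (fun _ _ _ w : R => rsum (seq 0 (S k)) (fun j => u a b c (INR j) * lagrange (S k) j w)).
    - apply (rpoly_rsum _ (fun j _ _ _ w => u a b c (INR j) * lagrange (S k) j w)). intros j.
      apply (rpoly_mult (fun _ _ _ _ => u a b c (INR j)) (fun x y z w => lagrange (S k) j w)).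
      apply rpoly_const. apply (rpoly_lagrange _ _ (fun _ _ _ w => w)). apply rpoly_w.
    - repeat (apply functional_extensionality; intro). symmetry. apply Ew. }
  assert (P2 : forall a b, rpoly (fun x y z w => u a b z w)).
  { intros a b.
    replace (fun x y z w : R => u a b z w) with
      (fun _ _ z w : R => rsum (seq 0 (S k)) (fun j => u a b (INR j) w * lagrange (S k) j z)).
    - apply (rpoly_rsum _ (fun j _ _ z w => u a b (INR j) w * lagrange (S k) j z)). intros j.
      apply (rpoly_mult (fun _ _ _ w => u a b (INR j) w) (fun x y z w => lagrange (S k) j z)).
      apply P3. apply (rpoly_lagrange _ _ (fun _ _ z _ => z)). apply rpoly_z.
    - repeat (apply functional_extensionality; intro). symmetry. apply Ez. }
  assert (P1 : forall a, rpoly (fun x y z w => u a y z w)).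
  { intros a.
    replace (fun x y z w : R => u a y z w) with
      (fun _ y z w : R => rsum (seq 0 (S k)) (fun j => u a (INR j) z w * lagrange (S k) j y)).
    - apply (rpoly_rsum _ (fun j _ y z w => u a (INR j) z w * lagrange (S k) j y)). intros j.
      apply (rpoly_mult (fun _ _ z w => u a (INR j) z w) (fun x y z w => lagrange (S k) j y)).
      apply P2. apply (rpoly_lagrange _ _ (fun _ y _ _ => y)). apply rpoly_y.
    - repeat (apply functional_extensionality; intro). symmetry. apply Ey. }
  replace u with
      (fun x y z w : R => rsum (seq 0 (S k)) (fun j => u (INR j) y z w * lagrange (S k) j x)).
  - apply (rpoly_rsum _ (fun j x y z w => u (INR j) y z w * lagrange (S k) j x)). intros j.
    apply (rpoly_mult (fun _ y z w => u (INR j) y z w) (fun x y z w => lagrange (S k) j x)).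
    apply P1. apply (rpoly_lagrange _ _ (fun x _ _ _ => x)). apply rpoly_x.
  - repeat (apply functional_extensionality; intro). symmetry. apply Ex.
Qed.

Lemma difference_zero_x (u : rfn) (C a b y z w : R) : harm_off O4 u -> 0 <= C -> growth O4 u C 0 ->
  0 < rho a y z w -> 0 < rho b y z w -> u a y z w = u b y z w.
Proof.
  intros Hu HC Hg.
  assert (K : forall a b, a < b -> 0 < rho a y z w -> 0 < rho b y z w -> u a y z w = u b y z w).
  { intros a' b' Hab Ha Hb. assert (E : fwd (b' - a') u a' y z w = 0).
    { apply (growth0_fwd _ O4 u C); auto. lra.
      unfold shifted, O4. simpl. intros [K | [K | []]]; inversion K; subst.
      - unfold rho in Ha. lra.
      - assert (b' = 0) by lra. subst. unfold rho in Hb. lra. }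
    unfold fwd in E. replace (a' + (b' - a')) with b' in E by ring. lra. }
  intros Ha Hb. destruct (Rtotal_order a b) as [H | [H | H]].
  - apply K; auto.
  - subst; auto.
  - symmetry. apply K; auto.
Qed.

(** For growth of degree 0, where no continuity at the origin is available. The coordinates are
    moved to 1 one at a time, and each intermediate point has a coordinate equal to 1, so it is not
    the origin. *)
Lemma liouville_constant (u : rfn) (C x y z w : R) : harm_off O4 u -> 0 <= C -> growth O4 u C 0 ->
  0 < rho x y z w -> u x y z w = u 1 1 1 1.
Proof.
  intros Hu HC Hg Hp.
  destruct (harm_off_swap u Hu) as [U1 [U2 U3]]. destruct (growth_swap u C 0 Hg) as [G1 [G2 G3]].
  assert (R1 : forall y z w, 0 < rho 1 y z w).
  { intros. unfold rho. pose proof (pow2_ge_0 y0). pose proof (pow2_ge_0 z0). pose proof (pow2_ge_0 w0). lra. }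
  assert (R2 : forall y z w, 0 < rho y 1 z w).
  { intros. unfold rho. pose proof (pow2_ge_0 y0). pose proof (pow2_ge_0 z0). pose proof (pow2_ge_0 w0). lra. }
  rewrite (difference_zero_x u C x 1 y z w Hu HC Hg Hp (R1 _ _ _)).
  rewrite (difference_zero_x _ C y 1 1 z w U1 HC G1 (R2 _ _ _) (R2 _ _ _)).
  rewrite (difference_zero_x _ C z 1 1 1 w U2 HC G2 (R2 _ _ _) (R2 _ _ _)).
  apply (difference_zero_x _ C w 1 1 1 1 U3 HC G3 (R2 _ _ _) (R2 _ _ _)).
Qed.

Section Eigen.
Variable g : rfn.
Variable k : nat.
Hypothesis Hg : C2r g.
Hypothesis Hhom : forall s x y z w, 0 < s -> 0 < rho x y z w ->
  g (s * x) (s * y) (s * z) (s * w) = g x y z w.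
Hypothesis Heig : forall x y z w, rho x y z w = 1 ->
  pd 0 (pd 0 g) x y z w + pd 1 (pd 1 g) x y z w + pd 2 (pd 2 g) x y z w + pd 3 (pd 3 g) x y z w =
  - (INR k * (INR k + 2)) * g x y z w.

Let H : rfn := fun x y z w => sqrt (rho x y z w) ^ k * g x y z w.

Lemma rho_normalize (x y z w : R) : 0 < rho x y z w ->
  0 < / sqrt (rho x y z w) /\
  rho (/ sqrt (rho x y z w) * x) (/ sqrt (rho x y z w) * y)
      (/ sqrt (rho x y z w) * z) (/ sqrt (rho x y z w) * w) = 1.
Proof.
  intros Hp. assert (Hs := sqrt_lt_R0 _ Hp). split. apply Rinv_0_lt_compat; auto.
  rewrite rho_scale. rewrite <- (sqrt_sqrt (rho x y z w)) at 2 by lra. field. lra.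
Qed.

Lemma eigen_homogeneous (x y z w : R) : 0 < rho x y z w ->
  pd 0 (pd 0 g) x y z w + pd 1 (pd 1 g) x y z w + pd 2 (pd 2 g) x y z w + pd 3 (pd 3 g) x y z w =
  - (INR k * (INR k + 2)) * g x y z w / rho x y z w.
Proof.
  intros Hp. destruct (rho_normalize _ _ _ _ Hp) as [Hs H1].
  rewrite (laplacian_scale g Hg Hhom _ x y z w Hs Hp), Heig, Hhom by auto.
  assert (Hr := sqrt_lt_R0 _ Hp).
  rewrite <- (sqrt_sqrt (rho x y z w)) at 2 by lra. field. lra.
Qed.

Lemma H_harmonic : harm_off O4 H.
Proof.
  intros x y z w Hp. apply O4_notin in Hp. split.
  - apply cont4_mult; [|apply C2r_cont; auto].
    apply (cont4_comp (fun r => sqrt r ^ k)). apply cont4_rho.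
    apply (ex_derive_continuous (fun r => sqrt r ^ k)). auto_derive. exact Hp.
  - destruct (C2r_D2 g Hg _ _ _ _ Hp) as [A0 [A1 [A2 A3]]].
    pose proof (euler_degree0 g Hg Hhom _ _ _ _ Hp) as HE. rewrite <- (Rmult_0_l (g x y z w)) in HE.
    pose proof (lap_psi_mult (INR k) g x y z w _ _ _ _ _ _ _ _ 0 _ Hp A0 A1 A2 A3 HE
      (eigen_homogeneous _ _ _ _ Hp)) as K.
    replace (psi (INR k) x y z w * _) with 0 in K by (field; lra).
    destruct (rho_near _ _ _ _ Hp) as [d [Hd Hn]].
    apply (lap_ext_near _ H _ _ _ _ d) in K; auto.
    intros. unfold H. rewrite sqrt_pow_psi; auto.
Qed.

(** The sphere is treated inside the box [[-1, 1]^4], with the condition [rho = 1] placed in the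
    compactness predicate. Near the origin that condition is never met; homogeneity extends the
    bound off the sphere. *)
Lemma g_bounded : exists C, 0 <= C /\ forall x y z w, 0 < rho x y z w -> Rabs (g x y z w) <= C.
Proof.
  destruct (box_compact (-1) 1 1 (fun d x y z w => rho x y z w = 1 -> Rabs (g x y z w) <= / d))
    as [d [Hd K]].
  - intros d d' x y z w Hd' Hle K H1. apply Rle_trans with (1 := K H1).
    apply Rinv_le_contravar; auto.
  - intros x y z w _. destruct (Req_dec (rho x y z w) 0) as [H0 | H0].
    + destruct (cont4_rho x y z w 1 Rlt_0_1) as [d [Hd K]]. exists d. split; auto.
      intros x' y' z' w' _ Hn H1. specialize (K _ _ _ _ Hn). rewrite H0, H1 in K.
      rewrite Rminus_0_r, Rabs_R1 in K. lra.
    + assert (Hp : 0 < rho x y z w) by (pose proof (rho_nonneg x y z w); lra).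
      destruct (C2r_cont g Hg _ _ _ _ Hp 1 Rlt_0_1) as [d [Hd K]].
      set (B := Rabs (g x y z w) + 1).
      assert (HB : 0 < B) by (unfold B; pose proof (Rabs_pos (g x y z w)); lra).
      exists (Rmin d (/ B)). split. { apply Rmin_glb_lt; auto. apply Rinv_0_lt_compat; auto. }
      intros x' y' z' w' _ [N1 [N2 [N3 N4]]] H1. pose proof (Rmin_l d (/ B)).
      apply Rle_trans with B.
      * specialize (K x' y' z' w' ltac:(unfold near4; repeat split; lra)).
        pose proof (Rabs_triang_inv (g x' y' z' w') (g x y z w)). unfold B. lra.
      * rewrite <- (Rinv_inv B) at 1. apply Rinv_le_contravar.
        apply Rmin_glb_lt; auto. apply Rinv_0_lt_compat; auto. apply Rmin_r.
  - exists (/ d). split. left; apply Rinv_0_lt_compat; auto.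
    intros x y z w Hp. destruct (rho_normalize _ _ _ _ Hp) as [Hs H1].
    rewrite <- (Hhom _ x y z w Hs Hp). apply K; auto.
    assert (T : forall a b c e, rho a b c e = 1 -> in_box (-1) 1 1 a b c e).
    { intros a b c e E. unfold rho in E. unfold in_box.
      pose proof (pow2_ge_0 a). pose proof (pow2_ge_0 b). pose proof (pow2_ge_0 c). pose proof (pow2_ge_0 e).
      repeat split; nra. }
    apply T; auto.
Qed.

Lemma sqrt_rho_le_norm1 (x y z w : R) : sqrt (rho x y z w) <= norm1 x y z w.
Proof.
  rewrite <- (sqrt_pow2 (norm1 x y z w)) by apply norm1_nonneg. apply sqrt_le_1_alt.
  unfold rho, norm1.
  rewrite <- (pow2_abs x), <- (pow2_abs y), <- (pow2_abs z), <- (pow2_abs w).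
  pose proof (Rabs_pos x). pose proof (Rabs_pos y). pose proof (Rabs_pos z). pose proof (Rabs_pos w).
  nra.
Qed.

Lemma H_growth (C : R) : 0 <= C -> (forall x y z w, 0 < rho x y z w -> Rabs (g x y z w) <= C) ->
  growth O4 H C k.
Proof.
  intros HC HB x y z w Hp. apply O4_notin in Hp. unfold H.
  rewrite Rabs_mult, Rmult_comm. rewrite (Rabs_pos_eq (sqrt _ ^ k)) by (apply pow_le, sqrt_pos).
  apply Rmult_le_compat; auto. apply Rabs_pos. apply pow_le, sqrt_pos.
  apply pow_incr. split. apply sqrt_pos. pose proof (sqrt_rho_le_norm1 x y z w). lra.
Qed.

Lemma H_cont0 (C : R) : (0 < k)%nat -> 0 <= C ->
  (forall x y z w, 0 < rho x y z w -> Rabs (g x y z w) <= C) -> cont4 H 0 0 0 0.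
Proof.
  intros Hk HC HB e He.
  assert (H0 : forall x y z w, rho x y z w = 0 -> H x y z w = 0).
  { intros x y z w E. unfold H. rewrite E, sqrt_0, pow_i by auto. ring. }
  (* [C + 1] keeps the quotient meaningful when [C = 0], the 4 accounts for the four coordinates,
     and the bound 1 gives [s^k <= s]. *)
  set (d := Rmin 1 (e / (C + 1)) / 4).
  assert (He' : 0 < e / (C + 1)) by (apply Rdiv_lt_0_compat; lra).
  assert (Hm : 0 < Rmin 1 (e / (C + 1))) by (apply Rmin_glb_lt; lra).
  pose proof (Rmin_l 1 (e / (C + 1))). pose proof (Rmin_r 1 (e / (C + 1))).
  exists d. split. unfold d; lra.
  intros x y z w [N1 [N2 [N3 N4]]]. rewrite !Rminus_0_r in *.
  rewrite (H0 0 0 0 0), Rminus_0_r by (unfold rho; ring).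
  destruct (Req_dec (rho x y z w) 0) as [E | E].
  { rewrite H0 by auto. rewrite Rabs_R0. auto. }
  assert (Hp : 0 < rho x y z w) by (pose proof (rho_nonneg x y z w); lra).
  unfold H. rewrite Rabs_mult. rewrite (Rabs_pos_eq (sqrt _ ^ k)) by (apply pow_le, sqrt_pos).
  assert (Hn : norm1 x y z w < Rmin 1 (e / (C + 1))) by (unfold norm1; unfold d in *; lra).
  pose proof (sqrt_rho_le_norm1 x y z w) as Hsn. pose proof (sqrt_pos (rho x y z w)) as Hs0.
  set (s := sqrt (rho x y z w)) in *.
  assert (Hsk : s ^ k <= s).
  { destruct k as [|k']; [lia|]. simpl. assert (s ^ k' <= 1).
    { rewrite <- (pow1 k'). apply pow_incr. lra. } nra. }
  apply Rle_lt_trans with (s * C).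
  - apply Rmult_le_compat; auto. apply pow_le; auto. apply Rabs_pos.
  - apply Rle_lt_trans with (s * (C + 1)). nra.
    replace e with (e / (C + 1) * (C + 1)) by (field; lra). apply Rmult_lt_compat_r; lra.
Qed.

Theorem eigenfunction_polynomial :
  exists P, rpoly P /\ forall x y z w, 0 < rho x y z w ->
    sqrt (rho x y z w) ^ k * g x y z w = P x y z w /\ lap P x y z w 0.
Proof.
  destruct g_bounded as [C [HC HB]].
  pose proof (H_growth C HC HB) as HG. pose proof H_harmonic as HH.
  destruct (Nat.eq_dec k 0) as [Hk | Hk].
  (* The witness is the constant and not H, because for [k = 0] the value of H at the origin is
     whatever [g] has there. *)
  - exists (fun _ _ _ _ => H 1 1 1 1). split. apply rpoly_const.
    intros x y z w Hp. split; [|apply lap_const].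
    change (H x y z w = H 1 1 1 1). apply (liouville_constant H C); auto.
    rewrite Hk in HG. exact HG.
  - exists H. split; [|intros x y z w Hp; split; [reflexivity | apply HH, O4_notin, Hp]]. apply (liouville_polynomial H C k); auto.
    intros x y z w. destruct (Req_dec (rho x y z w) 0) as [E | E].
    + assert (Z : x = 0 /\ y = 0 /\ z = 0 /\ w = 0).
      { unfold rho in E. pose proof (pow2_ge_0 x). pose proof (pow2_ge_0 y).
        pose proof (pow2_ge_0 z). pose proof (pow2_ge_0 w).
        repeat split; apply NNPP; intros K; apply pow2_gt_0 in K; lra. }
      destruct Z as [-> [-> [-> ->]]]. apply (H_cont0 C); auto. lia.
    + apply HH. apply O4_notin. pose proof (rho_nonneg x y z w). lra.
Qed.

End Eigen.

(** * Polynomials in alpha, beta and their conjugates *)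

Definition csum {I : Type} (l : list I) (f : I -> C) : C :=
  fold_right (fun i acc => Cplus (f i) acc) (RtoC 0) l.

Lemma csum_ext {I : Type} (l : list I) (f g : I -> C) :
  (forall i, In i l -> f i = g i) -> csum l f = csum l g.
Proof.
  induction l as [|i l IH]; simpl; intros H; auto. rewrite IH, H by auto. auto.
Qed.

Lemma csum_app {I : Type} (l l' : list I) (f : I -> C) : csum (l ++ l') f = Cplus (csum l f) (csum l' f).
Proof. induction l as [|i l IH]; simpl; [|rewrite IH]; ring. Qed.

Lemma csum_map {I J : Type} (s : I -> J) (l : list I) (f : J -> C) :
  csum (map s l) f = csum l (fun i => f (s i)).
Proof. induction l as [|i l IH]; simpl; [|rewrite IH]; auto. Qed.

Lemma csum_flat_map {I J : Type} (s : I -> list J) (l : list I) (f : J -> C) :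
  csum (flat_map s l) f = csum l (fun i => csum (s i) f).
Proof. induction l as [|i l IH]; simpl; auto. rewrite csum_app, IH. auto. Qed.

Lemma csum_plus {I : Type} (l : list I) (f g : I -> C) :
  csum l (fun i => Cplus (f i) (g i)) = Cplus (csum l f) (csum l g).
Proof. induction l as [|i l IH]; simpl; [|rewrite IH]; ring. Qed.

Lemma csum_scal {I : Type} (l : list I) (c : C) (f : I -> C) :
  csum l (fun i => Cmult c (f i)) = Cmult c (csum l f).
Proof. induction l as [|i l IH]; simpl; [|rewrite IH]; ring. Qed.

Lemma csum_zero {I : Type} (l : list I) (f : I -> C) :
  (forall i, In i l -> f i = RtoC 0) -> csum l f = RtoC 0.
Proof.
  induction l as [|i l IH]; simpl; intros H; auto. rewrite IH, H by auto. ring.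
Qed.

Lemma csum_exchange {I J : Type} (l : list I) (l' : list J) (f : I -> J -> C) :
  csum l (fun i => csum l' (f i)) = csum l' (fun j => csum l (fun i => f i j)).
Proof.
  induction l as [|i l IH]; simpl.
  - symmetry. apply csum_zero. auto.
  - rewrite IH, csum_plus. auto.
Qed.

Lemma csum_single {I : Type} (l : list I) (f : I -> C) (i : I) :
  NoDup l -> In i l -> (forall j, In j l -> j <> i -> f j = RtoC 0) -> csum l f = f i.
Proof.
  induction 1 as [|j l Hj Hl IH]; simpl; [tauto|]. intros [E | Hi] H.
  - subst j. rewrite csum_zero. ring. intros j Hj'. apply H; auto. intros E; subst; auto.
  - rewrite IH by auto. rewrite (H j) by (auto; intros E; subst; auto). ring.
Qed.

Definition idx := (nat * nat * nat * nat)%type.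

Definition idx_dec (i j : idx) : {i = j} + {i <> j}.
Proof. repeat decide equality. Defined.

(* The index (a, b, c, d) stands for alpha^a * conj(alpha)^b * beta^c * conj(beta)^d. *)
Definition poly := list (C * idx).

Definition mono (i : idx) (A A' B B' : C) : C :=
  let '(a, b, c, d) := i in (A ^ a * A' ^ b * B ^ c * B' ^ d)%C.

(** The conjugates are separate arguments, so that differentiation and substitution are formal;
    [peval] inserts the actual conjugates. *)
Definition ev (P : poly) (A A' B B' : C) : C :=
  csum P (fun t => Cmult (fst t) (mono (snd t) A A' B B')).

Definition peval (P : poly) : fn := fun x y z w => ev P (x, y) (x, - y) (z, w) (z, - w).

(** An index may occur several times in the list. Polynomials are therefore compared through
    [coeff], never as lists. *)
Definition coeff (P : poly) (i : idx) : C :=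
  csum P (fun t => if idx_dec (snd t) i then fst t else RtoC 0).

Lemma ev_coeff (P : poly) (L : list idx) (A A' B B' : C) :
  NoDup L -> (forall t, In t P -> In (snd t) L) ->
  ev P A A' B B' = csum L (fun i => Cmult (coeff P i) (mono i A A' B B')).
Proof.
  intros HL. induction P as [|[c i] P IH]; intros H.
  - symmetry. apply csum_zero. intros i _. unfold coeff. simpl. ring.
  - unfold ev in *. simpl. rewrite IH by (intros; apply H; right; auto).
    transitivity (csum L (fun j => Cplus (Cmult (if idx_dec i j then c else RtoC 0) (mono j A A' B B'))
       (Cmult (coeff P j) (mono j A A' B B')))).
    + rewrite csum_plus. f_equal.
      rewrite (csum_single L _ i); auto.
      * destruct (idx_dec i i); [auto | contradiction].
      * apply (H (c, i)). left; auto.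
      * intros j _ Hj. destruct (idx_dec i j); [congruence | ring].
    + apply csum_ext. intros j _. unfold coeff. simpl. ring.
Qed.

Lemma ev_ext (P Q : poly) (A A' B B' : C) :
  (forall i, coeff P i = coeff Q i) -> ev P A A' B B' = ev Q A A' B B'.
Proof.
  intros H. set (L := nodup idx_dec (map snd P ++ map snd Q)).
  rewrite (ev_coeff P L), (ev_coeff Q L).
  - apply csum_ext. intros i _. rewrite H. auto.
  - apply NoDup_nodup.
  - intros t Ht. apply nodup_In, in_or_app. right. apply in_map. auto.
  - apply NoDup_nodup.
  - intros t Ht. apply nodup_In, in_or_app. left. apply in_map. auto.
Qed.

Lemma peval_ext (P Q : poly) : (forall i, coeff P i = coeff Q i) -> peval P = peval Q.
Proof.
  intros H. unfold peval. repeat (apply functional_extensionality; intro). apply ev_ext; auto.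
Qed.

(** The linear map sending the monomial [i] to [phi i] times the monomial [s i]. Derivatives,
    dilations and the group generators are of this form, and the twist is a sum of two such maps. *)
Definition pmap (phi : idx -> C) (s : idx -> idx) (P : poly) : poly :=
  map (fun t => (Cmult (fst t) (phi (snd t)), s (snd t))) P.

Lemma ev_pmap (phi : idx -> C) (s : idx -> idx) (P : poly) (A A' B B' : C) :
  ev (pmap phi s P) A A' B B' =
  csum P (fun t => Cmult (fst t) (Cmult (phi (snd t)) (mono (s (snd t)) A A' B B'))).
Proof. unfold ev, pmap. rewrite csum_map. apply csum_ext. intros t _. simpl. ring. Qed.

Lemma ev_app (P Q : poly) (A A' B B' : C) : ev (P ++ Q) A A' B B' = Cplus (ev P A A' B B') (ev Q A A' B B').
Proof. apply csum_app. Qed.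

Lemma coeff_app (P Q : poly) (i : idx) : coeff (P ++ Q) i = Cplus (coeff P i) (coeff Q i).
Proof. apply csum_app. Qed.

(** The hypothesis says that [j'] is the only index contributing to [j]. Other indices may be sent
    to [j] as well, provided that their factor is 0. *)
Lemma coeff_pmap (phi : idx -> C) (s : idx -> idx) (j j' : idx) (kap : C) (P : poly) :
  (forall i, (if idx_dec (s i) j then phi i else RtoC 0) = (if idx_dec i j' then kap else RtoC 0)) ->
  coeff (pmap phi s P) j = Cmult kap (coeff P j').
Proof.
  intros H. unfold coeff, pmap. rewrite csum_map, <- csum_scal. apply csum_ext. intros [c i] _. simpl.
  specialize (H i). destruct (idx_dec (s i) j); destruct (idx_dec i j'); rewrite ?H; try ring;
  rewrite <- H; ring.
Qed.

Lemma coeff_pmap_zero (phi : idx -> C) (s : idx -> idx) (j : idx) (P : poly) :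
  (forall i, s i = j -> phi i = RtoC 0) -> coeff (pmap phi s P) j = RtoC 0.
Proof.
  intros H. unfold coeff, pmap. rewrite csum_map. apply csum_zero. intros [c i] _. simpl.
  destruct (idx_dec (s i) j); auto. rewrite H by auto. ring.
Qed.

Definition scale (c : C) : poly -> poly := pmap (fun _ => c) (fun i => i).

Lemma ev_scale (c : C) (P : poly) (A A' B B' : C) : ev (scale c P) A A' B B' = Cmult c (ev P A A' B B').
Proof.
  unfold scale. rewrite ev_pmap. unfold ev. rewrite <- csum_scal. apply csum_ext. intros; ring.
Qed.

Lemma coeff_scale (c : C) (P : poly) (i : idx) : coeff (scale c P) i = Cmult c (coeff P i).
Proof. apply coeff_pmap. intros j. destruct (idx_dec j i); auto. Qed.

Definition Cnat (n : nat) : C := RtoC (INR n).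

Lemma Cnat_S (n : nat) : Cnat (S n) = Cplus (Cnat n) (RtoC 1).
Proof. unfold Cnat. rewrite S_INR, RtoC_plus. auto. Qed.

Lemma Cnat_neq0 (n : nat) : Cnat (S n) <> RtoC 0.
Proof. unfold Cnat. intros H. apply RtoC_inj in H. revert H. apply not_0_INR. lia. Qed.

(** Truncated subtraction does no harm: an exponent 0 stays 0 but comes with the factor 0. *)
Definition dA : poly -> poly :=
  pmap (fun '(a, b, c, d) => Cnat a) (fun '(a, b, c, d) => (a - 1, b, c, d)%nat).
Definition dA' : poly -> poly :=
  pmap (fun '(a, b, c, d) => Cnat b) (fun '(a, b, c, d) => (a, b - 1, c, d)%nat).
Definition dB : poly -> poly :=
  pmap (fun '(a, b, c, d) => Cnat c) (fun '(a, b, c, d) => (a, b, c - 1, d)%nat).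
Definition dB' : poly -> poly :=
  pmap (fun '(a, b, c, d) => Cnat d) (fun '(a, b, c, d) => (a, b, c, d - 1)%nat).

Ltac idx_tac := intros [[[? ?] ?] ?];
  repeat match goal with |- context [idx_dec ?u ?v] => destruct (idx_dec u v) end;
  repeat match goal with
  | H : (_, _, _, _) = (_, _, _, _) |- _ => inversion H; clear H; subst
  | H : (_, _, _, _) <> (_, _, _, _) |- _ => revert H
  end; intros; auto.

Lemma Cnat_pred_case (n m : nat) : (n - 1)%nat = m -> n <> S m -> Cnat n = RtoC 0.
Proof. intros H1 H2. replace n with 0%nat by lia. reflexivity. Qed.

Ltac pred_tac :=
  first [ exfalso; match goal with H : _ <> _ |- _ => apply H; repeat f_equal; lia end
        | (eapply Cnat_pred_case; [reflexivity |]); let K := fresh in intros K;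
          match goal with H : _ <> _ |- _ => apply H; repeat f_equal; lia end ].

Lemma coeff_dA (P : poly) (a b c d : nat) : coeff (dA P) (a, b, c, d) = Cmult (Cnat (S a)) (coeff P (S a, b, c, d)).
Proof. apply coeff_pmap. idx_tac; try pred_tac. Qed.

Lemma coeff_dA' (P : poly) (a b c d : nat) : coeff (dA' P) (a, b, c, d) = Cmult (Cnat (S b)) (coeff P (a, S b, c, d)).
Proof. apply coeff_pmap. idx_tac; try pred_tac. Qed.

Lemma coeff_dB (P : poly) (a b c d : nat) : coeff (dB P) (a, b, c, d) = Cmult (Cnat (S c)) (coeff P (a, b, S c, d)).
Proof. apply coeff_pmap. idx_tac; try pred_tac. Qed.

Lemma coeff_dB' (P : poly) (a b c d : nat) : coeff (dB' P) (a, b, c, d) = Cmult (Cnat (S d)) (coeff P (a, b, c, S d)).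
Proof. apply coeff_pmap. idx_tac; try pred_tac. Qed.

(** * Differentiation of formal polynomials *)

Definition isCD (f : R -> C) (x : R) (l : C) : Prop :=
  is_derive (fun t => fst (f t)) x (fst l) /\ is_derive (fun t => snd (f t)) x (snd l).

Lemma isCD_const (c : C) (x : R) : isCD (fun _ => c) x (RtoC 0).
Proof. split; apply (@is_derive_const R_AbsRing R_NormedModule). Qed.

Lemma isCD_plus (f g : R -> C) (x : R) (l m : C) :
  isCD f x l -> isCD g x m -> isCD (fun t => Cplus (f t) (g t)) x (Cplus l m).
Proof.
  intros [F1 F2] [G1 G2]. split; simpl.
  - apply (is_derive_plus (fun t => fst (f t)) (fun t => fst (g t))); auto.
  - apply (is_derive_plus (fun t => snd (f t)) (fun t => snd (g t))); auto.
Qed.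

Lemma isCD_mult (f g : R -> C) (x : R) (l m : C) :
  isCD f x l -> isCD g x m ->
  isCD (fun t => Cmult (f t) (g t)) x (Cplus (Cmult l (g x)) (Cmult (f x) m)).
Proof.
  intros [F1 F2] [G1 G2]. split; simpl.
  - pose proof (is_derive_minus _ _ _ _ _ (is_derive_mult_R _ _ _ _ _ F1 G1) (is_derive_mult_R _ _ _ _ _ F2 G2)) as K.
    replace (_ + _) with (minus (fst l * fst (g x) + fst (f x) * fst m) (snd l * snd (g x) + snd (f x) * snd m)).
    exact K. unfold minus, plus, opp; simpl. ring.
  - pose proof (is_derive_plus _ _ _ _ _ (is_derive_mult_R _ _ _ _ _ F1 G2) (is_derive_mult_R _ _ _ _ _ F2 G1)) as K.
    replace (_ + _) with (plus (fst l * snd (g x) + fst (f x) * snd m) (snd l * fst (g x) + snd (f x) * fst m)).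
    exact K. unfold plus; simpl. ring.
Qed.

Lemma isCD_eq (f : R -> C) (x : R) (l m : C) : isCD f x l -> l = m -> isCD f x m.
Proof. intros; subst; auto. Qed.

Lemma isCD_pow (f : R -> C) (x : R) (l : C) (n : nat) :
  isCD f x l -> isCD (fun t => (f t ^ n)%C) x (Cmult (Cmult (Cnat n) (f x ^ (n - 1))%C) l).
Proof.
  intros Hf. induction n.
  - eapply isCD_eq. apply (isCD_const (RtoC 1)). unfold Cnat. simpl. ring.
  - eapply isCD_eq. apply (isCD_mult f (fun t => (f t ^ n)%C)); eauto.
    rewrite Cnat_S. destruct n; simpl. unfold Cnat; simpl; ring.
    rewrite Nat.sub_0_r. rewrite Cnat_S. ring.
Qed.

Lemma isCD_csum {I : Type} (l : list I) (f : I -> R -> C) (f' : I -> C) (x : R) :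
  (forall i, isCD (f i) x (f' i)) -> isCD (fun t => csum l (fun i => f i t)) x (csum l f').
Proof.
  intros H. induction l as [|i l IH]; simpl. apply isCD_const. apply isCD_plus; auto.
Qed.

Lemma isCD_ev (P : poly) (A A' B B' : R -> C) (x : R) (a a' b b' : C) :
  isCD A x a -> isCD A' x a' -> isCD B x b -> isCD B' x b' ->
  isCD (fun t => ev P (A t) (A' t) (B t) (B' t)) x
    (Cplus (Cplus (Cmult a (ev (dA P) (A x) (A' x) (B x) (B' x)))
                  (Cmult a' (ev (dA' P) (A x) (A' x) (B x) (B' x))))
           (Cplus (Cmult b (ev (dB P) (A x) (A' x) (B x) (B' x)))
                  (Cmult b' (ev (dB' P) (A x) (A' x) (B x) (B' x))))).
Proof.
  intros HA HA' HB HB'. unfold dA, dA', dB, dB'. rewrite !ev_pmap, <- !csum_scal, <- !csum_plus.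
  apply (isCD_csum P (fun i t => Cmult (fst i) (mono (snd i) (A t) (A' t) (B t) (B' t)))).
  intros [c [[[n1 n2] n3] n4]]. simpl fst; simpl snd. unfold mono.
  eapply isCD_eq.
  - apply isCD_mult. apply isCD_const.
    apply isCD_mult; [apply isCD_mult; [apply isCD_mult|]|]; apply isCD_pow; eauto.
  - cbv beta. ring.
Qed.

Lemma isCD_x (P : poly) (x y z w : R) :
  isCD (fun t => peval P t y z w) x (Cplus (peval (dA P) x y z w) (peval (dA' P) x y z w)).
Proof.
  unfold peval. eapply isCD_eq. apply (isCD_ev P (fun t => (t, y)) (fun t => (t, - y)) (fun _ => (z, w)) (fun _ => (z, - w)) x (RtoC 1) (RtoC 1) (RtoC 0) (RtoC 0)).
  - split; simpl; auto_derive; auto.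
  - split; simpl; auto_derive; auto.
  - apply isCD_const.
  - apply isCD_const.
  - ring.
Qed.

Lemma isCD_y (P : poly) (x y z w : R) :
  isCD (fun t => peval P x t z w) y (Cmult Ci (Cminus (peval (dA P) x y z w) (peval (dA' P) x y z w))).
Proof.
  unfold peval. eapply isCD_eq. apply (isCD_ev P (fun t => (x, t)) (fun t => (x, - t)) (fun _ => (z, w)) (fun _ => (z, - w)) y Ci (Copp Ci) (RtoC 0) (RtoC 0)).
  - split; simpl; auto_derive; auto.
  - split; simpl; auto_derive; auto; ring.
  - apply isCD_const.
  - apply isCD_const.
  - ring.
Qed.

Lemma isCD_z (P : poly) (x y z w : R) :
  isCD (fun t => peval P x y t w) z (Cplus (peval (dB P) x y z w) (peval (dB' P) x y z w)).
Proof.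
  unfold peval. eapply isCD_eq. apply (isCD_ev P (fun _ => (x, y)) (fun _ => (x, - y)) (fun t => (t, w)) (fun t => (t, - w)) z (RtoC 0) (RtoC 0) (RtoC 1) (RtoC 1)).
  - apply isCD_const.
  - apply isCD_const.
  - split; simpl; auto_derive; auto.
  - split; simpl; auto_derive; auto.
  - ring.
Qed.

Lemma isCD_w (P : poly) (x y z w : R) :
  isCD (fun t => peval P x y z t) w (Cmult Ci (Cminus (peval (dB P) x y z w) (peval (dB' P) x y z w))).
Proof.
  unfold peval. eapply isCD_eq. apply (isCD_ev P (fun _ => (x, y)) (fun _ => (x, - y)) (fun t => (z, t)) (fun t => (z, - t)) w (RtoC 0) (RtoC 0) Ci (Copp Ci)).
  - apply isCD_const.
  - apply isCD_const.
  - split; simpl; auto_derive; auto.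
  - split; simpl; auto_derive; auto; ring.
  - ring.
Qed.

Definition dF (i : nat) (P : poly) : poly :=
  match i with
  | O => dA P ++ dA' P
  | 1%nat => scale Ci (dA P) ++ scale (Copp Ci) (dA' P)
  | 2%nat => dB P ++ dB' P
  | _ => scale Ci (dB P) ++ scale (Copp Ci) (dB' P)
  end.

Lemma isCD_dF (i : nat) (P : poly) (x y z w : R) :
  match i with
  | O => isCD (fun t => peval P t y z w) x (peval (dF i P) x y z w)
  | 1%nat => isCD (fun t => peval P x t z w) y (peval (dF i P) x y z w)
  | 2%nat => isCD (fun t => peval P x y t w) z (peval (dF i P) x y z w)
  | _ => isCD (fun t => peval P x y z t) w (peval (dF i P) x y z w)
  end.
Proof.
  destruct i as [|[|[|i]]]; unfold dF.
  - eapply isCD_eq. apply isCD_x. unfold peval. rewrite ev_app. auto.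
  - eapply isCD_eq. apply isCD_y. unfold peval. rewrite ev_app, !ev_scale. ring.
  - eapply isCD_eq. apply isCD_z. unfold peval. rewrite ev_app. auto.
  - eapply isCD_eq. apply isCD_w. unfold peval. rewrite ev_app, !ev_scale. ring.
Qed.

Lemma isCD_Derive (f : R -> C) (x : R) (l : C) : isCD f x l ->
  (Derive (fun t => fst (f t)) x, Derive (fun t => snd (f t)) x) = l.
Proof.
  destruct l as [l1 l2]. intros [H1 H2]. f_equal; apply is_derive_unique; assumption.
Qed.

Lemma partial_peval (i : nat) (P : poly) : partial i (peval P) = peval (dF i P).
Proof.
  repeat (apply functional_extensionality; intro). rewrite partial_eq.
  pose proof (isCD_dF i P x x0 x1 x2) as H.
  destruct i as [|[|[|i]]]; apply isCD_Derive in H; rewrite <- H; reflexivity.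
Qed.

Definition twistF (P : poly) : poly :=
  pmap (fun '(a, b, c, d) => Copp (Cnat a)) (fun '(a, b, c, d) => (a - 1, b, c, S d)%nat) P ++
  pmap (fun '(a, b, c, d) => Cnat c) (fun '(a, b, c, d) => (a, S b, c - 1, d)%nat) P.

Lemma ev_twistF (P : poly) (A A' B B' : C) :
  ev (twistF P) A A' B B' =
  Cplus (Cmult (Copp B') (ev (dA P) A A' B B')) (Cmult A' (ev (dB P) A A' B B')).
Proof.
  unfold twistF, dA, dB. rewrite ev_app, !ev_pmap, <- !csum_scal. f_equal;
  apply csum_ext; intros [e [[[a b] c] d]] _; simpl; ring.
Qed.

Lemma twist_minus_peval (P : poly) : twist_minus (peval P) = peval (twistF P).
Proof.
  repeat (apply functional_extensionality; intro).
  unfold twist_minus, dalpha, dbeta. rewrite !partial_peval. unfold peval.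
  rewrite ev_twistF. unfold dF. rewrite !ev_app, !ev_scale.
  set (a := ev (dA P) _ _ _ _). set (a' := ev (dA' P) _ _ _ _).
  set (b := ev (dB P) _ _ _ _). set (b' := ev (dB' P) _ _ _ _).
  unfold alpha, beta, Cconj. simpl fst; simpl snd.
  (* The Wirtinger combination of the two real partial derivatives, [u + v] and [i u - i v], keeps
     [u] and kills the conjugate part. *)
  assert (E : forall u v, Cmult (RtoC (1 / 2)) (Cminus (Cplus u v)
     (Cmult Ci (Cplus (Cmult Ci u) (Cmult (Copp Ci) v)))) = u).
  { intros [u1 u2] [v1 v2]. unfold Cmult, Cminus, Cplus, Copp, Ci, RtoC. simpl. f_equal; field. }
  rewrite !E. auto.
Qed.

Lemma iter_twist_peval (j : nat) (P : poly) :
  Nat.iter j twist_minus (peval P) = peval (Nat.iter j twistF P).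
Proof. induction j; simpl; auto. rewrite IHj. apply twist_minus_peval. Qed.

Lemma coeff_twistF (P : poly) (a b c d : nat) : coeff (twistF P) (a, b, c, d) =
  Cplus (match d with O => RtoC 0 | S d' => Cmult (Copp (Cnat (S a))) (coeff P (S a, b, c, d')) end)
        (match b with O => RtoC 0 | S b' => Cmult (Cnat (S c)) (coeff P (a, b', S c, d)) end).
Proof.
  unfold twistF. rewrite coeff_app. f_equal.
  - destruct d as [|d'].
    + apply coeff_pmap_zero. intros [[[? ?] ?] ?] H. inversion H.
    + apply coeff_pmap. idx_tac; try (exfalso; match goal with H : _ <> _ |- _ => apply H; repeat f_equal; lia end).
      all: match goal with |- Copp (Cnat ?n) = _ => destruct n end;
        [unfold Cnat; simpl; ring | exfalso; match goal with H : _ <> _ |- _ => apply H; repeat f_equal; lia end].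
  - destruct b as [|b'].
    + apply coeff_pmap_zero. intros [[[? ?] ?] ?] H. inversion H.
    + apply coeff_pmap. idx_tac; try pred_tac.
Qed.

(** A quarter of the Euclidean Laplacian in Wirtinger form; see [peval_lapF]. *)
Definition lapF (P : poly) : poly := dA (dA' P) ++ dB (dB' P).

Lemma coeff_lapF (P : poly) (a b c d : nat) : coeff (lapF P) (a, b, c, d) =
  Cplus (Cmult (Cmult (Cnat (S a)) (Cnat (S b))) (coeff P (S a, S b, c, d)))
        (Cmult (Cmult (Cnat (S c)) (Cnat (S d))) (coeff P (a, b, S c, S d))).
Proof. unfold lapF. rewrite coeff_app, coeff_dA, coeff_dA', coeff_dB, coeff_dB'. ring. Qed.

Lemma peval_lapF (P : poly) (x y z w : R) :
  Cplus (Cplus (peval (dF 0 (dF 0 P)) x y z w) (peval (dF 1 (dF 1 P)) x y z w))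
        (Cplus (peval (dF 2 (dF 2 P)) x y z w) (peval (dF 3 (dF 3 P)) x y z w)) =
  Cmult (RtoC 4) (peval (lapF P) x y z w).
Proof.
  unfold peval. rewrite <- ev_scale, <- !ev_app. apply ev_ext. intros [[[a b] c] d].
  rewrite coeff_scale, coeff_lapF. unfold dF.
  repeat (rewrite ?coeff_app, ?coeff_scale, ?coeff_dA, ?coeff_dA', ?coeff_dB, ?coeff_dB').
  assert (E : (Ci * Ci = - (1))%C) by (unfold Cmult, Ci, Copp, RtoC; simpl; f_equal; ring).
  ring [E].
Qed.

Lemma peval_zero_dA (P : poly) : (forall x y z w, peval P x y z w = RtoC 0) ->
  (forall x y z w, peval (dA P) x y z w = RtoC 0) /\ (forall x y z w, peval (dA' P) x y z w = RtoC 0) /\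
  (forall x y z w, peval (dB P) x y z w = RtoC 0) /\ (forall x y z w, peval (dB' P) x y z w = RtoC 0).
Proof.
  intros H.
  assert (Z : forall (f : R -> C) s l, (forall t, f t = RtoC 0) -> isCD f s l -> l = RtoC 0).
  { intros f s l Hf K. rewrite <- (isCD_Derive _ _ _ K).
    replace f with (fun _ : R => RtoC 0) by (apply functional_extensionality; auto).
    simpl. rewrite Derive_const. auto. }
  assert (Half : forall u v : C, Cplus u v = RtoC 0 -> Cmult Ci (Cminus u v) = RtoC 0 -> u = RtoC 0 /\ v = RtoC 0).
  { intros [u1 u2] [v1 v2] E1 E2. unfold Cmult, Cminus, Cplus, Copp, Ci, RtoC in *. simpl in *.
    injection E1 as a1 a2. injection E2 as b1 b2. split; f_equal; lra. }
  assert (K1 : forall x y z w, peval (dA P) x y z w = RtoC 0 /\ peval (dA' P) x y z w = RtoC 0).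
  { intros x y z w. apply Half.
    - apply (Z _ _ _ (fun t => H t y z w) (isCD_x P x y z w)).
    - apply (Z _ _ _ (fun t => H x t z w) (isCD_y P x y z w)). }
  assert (K2 : forall x y z w, peval (dB P) x y z w = RtoC 0 /\ peval (dB' P) x y z w = RtoC 0).
  { intros x y z w. apply Half.
    - apply (Z _ _ _ (fun t => H x y t w) (isCD_z P x y z w)).
    - apply (Z _ _ _ (fun t => H x y z t) (isCD_w P x y z w)). }
  split; [|split; [|split]]; intros x y z w; [apply (proj1 (K1 x y z w)) | apply (proj2 (K1 x y z w)) |
    apply (proj1 (K2 x y z w)) | apply (proj2 (K2 x y z w))].
Qed.

Lemma coeff_0000 (P : poly) : coeff P (0, 0, 0, 0)%nat = peval P 0 0 0 0.
Proof.
  unfold coeff, peval, ev. apply csum_ext. intros [c [[[n1 n2] n3] n4]] _. simpl fst; simpl snd.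
  rewrite Ropp_0. change (0, 0)%R with (RtoC 0).
  assert (E : forall n, (RtoC 0 ^ S n)%C = RtoC 0) by (intros; rewrite Cpow_S; ring).
  destruct n1; [|unfold mono; rewrite E; destruct idx_dec; [discriminate | ring]].
  destruct n2; [|unfold mono; rewrite E; destruct idx_dec; [discriminate | ring]].
  destruct n3; [|unfold mono; rewrite E; destruct idx_dec; [discriminate | ring]].
  destruct n4; [|unfold mono; rewrite E; destruct idx_dec; [discriminate | ring]].
  unfold mono. simpl. ring.
Qed.

(** Differentiation lowers one exponent at a time, each step costing a nonzero factor, until the
    constant term is reached; that is the value at the origin. *)
Lemma coeff_zero (P : poly) : (forall x y z w, peval P x y z w = RtoC 0) -> forall i, coeff P i = RtoC 0.
Proof.
  intros H [[[a b] c] d]. revert P H.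
  assert (Cancel : forall n v, Cmult (Cnat (S n)) v = RtoC 0 -> v = RtoC 0).
  { intros n v E. apply (f_equal (Cmult (Cinv (Cnat (S n))))) in E.
    rewrite Cmult_assoc, Cinv_l, Cmult_1_l, Cmult_0_r in E; auto. apply Cnat_neq0. }
  induction a as [|a IHa]; intros P H.
  2: { apply (Cancel a). rewrite <- coeff_dA. apply IHa. apply peval_zero_dA; auto. }
  revert P H. induction b as [|b IHb]; intros P H.
  2: { apply (Cancel b). rewrite <- coeff_dA'. apply IHb. apply peval_zero_dA; auto. }
  revert P H. induction c as [|c IHc]; intros P H.
  2: { apply (Cancel c). rewrite <- coeff_dB. apply IHc. apply peval_zero_dA; auto. }
  revert P H. induction d as [|d IHd]; intros P H.
  2: { apply (Cancel d). rewrite <- coeff_dB'. apply IHd. apply peval_zero_dA; auto. }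
  rewrite coeff_0000. auto.
Qed.

(** * Siblings and harmonic polynomials *)

Definition ff (n : nat) : C := Cnat (fact n).

Lemma ff_S (n : nat) : ff (S n) = Cmult (Cnat (S n)) (ff n).
Proof. unfold ff, Cnat. rewrite fact_simpl, mult_INR, RtoC_mult. auto. Qed.

Lemma ff_0 : ff 0 = RtoC 1.
Proof. reflexivity. Qed.

Lemma ff_neq0 (n : nat) : ff n <> RtoC 0.
Proof. unfold ff, Cnat. intros H. apply RtoC_inj in H. revert H. apply INR_fact_neq_0. Qed.

Lemma Cnat_plus (a b : nat) : Cnat (a + b) = Cplus (Cnat a) (Cnat b).
Proof. unfold Cnat. rewrite plus_INR, RtoC_plus. auto. Qed.

Lemma RtoC_m1 : RtoC (-1) = Copp (RtoC 1).
Proof. rewrite <- RtoC_opp. auto. Qed.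

Lemma Cm1_neq0 : RtoC (-1) <> RtoC 0.
Proof. intros H. apply RtoC_inj in H. lra. Qed.

(** The coefficient of the monomial [(a, b, c, d)] in the [(b + d)]-th twist of
    [alpha^(a+d) beta^(b+c)]. The two terms of the twist commute, so the binomial theorem gives
    [(b+d)! / (b! d!)], the sign [(-1)^d], and the derivative factors [(a+d)! / a!] and
    [(b+c)! / c!]. *)
Definition table_weight (a b c d : nat) : C :=
  (ff (b + d) * ff (a + d) * ff (b + c) * RtoC (-1) ^ d / (ff a * ff b * ff c * ff d))%C.

Lemma ff4_neq0 (a b c d : nat) : (ff a * ff b * ff c * ff d)%C <> RtoC 0.
Proof. repeat apply Cmult_neq_0; apply ff_neq0. Qed.

Lemma table_weight_neq0 (a b c d : nat) : table_weight a b c d <> RtoC 0.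
Proof.
  unfold table_weight, Cdiv. repeat apply Cmult_neq_0; try apply ff_neq0.
  - apply Cpow_nz, Cm1_neq0.
  - intros H. apply (f_equal (Cmult (ff a * ff b * ff c * ff d)%C)) in H.
    rewrite Cinv_r, Cmult_0_r in H by apply ff4_neq0. apply RtoC_inj in H. lra.
Qed.

Definition holomorphic (P : poly) : Prop :=
  forall a b c d, (b + d <> 0)%nat -> coeff P (a, b, c, d) = RtoC 0.

Lemma coeff_iter_twist (P : poly) (j a b c d : nat) : holomorphic P ->
  coeff (Nat.iter j twistF P) (a, b, c, d) =
  if Nat.eqb (b + d) j
  then Cmult (coeff P (a + d, 0, b + c, 0)%nat) (table_weight a b c d) else RtoC 0.
Proof.
  intros HP. revert a b c d. induction j; intros a b c d.
  - simpl Nat.iter. destruct (Nat.eqb_spec (b + d) 0) as [E | E].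
    + assert (b = 0%nat) by lia. assert (d = 0%nat) by lia. subst.
      unfold table_weight. rewrite !Nat.add_0_r, !Nat.add_0_l, !ff_0. simpl.
      field. split; apply ff_neq0.
    + apply HP. auto.
  - change (Nat.iter (S j) twistF P) with (twistF (Nat.iter j twistF P)).
    rewrite coeff_twistF.
    destruct d as [|d]; destruct b as [|b]; rewrite ?IHj.
    + simpl. ring.
    + rewrite Nat.add_0_r. replace (S b + 0)%nat with (S b) by lia.
      change (S b =? S j)%nat with (b =? j)%nat.
      destruct (Nat.eqb_spec (b + 0) j) as [E | E]; destruct (Nat.eqb_spec b j) as [E' | E']; try lia.
      * replace (b + S c)%nat with (S b + c)%nat by lia. unfold table_weight.
        rewrite !Nat.add_0_r. replace (b + S c)%nat with (S b + c)%nat by lia.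
        rewrite (ff_S b), (ff_S c). field.
        repeat split; try apply ff_neq0; apply Cnat_neq0.
      * ring.
    + change (0 + S d =? S j)%nat with (0 + d =? j)%nat.
      destruct (Nat.eqb_spec (0 + d) j) as [E | E]; [|ring].
      replace (S a + d)%nat with (a + S d)%nat by lia. unfold table_weight.
      replace (S a + d)%nat with (a + S d)%nat by lia. rewrite !Nat.add_0_l.
      rewrite (ff_S a), (ff_S d), Cpow_S. rewrite RtoC_m1.
      field. repeat split; try apply ff_neq0; apply Cnat_neq0.
    + change (S b + S d =? S j)%nat with (b + S d =? j)%nat.
      replace (S b + d)%nat with (b + S d)%nat by lia.
      destruct (Nat.eqb_spec (b + S d) j) as [E | E]; [|ring].
      replace (S a + d)%nat with (a + S d)%nat by lia. replace (b + S c)%nat with (S b + c)%nat by lia.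
      unfold table_weight.
      replace (S a + d)%nat with (a + S d)%nat by lia. replace (b + S c)%nat with (S b + c)%nat by lia.
      replace (S b + S d)%nat with (S (b + S d)) by lia. replace (S b + d)%nat with (b + S d)%nat by lia.
      rewrite (ff_S (b + S d)), (ff_S a), (ff_S b), (ff_S c), (ff_S d), Cpow_S.
      (* Pascal's rule: the two summands are the contributions of the two terms of the twist. *)
      replace (Cnat (S (b + S d))) with (Cplus (Cnat (S b)) (Cnat (S d))) by (rewrite <- Cnat_plus; f_equal; lia).
      rewrite RtoC_m1.
      field. repeat split; try apply ff_neq0; apply Cnat_neq0.
Qed.

(** The two tables that meet in [coeff_lapF] have the same margins, hence the same factor from [P].
    After the factorials cancel, only the signs [(-1)^d] and [(-1)^(d+1)] remain. *)
Lemma lapF_iter_twist (P : poly) (j : nat) (i : idx) : holomorphic P ->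
  coeff (lapF (Nat.iter j twistF P)) i = RtoC 0.
Proof.
  intros HP. destruct i as [[[a b] c] d]. rewrite coeff_lapF, !coeff_iter_twist by auto.
  replace (S b + d)%nat with (b + S d)%nat by lia.
  destruct (b + S d =? j)%nat; [|ring].
  replace (S a + d)%nat with (a + S d)%nat by lia. replace (b + S c)%nat with (S b + c)%nat by lia.
  unfold table_weight.
  replace (S a + d)%nat with (a + S d)%nat by lia. replace (b + S c)%nat with (S b + c)%nat by lia.
  replace (S b + d)%nat with (b + S d)%nat by lia.
  rewrite (ff_S a), (ff_S b), (ff_S c), (ff_S d), Cpow_S.
  rewrite RtoC_m1.
  field. repeat split; try apply ff_neq0; apply Cnat_neq0.
Qed.

Definition degree (i : idx) : nat := let '(a, b, c, d) := i in (a + b + c + d)%nat.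

Definition homog (k : nat) (P : poly) : Prop := forall i, degree i <> k -> coeff P i = RtoC 0.

Lemma homog_iter_twist (k j : nat) (P : poly) :
  holomorphic P -> homog k P -> homog k (Nat.iter j twistF P).
Proof.
  intros HP Hk [[[a b] c] d] Hd. rewrite coeff_iter_twist by auto.
  destruct (b + d =? j)%nat; auto. rewrite Hk. ring. simpl in *. lia.
Qed.

Lemma mono_scale (s : C) (i : idx) (A A' B B' : C) :
  mono i (s * A) (s * A') (s * B) (s * B') = Cmult (s ^ degree i)%C (mono i A A' B B').
Proof.
  destruct i as [[[a b] c] d]. unfold mono, degree. rewrite !Cpow_mult_l, !Cpow_add_r. ring.
Qed.

Definition dilate (s : C) : poly -> poly := pmap (fun i => (s ^ degree i)%C) (fun i => i).

Lemma ev_dilate (s : C) (P : poly) (A A' B B' : C) :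
  ev (dilate s P) A A' B B' = ev P (s * A) (s * A') (s * B) (s * B').
Proof.
  unfold dilate. rewrite ev_pmap. apply csum_ext. intros t _. rewrite mono_scale. ring.
Qed.

Lemma coeff_dilate (s : C) (P : poly) (i : idx) : coeff (dilate s P) i = Cmult (s ^ degree i)%C (coeff P i).
Proof. apply coeff_pmap. intros j. destruct (idx_dec j i); subst; auto. Qed.

Lemma RtoC_mult_pair (s x y : R) : Cmult (RtoC s) (x, y) = (s * x, s * y).
Proof. unfold Cmult, RtoC. simpl. f_equal; ring. Qed.

Lemma peval_dilate (s : R) (P : poly) (x y z w : R) :
  peval (dilate (RtoC s) P) x y z w = peval P (s * x) (s * y) (s * z) (s * w).
Proof.
  unfold peval. rewrite ev_dilate, !RtoC_mult_pair.
  replace (s * - y) with (- (s * y)) by ring. replace (s * - w) with (- (s * w)) by ring. auto.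
Qed.

Lemma peval_homog (k : nat) (P : poly) (s x y z w : R) : homog k P ->
  peval P (s * x) (s * y) (s * z) (s * w) = Cmult (RtoC (s ^ k)) (peval P x y z w).
Proof.
  intros Hk. rewrite <- peval_dilate. unfold peval. rewrite <- ev_scale. apply ev_ext.
  intros i. rewrite coeff_dilate, coeff_scale. destruct (Nat.eq_dec (degree i) k) as [E | E].
  - rewrite E, RtoC_pow. auto.
  - rewrite Hk by auto. ring.
Qed.

Lemma ex_derive_zero_punctured (f : R -> R) (x : R) :
  ex_derive f x -> (forall t, t <> x -> f t = 0) -> f x = 0.
Proof.
  intros Hf Hz. apply NNPP. intros K.
  pose proof (ex_derive_continuous f x Hf) as Hc. apply continuity_pt_filterlim in Hc.
  destruct (Hc _ (Rabs_pos_lt _ K)) as [d [Hd Hd']].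
  specialize (Hd' (x + d / 2)). simpl in Hd'. unfold Rdist in Hd'.
  rewrite (Hz (x + d / 2)) in Hd' by lra.
  rewrite Rminus_0_l, Rabs_Ropp in Hd'. apply (Rlt_irrefl (Rabs (f x))). apply Hd'.
  split. split. exact I. lra. replace (x + d / 2 - x) with (d / 2) by ring.
  rewrite Rabs_pos_eq; lra.
Qed.

Lemma isCD_zero_punctured (f : R -> C) (x : R) (l : C) : isCD f x l ->
  (forall t, t <> x -> f t = RtoC 0) -> f x = RtoC 0.
Proof.
  intros [D1 D2] H. apply injective_projections; simpl.
  - apply (ex_derive_zero_punctured (fun t => fst (f t))). eexists; exact D1. intros t Ht. rewrite H; auto.
  - apply (ex_derive_zero_punctured (fun t => snd (f t))). eexists; exact D2. intros t Ht. rewrite H; auto.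
Qed.

Lemma peval_zero_off_origin (P : poly) :
  (forall x y z w, 0 < rho x y z w -> peval P x y z w = RtoC 0) ->
  forall x y z w, peval P x y z w = RtoC 0.
Proof.
  intros H x y z w. destruct (Req_dec (rho x y z w) 0) as [E | E].
  2: { apply H. pose proof (rho_nonneg x y z w). lra. }
  apply (isCD_zero_punctured (fun t => peval P t y z w) x _ (isCD_x P x y z w)).
  intros t Ht. apply H. unfold rho in *. pose proof (pow2_ge_0 x). pose proof (pow2_ge_0 y).
  pose proof (pow2_ge_0 z). pose proof (pow2_ge_0 w).
  assert (Hx0 : x = 0). { apply NNPP; intros K; apply pow2_gt_0 in K; lra. }
  subst x. apply pow2_gt_0 in Ht. lra.
Qed.

(** * Products, and formal expressions for real polynomials *)

Definition pmul (P Q : poly) : poly :=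
  flat_map (fun t => map (fun s => (Cmult (fst t) (fst s),
    let '(a, b, c, d) := snd t in let '(a', b', c', d') := snd s in
    (a + a', b + b', c + c', d + d')%nat)) Q) P.

Lemma ev_pmul (P Q : poly) (A A' B B' : C) :
  ev (pmul P Q) A A' B B' = Cmult (ev P A A' B B') (ev Q A A' B B').
Proof.
  unfold pmul. unfold ev at 1. rewrite csum_flat_map.
  transitivity (csum P (fun t => Cmult (ev Q A A' B B') (Cmult (fst t) (mono (snd t) A A' B B')))).
  - apply csum_ext. intros [e [[[a b] c] d]] _. rewrite csum_map. unfold ev. simpl snd; simpl fst.
    rewrite Cmult_comm, <- csum_scal. apply csum_ext. intros [e' [[[a' b'] c'] d']] _. simpl fst; simpl snd.
    unfold mono. rewrite !Cpow_add_r. ring.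
  - rewrite csum_scal. unfold ev. ring.
Qed.

Lemma rpoly_peval (f : rfn) : rpoly f -> exists P, forall x y z w, RtoC (f x y z w) = peval P x y z w.
Proof.
  induction 1 as [c | | | | | f g _ [P HP] _ [Q HQ] | f g _ [P HP] _ [Q HQ]].
  - exists ((RtoC c, (0, 0, 0, 0)%nat) :: nil). intros. unfold peval, ev. simpl. ring.
  - exists ((RtoC (/ 2), (1, 0, 0, 0)%nat) :: (RtoC (/ 2), (0, 1, 0, 0)%nat) :: nil).
    intros. unfold peval, ev, mono. simpl. unfold Cmult, Cplus, RtoC. simpl. f_equal; field.
  - exists (((0, - / 2), (1, 0, 0, 0)%nat) :: ((0, / 2), (0, 1, 0, 0)%nat) :: nil).
    intros. unfold peval, ev, mono. simpl. unfold Cmult, Cplus, RtoC. simpl. f_equal; field.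
  - exists ((RtoC (/ 2), (0, 0, 1, 0)%nat) :: (RtoC (/ 2), (0, 0, 0, 1)%nat) :: nil).
    intros. unfold peval, ev, mono. simpl. unfold Cmult, Cplus, RtoC. simpl. f_equal; field.
  - exists (((0, - / 2), (0, 0, 1, 0)%nat) :: ((0, / 2), (0, 0, 0, 1)%nat) :: nil).
    intros. unfold peval, ev, mono. simpl. unfold Cmult, Cplus, RtoC. simpl. f_equal; field.
  - exists (P ++ Q). intros. unfold peval in *. rewrite ev_app, <- HP, <- HQ, RtoC_plus. auto.
  - exists (pmul P Q). intros. unfold peval in *. rewrite ev_pmul, <- HP, <- HQ, RtoC_mult. auto.
Qed.

Lemma D2_peval (P : poly) (x y z w : R) :
  D2 (fun t => fst (peval P t y z w)) x (fst (peval (dF 0 P) x y z w)) (fst (peval (dF 0 (dF 0 P)) x y z w)) /\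
  D2 (fun t => fst (peval P x t z w)) y (fst (peval (dF 1 P) x y z w)) (fst (peval (dF 1 (dF 1 P)) x y z w)) /\
  D2 (fun t => fst (peval P x y t w)) z (fst (peval (dF 2 P) x y z w)) (fst (peval (dF 2 (dF 2 P)) x y z w)) /\
  D2 (fun t => fst (peval P x y z t)) w (fst (peval (dF 3 P) x y z w)) (fst (peval (dF 3 (dF 3 P)) x y z w)).
Proof.
  split; [|split; [|split]].
  - apply (D2_intro _ (fun t => fst (peval (dF 0 P) t y z w))); auto;
    [intros t; apply (isCD_dF 0 P t y z w) | apply (isCD_dF 0 (dF 0 P) x y z w)].
  - apply (D2_intro _ (fun t => fst (peval (dF 1 P) x t z w))); auto;
    [intros t; apply (isCD_dF 1 P x t z w) | apply (isCD_dF 1 (dF 1 P) x y z w)].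
  - apply (D2_intro _ (fun t => fst (peval (dF 2 P) x y t w))); auto;
    [intros t; apply (isCD_dF 2 P x y t w) | apply (isCD_dF 2 (dF 2 P) x y z w)].
  - apply (D2_intro _ (fun t => fst (peval (dF 3 P) x y z t))); auto;
    [intros t; apply (isCD_dF 3 P x y z t) | apply (isCD_dF 3 (dF 3 P) x y z w)].
Qed.

Lemma fst_RtoC_mult (a : R) (c : C) : fst (Cmult (RtoC a) c) = a * fst c.
Proof. unfold Cmult, RtoC. simpl. ring. Qed.

(** Statements about real parts apply to imaginary parts by way of [scale (Copp Ci)]. *)
Lemma snd_eq_fst (c : C) : snd c = fst (Cmult (Copp Ci) c).
Proof. destruct c. unfold Cmult, Copp, Ci. simpl. ring. Qed.

Lemma peval_scale (c : C) (P : poly) (x y z w : R) : peval (scale c P) x y z w = Cmult c (peval P x y z w).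
Proof. apply ev_scale. Qed.

Lemma fst_peval_lapF (P : poly) (x y z w : R) :
  fst (peval (dF 0 (dF 0 P)) x y z w) + fst (peval (dF 1 (dF 1 P)) x y z w) +
  fst (peval (dF 2 (dF 2 P)) x y z w) + fst (peval (dF 3 (dF 3 P)) x y z w) =
  4 * fst (peval (lapF P) x y z w).
Proof. rewrite <- fst_RtoC_mult, <- peval_lapF. unfold Cplus. cbn [fst]. ring. Qed.

Lemma lap_peval (P : poly) (x y z w : R) :
  lap (fun x y z w => fst (peval P x y z w)) x y z w (4 * fst (peval (lapF P) x y z w)).
Proof.
  destruct (D2_peval P x y z w) as [A0 [A1 [A2 A3]]]. do 8 eexists.
  split; [exact A0 | split; [exact A1 | split; [exact A2 | split; [exact A3 |]]]].
  symmetry. apply fst_peval_lapF.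
Qed.

Lemma coeff_lapF_scale (c : C) (P : poly) (i : idx) : coeff (lapF (scale c P)) i = Cmult c (coeff (lapF P) i).
Proof. destruct i as [[[a b] e] d]. rewrite !coeff_lapF, !coeff_scale. ring. Qed.

(* Up to (-1)^d a! b! c! d!, the coefficients of a harmonic polynomial depend
   only on the margins a+d, b+c, b+d, a+c of the index. *)
Lemma harmonic_chain (P : poly) (n : nat) : (forall i, coeff (lapF P) i = RtoC 0) -> forall a b c d,
  Cmult (coeff P (a + n, b + n, c, d)%nat) (ff (a + n) * ff (b + n) * ff c * ff d)%C =
  Cmult (coeff P (a, b, c + n, d + n)%nat) (RtoC (-1) ^ n * (ff a * ff b * ff (c + n) * ff (d + n)))%C.
Proof.
  intros H. induction n; intros a b c d.
  - rewrite !Nat.add_0_r. simpl. ring.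
  - replace (a + S n)%nat with (S a + n)%nat by lia. replace (b + S n)%nat with (S b + n)%nat by lia.
    rewrite IHn. specialize (H (a, b, c + n, d + n)%nat). rewrite coeff_lapF in H.
    replace (c + S n)%nat with (S (c + n)) by lia. replace (d + S n)%nat with (S (d + n)) by lia.
    rewrite (ff_S a), (ff_S b), (ff_S (c + n)), (ff_S (d + n)), Cpow_S.
    rewrite RtoC_m1.
    set (X := coeff P (S a, S b, (c + n)%nat, (d + n)%nat)) in *.
    set (Y := coeff P (a, b, S (c + n), S (d + n))) in *.
    set (q := (Copp (RtoC 1) ^ n * (ff a * ff b * ff (c + n) * ff (d + n)))%C).
    transitivity (Cmult q (Cmult (Cmult (Cnat (S a)) (Cnat (S b))) X)). { unfold q; ring. }
    replace (Cmult (Cmult (Cnat (S a)) (Cnat (S b))) X)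
      with (Copp (Cmult (Cmult (Cnat (S (c + n))) (Cnat (S (d + n)))) Y)).
    + unfold q; ring.
    + set (U := Cmult (Cmult (Cnat (S a)) _) X) in *. set (V := Cmult _ Y) in *.
      replace U with (Cminus (Cplus U V) V) by ring. rewrite H. ring.
Qed.

(** * Decomposition of harmonic polynomials into siblings *)

Definition table_d (k i j : nat) : nat := Nat.min j (k - i).

(** The coefficient of [alpha^(k-i) beta^i] in the source of the [j]-th siblings. It is read off one
    table with margins [a + d = k - i], [b + c = i], [b + d = j], namely the one with the largest
    [d]; [harmonic_chain] connects it with all others. *)
Definition sib_coeff (k : nat) (P : poly) (j i : nat) : C :=
  let d := table_d k i j in
  let b := (j - d)%nat in let a := (k - i - d)%nat in let c := (i - b)%nat in
  Cdiv (coeff P (a, b, c, d)) (table_weight a b c d).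

Definition sib_poly (k : nat) (v : nat -> C) : poly :=
  map (fun i => (v i, (k - i, 0, i, 0)%nat)) (seq 0 (S k)).

Lemma coeff_sib_poly (k : nat) (v : nat -> C) (a b c d : nat) :
  coeff (sib_poly k v) (a, b, c, d) =
  if (Nat.eqb b 0 && Nat.eqb d 0 && Nat.eqb (a + c) k)%bool then v c else RtoC 0.
Proof.
  unfold coeff, sib_poly. rewrite csum_map. cbn [fst snd].
  destruct (Nat.eqb_spec b 0) as [Eb | Eb]; [subst b|].
  2: { apply csum_zero. intros i Hi. destruct idx_dec as [E | E]; auto. inversion E; lia. }
  destruct (Nat.eqb_spec d 0) as [Ed | Ed]; [subst d|].
  2: { apply csum_zero. intros i Hi. destruct idx_dec as [E | E]; auto. inversion E; lia. }
  destruct (Nat.eqb_spec (a + c) k) as [Ek | Ek]; cbn [andb].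
  - rewrite (csum_single _ _ c).
    + destruct idx_dec as [E | E]; auto. exfalso. apply E. repeat f_equal; lia.
    + apply seq_NoDup.
    + apply in_seq. lia.
    + intros i Hi Hne. destruct idx_dec as [E | E]; auto. inversion E; subst; contradiction.
  - apply csum_zero. intros i Hi. apply in_seq in Hi.
    destruct idx_dec as [E | E]; auto. inversion E; lia.
Qed.

Lemma holomorphic_sib_poly (k : nat) (v : nat -> C) : holomorphic (sib_poly k v).
Proof.
  intros a b c d H. rewrite coeff_sib_poly.
  destruct (Nat.eqb_spec b 0); destruct (Nat.eqb_spec d 0); simpl; auto; lia.
Qed.

Lemma homog_sib_poly (k : nat) (v : nat -> C) : homog k (sib_poly k v).
Proof.
  intros [[[a b] c] d] H. rewrite coeff_sib_poly. simpl in H.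
  destruct (Nat.eqb_spec b 0); destruct (Nat.eqb_spec d 0); simpl; auto.
  destruct (Nat.eqb_spec (a + c) k); auto. lia.
Qed.

Definition sib_sum (k : nat) (g : nat -> poly) : poly :=
  flat_map (fun j => Nat.iter j twistF (g j)) (seq 0 (S k)).

Lemma coeff_sib_sum (k : nat) (g : nat -> poly) (a b c d : nat) :
  (forall j, holomorphic (g j)) -> (b + d <= k)%nat ->
  coeff (sib_sum k g) (a, b, c, d) =
  Cmult (coeff (g (b + d)%nat) (a + d, 0, b + c, 0)%nat) (table_weight a b c d).
Proof.
  intros Hg Hk. unfold sib_sum, coeff at 1. rewrite csum_flat_map.
  rewrite (csum_single _ _ (b + d)%nat).
  - change (coeff (Nat.iter (b + d) twistF (g (b + d)%nat)) (a, b, c, d) =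
      Cmult (coeff (g (b + d)%nat) (a + d, 0, b + c, 0)%nat) (table_weight a b c d)).
    rewrite coeff_iter_twist by auto. rewrite Nat.eqb_refl. auto.
  - apply seq_NoDup.
  - apply in_seq. lia.
  - intros j Hj Hne. change (coeff (Nat.iter j twistF (g j)) (a, b, c, d) = RtoC 0).
    rewrite coeff_iter_twist by auto. destruct (Nat.eqb_spec (b + d) j); auto. congruence.
Qed.

Lemma homog_sib_sum (k : nat) (g : nat -> poly) :
  (forall j, holomorphic (g j)) -> (forall j, homog k (g j)) -> homog k (sib_sum k g).
Proof.
  intros H1 H2 i Hi. unfold sib_sum, coeff. rewrite csum_flat_map. apply csum_zero.
  intros j _. apply (homog_iter_twist k j (g j)); auto.
Qed.

Lemma peval_sib_sum (k : nat) (g : nat -> poly) (x y z w : R) :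
  peval (sib_sum k g) x y z w = csum (seq 0 (S k)) (fun j => peval (Nat.iter j twistF (g j)) x y z w).
Proof. unfold sib_sum, peval, ev. rewrite csum_flat_map. auto. Qed.

(** Both sides agree on the tables used by [sib_coeff], by its choice. Any other table lies
    [n = d0 - d] steps away along the chain, where the weights change in the same way as the
    coefficients of [P]. *)
Lemma harmonic_decomposition (k : nat) (P : poly) (i : idx) :
  homog k P -> (forall i, coeff (lapF P) i = RtoC 0) ->
  coeff P i = coeff (sib_sum k (fun j => sib_poly k (sib_coeff k P j))) i.
Proof.
  intros Hk Hl.
  assert (HG : homog k (sib_sum k (fun j => sib_poly k (sib_coeff k P j)))).
  { apply homog_sib_sum; intros; [apply holomorphic_sib_poly | apply homog_sib_poly]. }
  destruct (Nat.eq_dec (degree i) k) as [E | E].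
  2: { rewrite Hk, HG; auto. }
  destruct i as [[[a b] c] d]. simpl in E.
  rewrite coeff_sib_sum by (try lia; intros; apply holomorphic_sib_poly).
  rewrite coeff_sib_poly.
  replace (a + d + (b + c) =? k)%nat with true by (symmetry; apply Nat.eqb_eq; lia).
  cbn [Nat.eqb andb]. unfold sib_coeff, table_d.
  set (d0 := Nat.min (b + d) (k - (b + c))).
  assert (Hd0 : (d <= d0)%nat) by (unfold d0; lia).
  set (n := (d0 - d)%nat).
  assert (Hn : (n <= a /\ n <= b)%nat) by (unfold n, d0; lia).
  replace (k - (b + c) - d0)%nat with (a - n)%nat by (unfold n; lia).
  replace (b + d - d0)%nat with (b - n)%nat by (unfold n; lia).
  replace (b + c - (b - n))%nat with (c + n)%nat by lia.
  replace d0 with (d + n)%nat by (unfold n; lia).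
  pose proof (harmonic_chain P n Hl (a - n)%nat (b - n)%nat c d) as K.
  replace (a - n + n)%nat with a in K by lia. replace (b - n + n)%nat with b in K by lia.
  unfold table_weight.
  replace (b - n + (d + n))%nat with (b + d)%nat by lia.
  replace (a - n + (d + n))%nat with (a + d)%nat by lia.
  replace (b - n + (c + n))%nat with (b + c)%nat by lia.
  rewrite Cpow_add_r.
  assert (N1 := ff4_neq0 a b c d).
  apply (f_equal (fun v => Cdiv v (ff a * ff b * ff c * ff d)%C)) in K.
  assert (Hm : (RtoC (-1) ^ n * RtoC (-1) ^ n = 1)%C).
  { rewrite <- Cpow_mult_l. replace (RtoC (-1) * RtoC (-1))%C with (RtoC 1).
    apply Cpow_1_l. rewrite <- RtoC_mult. f_equal; ring. }
  assert (Hm0 : (RtoC (-1) ^ n)%C <> RtoC 0) by apply Cpow_nz, Cm1_neq0.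
  assert (Hm1 : (RtoC (-1) ^ d)%C <> RtoC 0) by apply Cpow_nz, Cm1_neq0.
  set (u := (RtoC (-1) ^ n)%C) in *. set (v := (RtoC (-1) ^ d)%C) in *.
  (* [u] is a power of -1, hence its own inverse. *)
  assert (Hu : Cinv u = u).
  { replace u with (Cmult (Cinv u) (Cmult u u)) at 2 by (field; auto). rewrite Hm. ring. }
  transitivity (Cdiv (Cmult (coeff P (a, b, c, d)) (ff a * ff b * ff c * ff d)%C) (ff a * ff b * ff c * ff d)%C).
  { field. repeat split; apply ff_neq0. }
  rewrite K. rewrite <- Hu at 1. field. repeat split; try apply ff_neq0; auto.
Qed.

(** * Modes are restrictions of homogeneous harmonic polynomials *)

Lemma ext_scale (F : fn) (s x y z w : R) : 0 < s -> 0 < rho x y z w ->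
  ext F (s * x) (s * y) (s * z) (s * w) = ext F x y z w.
Proof.
  intros Hs Hp. unfold ext. cbv zeta. change ((s * x) ^ 2 + (s * y) ^ 2 + (s * z) ^ 2 + (s * w) ^ 2)
    with (rho (s * x) (s * y) (s * z) (s * w)). rewrite rho_scale.
  change (x ^ 2 + y ^ 2 + z ^ 2 + w ^ 2) with (rho x y z w).
  rewrite sqrt_mult by (try apply pow2_ge_0; lra). rewrite sqrt_pow2 by lra.
  assert (Hr := sqrt_lt_R0 _ Hp). f_equal; field; lra.
Qed.

Lemma ext_sphere (F : fn) (x y z w : R) : rho x y z w = 1 -> ext F x y z w = F x y z w.
Proof.
  intros H. unfold ext. cbv zeta. change (x ^ 2 + y ^ 2 + z ^ 2 + w ^ 2) with (rho x y z w).
  rewrite H, sqrt_1. unfold Rdiv. rewrite Rinv_1, !Rmult_1_r. auto.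
Qed.

Lemma lap4_components (G : fn) (x y z w : R) :
  fst (Lap4 G x y z w) = (let g := fun x y z w => fst (G x y z w) in
    pd 0 (pd 0 g) x y z w + pd 1 (pd 1 g) x y z w + pd 2 (pd 2 g) x y z w + pd 3 (pd 3 g) x y z w) /\
  snd (Lap4 G x y z w) = (let g := fun x y z w => snd (G x y z w) in
    pd 0 (pd 0 g) x y z w + pd 1 (pd 1 g) x y z w + pd 2 (pd 2 g) x y z w + pd 3 (pd 3 g) x y z w).
Proof.
  cbv zeta. rewrite <- !partial_fst, <- !partial_snd.
  unfold Lap4, Cplus. cbn [fst snd]. rewrite !partial_eq. cbn [fst snd].
  rewrite <- !partial_fst, <- !partial_snd. split; ring.
Qed.

Lemma pow2_inj (a b : nat) : 2 ^ a = 2 ^ b -> a = b.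
Proof.
  intros H. destruct (Nat.lt_trichotomy a b) as [K | [K | K]]; auto;
  apply (Rlt_pow 2) in K; lra.
Qed.

Lemma mode_polynomial (Gam : mat2 -> Prop) (k : nat) (F : fn) : is_mode Gam k F ->
  exists P, homog k P /\ (forall i, coeff (lapF P) i = RtoC 0) /\
    forall x y z w, on_S3 x y z w -> F x y z w = peval P x y z w.
Proof.
  intros [HC2 [Heig _]]. apply C2_away0_iff in HC2. destruct HC2 as [C1 C2].
  destruct (eigenfunction_polynomial (fun x y z w => fst (ext F x y z w)) k C1) as [P1 [R1 E1]].
  { intros s x y z w Hs Hp. rewrite ext_scale; auto. }
  { intros x y z w Hp. pose proof (proj1 (lap4_components (ext F) x y z w)) as K. cbv zeta in K.
    rewrite <- K. change (Lap4 (ext F)) with (LapS3 F). rewrite (Heig x y z w Hp), ext_sphere by auto.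
    unfold Cmult, RtoC. simpl. ring. }
  destruct (eigenfunction_polynomial (fun x y z w => snd (ext F x y z w)) k C2) as [P2 [R2 E2]].
  { intros s x y z w Hs Hp. rewrite ext_scale; auto. }
  { intros x y z w Hp. pose proof (proj2 (lap4_components (ext F) x y z w)) as K. cbv zeta in K.
    rewrite <- K. change (Lap4 (ext F)) with (LapS3 F). rewrite (Heig x y z w Hp), ext_sphere by auto.
    unfold Cmult, RtoC. simpl. ring. }
  destruct (rpoly_peval P1 R1) as [Q1 H1]. destruct (rpoly_peval P2 R2) as [Q2 H2].
  set (P := Q1 ++ scale Ci Q2).
  assert (HP : forall x y z w, peval P x y z w = (P1 x y z w, P2 x y z w)).
  { intros. unfold P, peval. rewrite ev_app, ev_scale.
    change (Cplus (peval Q1 x y z w) (Cmult Ci (peval Q2 x y z w)) = (P1 x y z w, P2 x y z w)).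
    rewrite <- H1, <- H2. unfold Cplus, Cmult, Ci, RtoC. simpl. f_equal; ring. }
  exists P. split; [|split].
  (* Homogeneity: [P (2 p) = 2^k P p] off the origin, so a nonzero coefficient of degree [e]
     requires [2^e = 2^k]. *)
  - assert (Z : forall i, coeff (dilate (RtoC 2) P ++ scale (RtoC (- 2 ^ k)) P) i = RtoC 0).
    { apply coeff_zero. apply peval_zero_off_origin. intros x y z w Hp.
      unfold peval. rewrite ev_app, ev_scale.
      change (Cplus (peval (dilate (RtoC 2) P) x y z w) (Cmult (RtoC (- 2 ^ k)) (peval P x y z w)) = RtoC 0).
      rewrite peval_dilate, !HP.
      assert (Hp2 : 0 < rho (2 * x) (2 * y) (2 * z) (2 * w)) by (rewrite rho_scale; lra).
      rewrite <- (proj1 (E1 _ _ _ _ Hp2)), <- (proj1 (E2 _ _ _ _ Hp2)).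
      rewrite <- (proj1 (E1 _ _ _ _ Hp)), <- (proj1 (E2 _ _ _ _ Hp)).
      rewrite ext_scale by (auto; lra). rewrite rho_scale, sqrt_mult, sqrt_pow2 by lra.
      rewrite Rpow_mult_distr. unfold Cplus, Cmult, RtoC. simpl. f_equal; ring. }
    intros i Hi. specialize (Z i). rewrite coeff_app, coeff_dilate, coeff_scale in Z.
    assert (Hc : Cmult (Cplus (RtoC 2 ^ degree i)%C (RtoC (- 2 ^ k))) (coeff P i) = RtoC 0).
    { rewrite <- Z. ring. }
    rewrite <- RtoC_pow, <- RtoC_plus in Hc.
    apply (f_equal (Cmult (Cinv (RtoC (2 ^ degree i + - 2 ^ k))))) in Hc.
    rewrite Cmult_assoc, Cinv_l, Cmult_1_l, Cmult_0_r in Hc; auto.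
    intros K. apply RtoC_inj in K. apply Hi, pow2_inj. lra.
  (* The Laplacian is 0 by [eigenfunction_polynomial] and four times [lapF] by [lap_peval];
     uniqueness of derivatives identifies the two, for the real and the imaginary part
     separately. *)
  - apply coeff_zero. apply peval_zero_off_origin. intros x y z w Hp.
    assert (T1 : (fun x y z w => fst (peval P x y z w)) = P1).
    { repeat (apply functional_extensionality; intro). rewrite HP. auto. }
    assert (T2 : (fun x y z w => fst (peval (scale (Copp Ci) P) x y z w)) = P2).
    { repeat (apply functional_extensionality; intro). rewrite peval_scale, <- snd_eq_fst, HP. auto. }
    pose proof (lap_peval P x y z w) as L1. rewrite T1 in L1.
    pose proof (lap_peval (scale (Copp Ci) P) x y z w) as L2. rewrite T2 in L2.
    apply (lap_unique _ _ _ _ _ _ _ (proj2 (E1 _ _ _ _ Hp))) in L1.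
    apply (lap_unique _ _ _ _ _ _ _ (proj2 (E2 _ _ _ _ Hp))) in L2.
    rewrite (peval_ext _ (scale (Copp Ci) (lapF P))) in L2
      by (intros i; rewrite coeff_lapF_scale, coeff_scale; auto).
    rewrite peval_scale, <- snd_eq_fst in L2.
    apply injective_projections; simpl; lra.
  - intros x y z w Hs. change (rho x y z w = 1) in Hs. assert (Hp : 0 < rho x y z w) by lra.
    rewrite HP, <- (proj1 (E1 _ _ _ _ Hp)), <- (proj1 (E2 _ _ _ _ Hp)), !Hs, sqrt_1, pow1, !Rmult_1_l.
    rewrite ext_sphere by auto. destruct (F x y z w); auto.
Qed.

(** * The action of the binary dihedral group *)

(** [rot g] is [app_mat (minv g)]; leaving the inverse out makes composition a plain matrix
    product. *)
Definition app_mat (g : mat2) (F : fn) : fn := fun x y z w =>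
  let a := Cplus (Cmult (m11 g) (x, y)) (Cmult (m12 g) (z, w)) in
  let b := Cplus (Cmult (m21 g) (x, y)) (Cmult (m22 g) (z, w)) in
  F (fst a) (snd a) (fst b) (snd b).

Lemma app_mat_mmul (g h : mat2) (F : fn) : app_mat (mmul g h) F = app_mat h (app_mat g F).
Proof.
  repeat (apply functional_extensionality; intro). unfold app_mat, mmul. cbn [m11 m12 m21 m22].
  cbv zeta. rewrite <- !surjective_pairing.
  match goal with |- F (fst ?A) _ (fst ?B) _ = F (fst ?A') _ (fst ?B') _ =>
    replace A with A' by ring; replace B with B' by ring; reflexivity end.
Qed.

Lemma minv_det1 (g : mat2) : mdet g = RtoC 1 -> minv g = Mat2 (m22 g) (Copp (m12 g)) (Copp (m21 g)) (m11 g).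
Proof.
  intros H. unfold minv. rewrite H. cbv zeta.
  replace (Cinv (RtoC 1)) with (RtoC 1). f_equal; ring.
  field.
Qed.

Lemma app_mat_id (F : fn) (x y z w : R) : app_mat (Mat2 (RtoC 1) (RtoC 0) (RtoC 0) (RtoC 1)) F x y z w = F x y z w.
Proof.
  unfold app_mat. cbn [m11 m12 m21 m22]. cbv zeta.
  replace (Cplus (Cmult (RtoC 1) (x, y)) (Cmult (RtoC 0) (z, w))) with ((x, y) : C) by (unfold Cplus, Cmult, RtoC; simpl; f_equal; ring).
  replace (Cplus (Cmult (RtoC 0) (x, y)) (Cmult (RtoC 1) (z, w))) with ((z, w) : C) by (unfold Cplus, Cmult, RtoC; simpl; f_equal; ring). auto.
Qed.

Lemma cexp_i_inv (t : R) : Cmult (cexp_i t) (cexp_i (- t)) = RtoC 1.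
Proof.
  unfold cexp_i, Cmult, RtoC. simpl. rewrite cos_neg, sin_neg.
  pose proof (sin2_cos2 t) as H. unfold Rsqr in H. f_equal; [lra | ring].
Qed.

Lemma Ci_sqr : Cmult Ci Ci = RtoC (-1).
Proof. unfold Cmult, Ci, RtoC. simpl. f_equal; ring. Qed.

Lemma det_Dgen1 : mdet Dgen1 = RtoC 1.
Proof. unfold mdet, Dgen1; cbn [m11 m12 m21 m22]. rewrite Ci_sqr. unfold Cminus, Cmult, Cplus, Copp, RtoC; simpl; f_equal; ring. Qed.

Lemma det_Dgen2 (m : nat) : mdet (Dgen2 m) = RtoC 1.
Proof. unfold mdet, Dgen2; cbn [m11 m12 m21 m22]. rewrite cexp_i_inv. ring. Qed.

Lemma minv_Dgen1 : minv Dgen1 = Mat2 (RtoC 0) (Copp Ci) (Copp Ci) (RtoC 0).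
Proof. rewrite minv_det1 by apply det_Dgen1. reflexivity. Qed.

Lemma minv_Dgen2 (m : nat) : minv (Dgen2 m) =
  Mat2 (cexp_i (- (PI / INR m))) (RtoC 0) (RtoC 0) (cexp_i (PI / INR m)).
Proof. rewrite minv_det1 by apply det_Dgen2. unfold Dgen2; cbn [m11 m12 m21 m22]. f_equal; ring. Qed.

(* Invariance on all of C^2 propagates from the generators to the group
   without having to know that the group preserves the sphere. *)
Lemma Dstar_invariant (m : nat) (F : fn) :
  app_mat (minv Dgen1) F = F -> app_mat (minv (Dgen2 m)) F = F -> invariant (in_Dstar m) F.
Proof.
  intros H1 H2 g Hg.
  (* The determinant is carried along because [minv_det1] rewrites the inverse without division only
     when it is 1. *)
  assert (K : mdet g = RtoC 1 /\ app_mat (minv g) F = F).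
  { induction Hg as [| | g h _ [Dg Ag] _ [Dh Ah] | g _ [Dg Ag]].
    - split; auto. apply det_Dgen1.
    - split; auto. apply det_Dgen2.
    - assert (D : mdet (mmul g h) = RtoC 1).
      { transitivity (Cmult (mdet g) (mdet h)). unfold mdet, mmul; cbn [m11 m12 m21 m22]; ring.
        rewrite Dg, Dh; ring. }
      split; auto.
      replace (minv (mmul g h)) with (mmul (minv h) (minv g)).
      + rewrite app_mat_mmul, Ah, Ag. auto.
      + rewrite !minv_det1 by auto. unfold mmul; cbn [m11 m12 m21 m22]. f_equal; ring.
    - assert (D : mdet (minv g) = RtoC 1).
      { rewrite minv_det1 by auto. rewrite <- Dg. unfold mdet; cbn [m11 m12 m21 m22]; ring. }
      split; auto.
      assert (E : minv (minv g) = g).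
      { rewrite (minv_det1 (minv g)), (minv_det1 g) by auto. cbn [m11 m12 m21 m22].
        destruct g as [p q r s]; cbn [m11 m12 m21 m22]; f_equal; ring. }
      rewrite E. rewrite <- Ag at 1. rewrite <- app_mat_mmul.
      replace (mmul (minv g) g) with (Mat2 (RtoC 1) (RtoC 0) (RtoC 0) (RtoC 1)).
      + repeat (apply functional_extensionality; intro). apply app_mat_id.
      + rewrite minv_det1 by auto. unfold mmul; cbn [m11 m12 m21 m22]. rewrite <- Dg. unfold mdet. f_equal; ring. }
  intros x y z w _. change (app_mat (minv g) F x y z w = F x y z w). rewrite (proj2 K). auto.
Qed.

(** The inverse of [Dgen1] replaces alpha by [-i beta] and beta by [-i alpha], hence their
    conjugates by [i] times the conjugates, exchanged. *)
Definition sub1 : poly -> poly :=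
  pmap (fun '(a, b, c, d) => (Copp Ci ^ (a + c) * Ci ^ (b + d))%C) (fun '(a, b, c, d) => (c, d, a, b)).

Definition sub2 (u v : C) : poly -> poly :=
  pmap (fun '(a, b, c, d) => (v ^ (a + d) * u ^ (b + c))%C) (fun i => i).

Lemma ev_sub1 (P : poly) (A A' B B' : C) :
  ev (sub1 P) A A' B B' = ev P (Copp Ci * B) (Ci * B') (Copp Ci * A) (Ci * A').
Proof.
  unfold sub1. rewrite ev_pmap. apply csum_ext. intros [e [[[a b] c] d]] _. cbn [fst snd].
  unfold mono. rewrite !Cpow_mult_l, !Cpow_add_r. ring.
Qed.

Lemma ev_sub2 (u v : C) (P : poly) (A A' B B' : C) :
  ev (sub2 u v P) A A' B B' = ev P (v * A) (u * A') (u * B) (v * B').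
Proof.
  unfold sub2. rewrite ev_pmap. apply csum_ext. intros [e [[[a b] c] d]] _. cbn [fst snd].
  unfold mono. rewrite !Cpow_mult_l, !Cpow_add_r. ring.
Qed.

Lemma coeff_sub1 (P : poly) (a b c d : nat) :
  coeff (sub1 P) (a, b, c, d) = Cmult (Copp Ci ^ (a + c) * Ci ^ (b + d))%C (coeff P (c, d, a, b)).
Proof.
  apply coeff_pmap. intros [[[a' b'] c'] d'].
  destruct idx_dec as [E | E]; destruct idx_dec as [E' | E']; auto.
  - inversion E'; subst. f_equal; f_equal; lia.
  - exfalso. apply E'. inversion E; subst; auto.
  - exfalso. apply E. inversion E'; subst; auto.
Qed.

Lemma coeff_sub2 (u v : C) (P : poly) (a b c d : nat) :
  coeff (sub2 u v P) (a, b, c, d) = Cmult (v ^ (a + d) * u ^ (b + c))%C (coeff P (a, b, c, d)).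
Proof.
  apply coeff_pmap. intros [[[a' b'] c'] d'].
  destruct idx_dec as [E | E]; auto. inversion E; subst; auto.
Qed.

Lemma peval_conj (P : poly) (a b : C) :
  peval P (fst a) (snd a) (fst b) (snd b) = ev P a (Cconj a) b (Cconj b).
Proof. destruct a, b. reflexivity. Qed.

Lemma app_Dgen1_peval (P : poly) : app_mat (minv Dgen1) (peval P) = peval (sub1 P).
Proof.
  repeat (apply functional_extensionality; intro). rewrite minv_Dgen1. unfold app_mat.
  cbn [m11 m12 m21 m22]. cbv zeta. rewrite peval_conj. unfold peval. rewrite ev_sub1.
  f_equal; unfold Cconj, Cmult, Cplus, Copp, Ci, RtoC; simpl; f_equal; ring.
Qed.

Lemma app_Dgen2_peval (m : nat) (P : poly) : app_mat (minv (Dgen2 m)) (peval P) =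
  peval (sub2 (cexp_i (PI / INR m)) (cexp_i (- (PI / INR m))) P).
Proof.
  repeat (apply functional_extensionality; intro). rewrite minv_Dgen2. unfold app_mat.
  cbn [m11 m12 m21 m22]. cbv zeta. rewrite peval_conj. unfold peval. rewrite ev_sub2.
  f_equal; unfold Cconj, Cmult, Cplus, Copp, cexp_i, RtoC; simpl; rewrite ?cos_neg, ?sin_neg; f_equal; ring.
Qed.

Definition inv_coeffs (m : nat) (P : poly) : Prop := forall a b c d,
  coeff P (a, b, c, d) = Cmult (Copp Ci ^ (a + c) * Ci ^ (b + d))%C (coeff P (c, d, a, b)) /\
  coeff P (a, b, c, d) =
    Cmult (cexp_i (- (PI / INR m)) ^ (a + d) * cexp_i (PI / INR m) ^ (b + c))%C (coeff P (a, b, c, d)).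

Lemma inv_coeffs_invariant (m : nat) (P : poly) : inv_coeffs m P -> invariant (in_Dstar m) (peval P).
Proof.
  intros H. apply Dstar_invariant.
  - rewrite app_Dgen1_peval. apply peval_ext. intros [[[a b] c] d]. rewrite coeff_sub1.
    symmetry. apply H.
  - rewrite app_Dgen2_peval. apply peval_ext. intros [[[a b] c] d]. rewrite coeff_sub2.
    symmetry. apply H.
Qed.

Lemma peval_minus (P Q : poly) (x y z w : R) :
  peval (P ++ scale (RtoC (-1)) Q) x y z w = Cminus (peval P x y z w) (peval Q x y z w).
Proof. unfold peval. rewrite ev_app, ev_scale. rewrite RtoC_m1. ring. Qed.

Lemma coeff_unique (P Q : poly) : (forall x y z w, peval P x y z w = peval Q x y z w) ->
  forall i, coeff P i = coeff Q i.
Proof.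
  intros H i. assert (K : coeff (P ++ scale (RtoC (-1)) Q) i = RtoC 0).
  { apply coeff_zero. intros. rewrite peval_minus, H. ring. }
  rewrite coeff_app, coeff_scale in K.
  rewrite RtoC_m1 in K.
  replace (coeff P i) with (Cplus (Cplus (coeff P i) (Cmult (Copp (RtoC 1)) (coeff Q i))) (coeff Q i)) by ring.
  rewrite K. ring.
Qed.

Lemma app_invariant_inv_coeffs (m : nat) (P : poly) :
  app_mat (minv Dgen1) (peval P) = peval P -> app_mat (minv (Dgen2 m)) (peval P) = peval P ->
  inv_coeffs m P.
Proof.
  intros H1 H2 a b c d. rewrite app_Dgen1_peval in H1. rewrite app_Dgen2_peval in H2. split.
  - rewrite <- coeff_sub1. symmetry. apply coeff_unique. intros. rewrite H1. auto.
  - rewrite <- coeff_sub2. symmetry. apply coeff_unique. intros. rewrite H2. auto.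
Qed.

Lemma homog_zero_sphere (k : nat) (P : poly) : homog k P ->
  (forall x y z w, on_S3 x y z w -> peval P x y z w = RtoC 0) ->
  forall x y z w, peval P x y z w = RtoC 0.
Proof.
  intros Hk H. apply peval_zero_off_origin. intros x y z w Hp.
  destruct (rho_normalize _ _ _ _ Hp) as [Hs H1].
  pose proof (H _ _ _ _ H1) as K. rewrite (peval_homog k) in K by auto.
  assert (Hn : RtoC ((/ sqrt (rho x y z w)) ^ k) <> RtoC 0).
  { intros E. apply RtoC_inj in E. revert E. apply pow_nonzero. lra. }
  apply (f_equal (Cmult (Cinv (RtoC ((/ sqrt (rho x y z w)) ^ k))))) in K.
  rewrite Cmult_assoc, Cinv_l, Cmult_1_l, Cmult_0_r in K; auto.
Qed.

Lemma homog_sphere_unique (k : nat) (P Q : poly) : homog k P -> homog k Q ->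
  (forall x y z w, on_S3 x y z w -> peval P x y z w = peval Q x y z w) ->
  forall x y z w, peval P x y z w = peval Q x y z w.
Proof.
  intros HP HQ H x y z w.
  assert (K : peval (P ++ scale (RtoC (-1)) Q) x y z w = RtoC 0).
  { apply (homog_zero_sphere k).
    - intros i Hi. rewrite coeff_app, coeff_scale, HP, HQ by auto. ring.
    - intros. rewrite peval_minus, H by auto. ring. }
  rewrite peval_minus in K.
  replace (peval P x y z w) with (Cplus (Cminus (peval P x y z w) (peval Q x y z w)) (peval Q x y z w)) by ring.
  rewrite K. ring.
Qed.

Lemma homog_sub1 (k : nat) (P : poly) : homog k P -> homog k (sub1 P).
Proof.
  intros H [[[a b] c] d] Hd. rewrite coeff_sub1, H. ring. simpl in *. lia.
Qed.

Lemma homog_sub2 (k : nat) (u v : C) (P : poly) : homog k P -> homog k (sub2 u v P).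
Proof.
  intros H [[[a b] c] d] Hd. rewrite coeff_sub2, H. ring. simpl in *. lia.
Qed.

(** Invariance is given on the sphere only. Both sides are homogeneous of degree [k], so the
    equality extends to all points and from there to coefficients. The computations at the ends of
    the two cases check that the inverse generators preserve the sphere. *)
Lemma mode_inv_coeffs (m k : nat) (F : fn) (P : poly) : invariant (in_Dstar m) F -> homog k P ->
  (forall x y z w, on_S3 x y z w -> F x y z w = peval P x y z w) -> inv_coeffs m P.
Proof.
  intros HF Hk HP. apply app_invariant_inv_coeffs.
  - rewrite app_Dgen1_peval. repeat (apply functional_extensionality; intro).
    apply (homog_sphere_unique k); auto. apply homog_sub1; auto.
    intros x3 y z w Hs. rewrite <- (HP x3 y z w Hs), <- (HF _ (Dstar_gen1 m) _ _ _ _ Hs).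
    rewrite <- app_Dgen1_peval. symmetry. apply HP.
    rewrite minv_Dgen1. cbn [m11 m12 m21 m22]. unfold alpha, beta, on_S3 in *.
    unfold Cplus, Cmult, Copp, Ci, RtoC. cbn [fst snd].
    transitivity (x3 ^ 2 + y ^ 2 + z ^ 2 + w ^ 2); [ring | exact Hs].
  - rewrite app_Dgen2_peval. repeat (apply functional_extensionality; intro).
    apply (homog_sphere_unique k); auto. apply homog_sub2; auto.
    intros x3 y z w Hs. rewrite <- (HP x3 y z w Hs), <- (HF _ (Dstar_gen2 m) _ _ _ _ Hs).
    rewrite <- app_Dgen2_peval. symmetry. apply HP.
    rewrite minv_Dgen2. cbn [m11 m12 m21 m22]. unfold alpha, beta, on_S3 in *.
    unfold Cplus, Cmult, Copp, cexp_i, RtoC. cbn [fst snd]. rewrite !cos_neg, !sin_neg.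
    pose proof (sin2_cos2 (PI / INR m)) as T. unfold Rsqr in T.
    transitivity ((x3 ^ 2 + y ^ 2 + z ^ 2 + w ^ 2) *
      (sin (PI / INR m) * sin (PI / INR m) + cos (PI / INR m) * cos (PI / INR m))); [ring|].
    rewrite T, Hs. ring.
Qed.

(** * Invariance passes between siblings and their sources *)

Lemma Copp_Ci_pow (n : nat) : (Copp Ci ^ n = RtoC (-1) ^ n * Ci ^ n)%C.
Proof.
  rewrite <- Cpow_mult_l. f_equal. unfold Copp, Cmult, Ci, RtoC; simpl; f_equal; ring.
Qed.

Lemma Cm1_pow_sqr (n : nat) : (RtoC (-1) ^ n * RtoC (-1) ^ n = 1)%C.
Proof.
  rewrite <- Cpow_mult_l. replace (RtoC (-1) * RtoC (-1))%C with (RtoC 1).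
  apply Cpow_1_l. rewrite <- RtoC_mult. f_equal; ring.
Qed.

(** The sign compensates the quotient of [(-i)^(b+d)] and [i^(b+d)] in the action of the first
    generator. *)
Lemma table_weight_swap (a b c d : nat) :
  table_weight c d a b = Cmult (RtoC (-1) ^ (b + d))%C (table_weight a b c d).
Proof.
  unfold table_weight. rewrite (Nat.add_comm d b), (Nat.add_comm c b), (Nat.add_comm d a), Cpow_add_r.
  transitivity ((RtoC (-1) ^ d * RtoC (-1) ^ d) * (ff (b + d) * ff (b + c) * ff (a + d) * RtoC (-1) ^ b / (ff c * ff d * ff a * ff b)))%C.
  - rewrite Cm1_pow_sqr. ring.
  - field. repeat split; apply ff_neq0.
Qed.

Definition inv_holo (m : nat) (P : poly) : Prop := forall a c,
  coeff P (a, 0, c, 0)%nat = Cmult (Copp Ci ^ (a + c))%C (coeff P (c, 0, a, 0)%nat) /\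
  coeff P (a, 0, c, 0)%nat =
    Cmult (cexp_i (- (PI / INR m)) ^ a * cexp_i (PI / INR m) ^ c)%C (coeff P (a, 0, c, 0)%nat).

Lemma inv_coeffs_holo (m : nat) (P : poly) : inv_coeffs m P -> inv_holo m P.
Proof.
  intros H a c. destruct (H a 0%nat c 0%nat) as [H1 H2].
  rewrite Nat.add_0_r in H2. simpl Nat.add in H1. simpl Nat.add in H2. split; auto.
  rewrite H1 at 1. simpl Cpow. ring.
Qed.

(** The twist commutes with the group. On coefficients: the second generator acts through the
    margins [a + d] and [b + c] alone, and the first exchanges these margins. *)
Lemma inv_holo_iter_twist (m j : nat) (P : poly) : holomorphic P -> inv_holo m P ->
  inv_coeffs m (Nat.iter j twistF P).
Proof.
  intros HP H a b c d. rewrite !coeff_iter_twist by auto. rewrite (Nat.add_comm d b).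
  destruct (b + d =? j)%nat; [|split; ring].
  destruct (H (a + d)%nat (b + c)%nat) as [H1 H2]. split.
  - rewrite H1 at 1. rewrite (table_weight_swap a b c d), (Nat.add_comm c b), (Nat.add_comm d a).
    replace (a + d + (b + c))%nat with ((a + c) + (b + d))%nat by lia.
    rewrite (Cpow_add_r (Copp Ci) (a + c)), (Copp_Ci_pow (b + d)). ring.
  - rewrite H2 at 1. ring.
Qed.

Lemma inv_coeffs_sib (m k j i : nat) (v : nat -> nat -> C) : (j <= k)%nat -> (i <= k)%nat ->
  inv_coeffs m (sib_sum k (fun j => sib_poly k (v j))) ->
  v j i = Cmult (Copp Ci ^ k)%C (v j (k - i)%nat) /\
  v j i = Cmult (cexp_i (- (PI / INR m)) ^ (k - i) * cexp_i (PI / INR m) ^ i)%C (v j i).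
Proof.
  intros Hj Hi H.
  (* A table with margins [k - i], [i] and [j]. There the sum has one nonvanishing contribution at
     most, and the nonzero weight cancels. *)
  set (d := Nat.min j (k - i)). set (b := (j - d)%nat). set (a := (k - i - d)%nat). set (c := (i - b)%nat).
  assert (E1 : (b + d = j)%nat) by (unfold b, d; lia).
  assert (E2 : (a + d = k - i)%nat) by (unfold a, d; lia).
  assert (E3 : (b + c = i)%nat) by (unfold c, b, d; lia).
  destruct (H a b c d) as [H1 H2].
  assert (Hh : forall j, holomorphic (sib_poly k (v j))) by (intros; apply holomorphic_sib_poly).
  rewrite (coeff_sib_sum k _ a b c d Hh) in H1, H2 by lia.
  rewrite (coeff_sib_sum k _ c d a b Hh) in H1 by lia.
  rewrite !coeff_sib_poly in H1. rewrite !coeff_sib_poly in H2.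
  replace (a + d + (b + c) =? k)%nat with true in H1, H2 by (symmetry; apply Nat.eqb_eq; lia).
  replace (c + b + (d + a) =? k)%nat with true in H1 by (symmetry; apply Nat.eqb_eq; lia).
  cbn [Nat.eqb andb] in H1, H2.
  replace (d + b)%nat with j in H1 by lia. replace (d + a)%nat with (k - i)%nat in H1 by lia.
  rewrite (table_weight_swap a b c d) in H1. rewrite E1, E3 in H1. rewrite E1, E2, E3 in H2.
  assert (Cancel : forall p q, Cmult p (table_weight a b c d) = Cmult q (table_weight a b c d) -> p = q).
  { intros p q E. apply (f_equal (fun v => Cdiv v (table_weight a b c d))) in E.
    replace (Cdiv (Cmult p (table_weight a b c d)) (table_weight a b c d)) with p in E by (field; apply table_weight_neq0).
    replace (Cdiv (Cmult q (table_weight a b c d)) (table_weight a b c d)) with q in E by (field; apply table_weight_neq0).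
    auto. }
  split; apply Cancel.
  - assert (EK : (Copp Ci ^ k = Copp Ci ^ (a + c) * (RtoC (-1) ^ j * Ci ^ j))%C)
      by (rewrite <- Copp_Ci_pow, <- Cpow_add_r; f_equal; lia).
    rewrite H1, EK. ring.
  - rewrite H2 at 1. ring.
Qed.

(** * Invariants in alpha and beta *)

Lemma Defs_Cpow (z : C) (n : nat) : Defs.Cpow z n = (z ^ n)%C.
Proof. reflexivity. Qed.

(** The sign that merges the two parity cases of the generators. *)
Definition eps (m : nat) : C := (RtoC (-1) ^ m)%C.

Lemma eps_even (m : nat) : Nat.even m = true -> eps m = RtoC 1.
Proof.
  intros H. apply Nat.even_spec in H. destruct H as [p ->]. unfold eps.
  replace (2 * p)%nat with (p + p)%nat by lia. rewrite Cpow_add_r. apply Cm1_pow_sqr.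
Qed.

Lemma eps_odd (m : nat) : Nat.even m = false -> eps m = RtoC (-1).
Proof.
  intros H. assert (K : Nat.odd m = true) by (unfold Nat.odd; rewrite H; auto).
  apply Nat.odd_spec in K. destruct K as [p ->]. unfold eps.
  replace (2 * p + 1)%nat with (S (p + p))%nat by lia. rewrite Cpow_S, Cpow_add_r, Cm1_pow_sqr. ring.
Qed.

Lemma eps_add (p q : nat) : eps (p + q) = Cmult (eps p) (eps q).
Proof. apply Cpow_add_r. Qed.

Lemma eps_sqr (m : nat) : Cmult (eps m) (eps m) = RtoC 1.
Proof. apply Cm1_pow_sqr. Qed.

Definition Dval (m a b c : nat) (A B : C) : C :=
  ((A ^ 2 * B ^ 2) ^ a * (A ^ (2 * m) + eps m * B ^ (2 * m)) ^ b *
   (A * B * (A ^ (2 * m) - eps m * B ^ (2 * m))) ^ c)%C.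

Lemma Dpoly_Dval (m a b c : nat) (x y z w : R) : Dpoly m a b c x y z w = Dval m a b c (x, y) (z, w).
Proof.
  unfold Dpoly, Dval, alpha, beta. cbv zeta. rewrite !Defs_Cpow.
  destruct (Nat.even m) eqn:E.
  - rewrite eps_even by auto. rewrite !Cmult_1_l. auto.
  - rewrite eps_odd by auto.
    replace (RtoC (-1) * (z, w) ^ (2 * m))%C with (- (z, w) ^ (2 * m))%C.
    + unfold Cminus.
      replace (- - ((z, w) ^ (2 * m)))%C with ((z, w) ^ (2 * m))%C by ring. auto.
    + rewrite RtoC_m1. ring.
Qed.

Definition ppow (P : poly) (n : nat) : poly := Nat.iter n (pmul P) ((RtoC 1, (0, 0, 0, 0)%nat) :: nil).

Lemma ev_ppow (P : poly) (n : nat) (A A' B B' : C) : ev (ppow P n) A A' B B' = (ev P A A' B B' ^ n)%C.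
Proof.
  induction n; simpl.
  - unfold ev, mono; simpl. ring.
  - rewrite ev_pmul. f_equal. auto.
Qed.

Definition DpolyF (m a b c : nat) : poly :=
  pmul (pmul (ppow ((RtoC 1, (2, 0, 2, 0)%nat) :: nil) a)
    (ppow ((RtoC 1, (2 * m, 0, 0, 0)%nat) :: (eps m, (0, 0, 2 * m, 0)%nat) :: nil) b))
    (ppow ((RtoC 1, (2 * m + 1, 0, 1, 0)%nat) :: (Copp (eps m), (1, 0, 2 * m + 1, 0)%nat) :: nil) c).

Lemma ev_DpolyF (m a b c : nat) (A A' B B' : C) : ev (DpolyF m a b c) A A' B B' = Dval m a b c A B.
Proof.
  unfold DpolyF, Dval. rewrite !ev_pmul, !ev_ppow. f_equal; [f_equal|]; f_equal;
  unfold ev, mono; cbn [csum fold_right fst snd]; rewrite ?Cpow_add_r; simpl Cpow; try ring.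
Qed.

Lemma Dpoly_peval (m a b c : nat) : Dpoly m a b c = peval (DpolyF m a b c).
Proof.
  repeat (apply functional_extensionality; intro). rewrite Dpoly_Dval. unfold peval.
  rewrite ev_DpolyF. auto.
Qed.

(** A condition on the listed terms instead of the coefficients, so that it passes to products term
    by term. *)
Definition ab_terms (k : nat) (P : poly) : Prop :=
  forall t, In t P -> exists a c, snd t = (a, 0, c, 0)%nat /\ (a + c = k)%nat.

Lemma ab_terms_pmul (k l : nat) (P Q : poly) : ab_terms k P -> ab_terms l Q -> ab_terms (k + l) (pmul P Q).
Proof.
  intros HP HQ t Ht. unfold pmul in Ht. apply in_flat_map in Ht. destruct Ht as [s [Hs Ht]].
  apply in_map_iff in Ht. destruct Ht as [r [Er Hr]]. subst t.
  destruct (HP s Hs) as [a [c [E1 E2]]]. destruct (HQ r Hr) as [a' [c' [E3 E4]]].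
  destruct s as [s1 s2], r as [r1 r2]. cbn [snd] in *. subst s2 r2. exists (a + a')%nat, (c + c')%nat. split; [auto | lia].
Qed.

Lemma ab_terms_ppow (k n : nat) (P : poly) : ab_terms k P -> ab_terms (k * n) (ppow P n).
Proof.
  intros HP. induction n; simpl.
  - intros t [E | []]. subst t. exists 0%nat, 0%nat. split; [auto | lia].
  - replace (k * S n)%nat with (k + k * n)%nat by lia. apply ab_terms_pmul; auto.
Qed.

Lemma ab_terms_DpolyF (m a b c : nat) :
  ab_terms (4 * a + 2 * m * b + (2 * m + 2) * c) (DpolyF m a b c).
Proof.
  unfold DpolyF. repeat apply ab_terms_pmul; apply ab_terms_ppow; intros t Ht; simpl in Ht.
  - destruct Ht as [E | []]. subst t. exists 2%nat, 2%nat. auto.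
  - destruct Ht as [E | [E | []]]; subst t; eexists; eexists; split; try reflexivity; lia.
  - destruct Ht as [E | [E | []]]; subst t; eexists; eexists; split; try reflexivity; lia.
Qed.

Lemma ab_terms_holomorphic (k : nat) (P : poly) : ab_terms k P -> holomorphic P.
Proof.
  intros H a b c d Hbd. apply csum_zero. intros t Ht. destruct (H t Ht) as [a' [c' [E _]]].
  rewrite E. destruct idx_dec as [K | K]; auto. inversion K. lia.
Qed.

Lemma ab_terms_homog (k : nat) (P : poly) : ab_terms k P -> homog k P.
Proof.
  intros H i Hi. apply csum_zero. intros t Ht. destruct (H t Ht) as [a' [c' [E E']]].
  rewrite E. destruct idx_dec as [K | K]; auto. subst i. simpl in Hi. lia.
Qed.

Lemma cexp_i_add (s t : R) : cexp_i (s + t) = Cmult (cexp_i s) (cexp_i t).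
Proof. unfold cexp_i, Cmult. simpl. rewrite cos_plus, sin_plus. f_equal; ring. Qed.

Lemma cexp_i_pow (t : R) (n : nat) : (cexp_i t ^ n)%C = cexp_i (INR n * t).
Proof.
  induction n.
  - simpl. unfold cexp_i. rewrite Rmult_0_l, cos_0, sin_0. auto.
  - rewrite Cpow_S, IHn, <- cexp_i_add, S_INR. f_equal. ring.
Qed.

Lemma cexp_i_2PI (s : R) : s = 2 * PI \/ s = - (2 * PI) -> cexp_i s = RtoC 1.
Proof. intros [-> | ->]; unfold cexp_i; rewrite ?cos_neg, ?sin_neg, cos_2PI, sin_2PI, ?Ropp_0; auto. Qed.

Lemma Copp_Ci_sqr : (Copp Ci ^ 2)%C = RtoC (-1).
Proof. simpl. unfold Cmult, Copp, Ci, RtoC; simpl; f_equal; ring. Qed.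

(** As [(-i)^(2 m) = eps m] and [eps m] squares to 1, the middle factor is preserved. In the last
    one, exchanging the two powers yields a sign, which [(-i)^2 = -1] from [alpha beta] undoes. *)
Lemma Dval_gen1 (m a b c : nat) (A B : C) : Dval m a b c (Copp Ci * B) (Copp Ci * A) = Dval m a b c A B.
Proof.
  unfold Dval. rewrite (Cpow_mult_l _ A 2), (Cpow_mult_l _ B 2), (Cpow_mult_l _ A (2 * m)), (Cpow_mult_l _ B (2 * m)).
  assert (E2 : (Copp Ci ^ 2)%C = RtoC (-1)) by apply Copp_Ci_sqr.
  assert (E2m : (Copp Ci ^ (2 * m))%C = eps m) by (rewrite Cpow_mult_r, E2; auto).
  rewrite E2m, !E2. pose proof (eps_sqr m) as Es. set (e := eps m) in *.
  f_equal; [f_equal|].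
  - f_equal. rewrite RtoC_m1. ring.
  - f_equal. transitivity ((e * e) * A ^ (2 * m) + e * B ^ (2 * m))%C; [ring | rewrite Es; ring].
  - f_equal. transitivity ((Copp Ci ^ 2) * (A * B * (e * B ^ (2 * m) - (e * e) * A ^ (2 * m))))%C; [simpl; ring|].
    rewrite E2, Es. rewrite RtoC_m1. ring.
Qed.

Lemma Dval_gen2 (m a b c : nat) (A B : C) : (1 <= m)%nat ->
  Dval m a b c (cexp_i (- (PI / INR m)) * A) (cexp_i (PI / INR m) * B) = Dval m a b c A B.
Proof.
  intros Hm. assert (Hm0 : INR m <> 0) by (apply not_0_INR; lia).
  unfold Dval. rewrite (Cpow_mult_l _ A 2), (Cpow_mult_l _ B 2), (Cpow_mult_l _ A (2 * m)), (Cpow_mult_l _ B (2 * m)).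
  assert (E1 : (cexp_i (PI / INR m) ^ (2 * m))%C = RtoC 1).
  { rewrite cexp_i_pow. apply cexp_i_2PI. left. rewrite mult_INR. simpl. field; auto. }
  assert (E2 : (cexp_i (- (PI / INR m)) ^ (2 * m))%C = RtoC 1).
  { rewrite cexp_i_pow. apply cexp_i_2PI. right. rewrite mult_INR. simpl. field; auto. }
  rewrite E1, E2. pose proof (cexp_i_inv (PI / INR m)) as E.
  set (u := cexp_i (PI / INR m)) in *. set (v := cexp_i (- (PI / INR m))) in *.
  f_equal; [f_equal|]; f_equal.
  - transitivity ((u * v) * (u * v) * (A ^ 2 * B ^ 2))%C; [simpl; ring | rewrite E; ring].
  - ring.
  - transitivity ((u * v) * (A * B * (A ^ (2 * m) - eps m * B ^ (2 * m))))%C; [ring | rewrite E; ring].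
Qed.

Lemma inv_holo_DpolyF (m a b c : nat) : (1 <= m)%nat -> inv_holo m (DpolyF m a b c).
Proof.
  intros Hm. apply inv_coeffs_holo. apply app_invariant_inv_coeffs.
  - rewrite app_Dgen1_peval. repeat (apply functional_extensionality; intro). unfold peval.
    rewrite ev_sub1, !ev_DpolyF, Dval_gen1. auto.
  - rewrite app_Dgen2_peval. repeat (apply functional_extensionality; intro). unfold peval.
    rewrite ev_sub2, !ev_DpolyF, Dval_gen2; auto.
Qed.

Inductive InSpan (m : nat) : nat -> (C -> C -> C) -> Prop :=
  | span_zero k : InSpan m k (fun _ _ => RtoC 0)
  | span_gen a b c : (c <= 1)%nat -> InSpan m (4 * a + 2 * m * b + (2 * m + 2) * c) (Dval m a b c)
  | span_add k f g : InSpan m k f -> InSpan m k g -> InSpan m k (fun A B => Cplus (f A B) (g A B))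
  | span_scal k s f : InSpan m k f -> InSpan m k (fun A B => Cmult s (f A B)).

Lemma InSpan_ext (m k l : nat) (f g : C -> C -> C) : InSpan m k f -> k = l ->
  (forall A B, f A B = g A B) -> InSpan m l g.
Proof.
  intros H -> E. replace g with f; auto.
  apply functional_extensionality; intro; apply functional_extensionality; intro; auto.
Qed.

Lemma InSpan_mulT (m k : nat) (f : C -> C -> C) : InSpan m k f ->
  InSpan m (k + 2 * m) (fun A B => (A ^ (2 * m) + eps m * B ^ (2 * m)) * f A B)%C.
Proof.
  induction 1 as [k | a b c Hc | k f g _ IHf _ IHg | k s f _ IHf].
  - apply (InSpan_ext _ _ _ _ _ (span_zero m (k + 2 * m))); auto. intros; ring.
  - apply (InSpan_ext _ _ _ _ _ (span_gen m a (S b) c Hc)). lia.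
    intros. unfold Dval. rewrite (Cpow_S _ b). ring.
  - apply (InSpan_ext _ _ _ _ _ (span_add _ _ _ _ IHf IHg)); auto. intros; ring.
  - apply (InSpan_ext _ _ _ _ _ (span_scal _ _ s _ IHf)); auto. intros; ring.
Qed.

Lemma InSpan_mulQ (m k : nat) (f : C -> C -> C) : InSpan m k f ->
  InSpan m (k + 4) (fun A B => (A ^ 2 * B ^ 2) * f A B)%C.
Proof.
  induction 1 as [k | a b c Hc | k f g _ IHf _ IHg | k s f _ IHf].
  - apply (InSpan_ext _ _ _ _ _ (span_zero m (k + 4))); auto. intros; ring.
  - apply (InSpan_ext _ _ _ _ _ (span_gen m (S a) b c Hc)). lia.
    intros. unfold Dval. rewrite (Cpow_S _ a). ring.
  - apply (InSpan_ext _ _ _ _ _ (span_add _ _ _ _ IHf IHg)); auto. intros; ring.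
  - apply (InSpan_ext _ _ _ _ _ (span_scal _ _ s _ IHf)); auto. intros; ring.
Qed.

Lemma InSpan_mulQpow (m k p : nat) (f : C -> C -> C) : InSpan m k f ->
  InSpan m (k + 4 * p) (fun A B => (A ^ 2 * B ^ 2) ^ p * f A B)%C.
Proof.
  intros H. induction p.
  - apply (InSpan_ext _ _ _ _ _ H). lia. intros; simpl; ring.
  - apply (InSpan_ext _ _ _ _ _ (InSpan_mulQ _ _ _ IHp)). lia.
    intros. rewrite (Cpow_S _ p). ring.
Qed.

(* Power sums in X = alpha^(2m) and Z = (-1)^m beta^(2m) satisfy the recurrence
   p_(e+2) = (X + Z) p_(e+1) - X Z p_e, where X Z = (-1)^m (alpha^2 beta^2)^m. *)
Lemma InSpan_recurrence (m k e : nat) (h : C -> C -> C) (s : C) :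
  InSpan m (2 * m * S e + k) (fun A B => h A B * ((A ^ (2 * m)) ^ S e + s * (eps m * B ^ (2 * m)) ^ S e))%C ->
  InSpan m (2 * m * e + k) (fun A B => h A B * ((A ^ (2 * m)) ^ e + s * (eps m * B ^ (2 * m)) ^ e))%C ->
  InSpan m (2 * m * S (S e) + k)
    (fun A B => h A B * ((A ^ (2 * m)) ^ S (S e) + s * (eps m * B ^ (2 * m)) ^ S (S e)))%C.
Proof.
  intros H1 H0.
  apply InSpan_mulT in H1. apply (InSpan_mulQpow _ _ m) in H0.
  apply (span_scal _ _ (Copp (eps m))) in H0.
  replace (2 * m * e + k + 4 * m)%nat with (2 * m * S e + k + 2 * m)%nat in H0 by lia.
  apply (InSpan_ext _ _ _ _ _ (span_add _ _ _ _ H1 H0)). lia.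
  intros A B.
  replace ((A ^ 2 * B ^ 2) ^ m)%C with (A ^ (2 * m) * B ^ (2 * m))%C by (rewrite Cpow_mult_l, !Cpow_mult_r; auto).
  rewrite !Cpow_S. ring.
Qed.

(** Two-step induction from [p_0 = 2] and from [p_1], which is the generator with [b = 1]. *)
Lemma InSpan_psum (m e : nat) :
  InSpan m (2 * m * e) (fun A B => (A ^ (2 * m)) ^ e + (eps m * B ^ (2 * m)) ^ e)%C.
Proof.
  assert (K : forall e, InSpan m (2 * m * e + 0) (fun A B => RtoC 1 * ((A ^ (2 * m)) ^ e + RtoC 1 * (eps m * B ^ (2 * m)) ^ e))%C /\
     InSpan m (2 * m * S e + 0) (fun A B => RtoC 1 * ((A ^ (2 * m)) ^ S e + RtoC 1 * (eps m * B ^ (2 * m)) ^ S e))%C).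
  { induction e0 as [|e0 [IH0 IH1]]; split; auto.
    - apply (InSpan_ext _ _ _ _ _ (span_scal _ _ (RtoC 2) _ (span_gen m 0 0 0 ltac:(lia)))). lia.
      intros. unfold Dval. simpl. replace (RtoC 2) with (RtoC 1 + RtoC 1)%C by (rewrite <- RtoC_plus; f_equal; ring). ring.
    - apply (InSpan_ext _ _ _ _ _ (span_gen m 0 1 0 ltac:(lia))). lia.
      intros. unfold Dval. simpl. ring.
    - apply (InSpan_recurrence m 0 e0 (fun _ _ => RtoC 1)); auto. }
  apply (InSpan_ext _ _ _ _ _ (proj1 (K e))). lia. intros; ring.
Qed.

(** The recurrence is the same for differences of powers; the initial values are 0 and the generator
    with [c = 1], which brings the factor [alpha beta]. *)
Lemma InSpan_pdiff (m e : nat) :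
  InSpan m (2 * m * e + 2) (fun A B => A * B * ((A ^ (2 * m)) ^ e - (eps m * B ^ (2 * m)) ^ e))%C.
Proof.
  assert (K : forall e, InSpan m (2 * m * e + 2) (fun A B => A * B * ((A ^ (2 * m)) ^ e + RtoC (-1) * (eps m * B ^ (2 * m)) ^ e))%C /\
     InSpan m (2 * m * S e + 2) (fun A B => A * B * ((A ^ (2 * m)) ^ S e + RtoC (-1) * (eps m * B ^ (2 * m)) ^ S e))%C).
  { induction e0 as [|e0 [IH0 IH1]]; split; auto.
    - apply (InSpan_ext _ _ _ _ _ (span_zero m (2 * m * 0 + 2))); auto.
      intros. simpl. rewrite RtoC_m1. ring.
    - apply (InSpan_ext _ _ _ _ _ (span_gen m 0 0 1 ltac:(lia))). lia.
      intros. unfold Dval. rewrite RtoC_m1. simpl. ring.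
    - apply (InSpan_recurrence m 2 e0 (fun A B => A * B)%C); auto. }
  apply (InSpan_ext _ _ _ _ _ (proj1 (K e))). lia. intros.
  rewrite RtoC_m1. ring.
Qed.

(** With [r = n - m e] the expression is [(alpha beta)^r] times [X^e + eps r Z^e]. The parity of [r]
    decides between sum and difference; what is left is an even power of [alpha beta], that is, a
    power of [alpha^2 beta^2]. *)
Lemma InSpan_orbit_sum (m n e : nat) : (m * e <= n)%nat ->
  InSpan m (2 * n) (fun A B => A ^ (n + m * e) * B ^ (n - m * e) + eps n * (A ^ (n - m * e) * B ^ (n + m * e)))%C.
Proof.
  intros H. set (r := (n - m * e)%nat).
  assert (Hn : n = (r + m * e)%nat) by (unfold r; lia).
  assert (Ee : forall B, (eps n * B ^ (2 * (m * e)) = eps r * (eps m * B ^ (2 * m)) ^ e)%C).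
  { intros B. assert (X : eps (m * e) = (eps m ^ e)%C) by apply Cpow_mult_r.
    replace (eps n) with (Cmult (eps r) (eps (m * e))) by (rewrite <- eps_add; f_equal; lia).
    rewrite X, Cpow_mult_l, <- (Cpow_mult_r B (2 * m) e), <- (Nat.mul_assoc 2 m e). ring. }
  assert (EA : forall A, (A ^ (2 * (m * e)) = (A ^ (2 * m)) ^ e)%C).
  { intros A. rewrite <- Cpow_mult_r. f_equal. lia. }
  assert (E : forall A B, (A ^ (n + m * e) * B ^ r + eps n * (A ^ r * B ^ (n + m * e)))%C =
    ((A * B) ^ r * ((A ^ (2 * m)) ^ e + eps r * (eps m * B ^ (2 * m)) ^ e))%C).
  { intros A B. rewrite <- Ee, <- EA. replace (n + m * e)%nat with (r + 2 * (m * e))%nat by lia.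
    rewrite !Cpow_add_r, Cpow_mult_l. ring. }
  assert (EQ : forall p A B, ((A * B) ^ (2 * p) = (A ^ 2 * B ^ 2) ^ p)%C).
  { intros p A B. rewrite Cpow_mult_r, Cpow_mult_l. auto. }
  destruct (Nat.even r) eqn:Er.
  - pose proof (eps_even _ Er) as Er'. apply Nat.even_spec in Er. destruct Er as [p Hp].
    apply (InSpan_ext _ _ _ _ _ (InSpan_mulQpow _ _ p _ (InSpan_psum m e))). lia.
    intros A B. rewrite E, Er', Hp, EQ. ring.
  - pose proof (eps_odd _ Er) as Er'. assert (K : Nat.odd r = true) by (unfold Nat.odd; rewrite Er; auto).
    apply Nat.odd_spec in K. destruct K as [p Hp].
    apply (InSpan_ext _ _ _ _ _ (InSpan_mulQpow _ _ p _ (InSpan_pdiff m e))). lia.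
    intros A B. rewrite E, Er', Hp. replace (2 * p + 1)%nat with (S (2 * p)) by lia.
    rewrite (Cpow_S (A * B)%C (2 * p)), EQ. rewrite RtoC_m1. ring.
Qed.

Lemma InSpan_csum {I : Type} (m k : nat) (l : list I) (f : I -> C -> C -> C) :
  (forall i, In i l -> InSpan m k (f i)) -> InSpan m k (fun A B => csum l (fun i => f i A B)).
Proof.
  induction l as [|i l IH]; intros H; simpl. apply span_zero.
  apply span_add. apply H; left; auto. apply IH. intros; apply H; right; auto.
Qed.

Lemma csum_perm {I : Type} (l l' : list I) (f : I -> C) : Permutation l l' -> csum l f = csum l' f.
Proof.
  induction 1; simpl; auto.
  - rewrite IHPermutation. auto.
  - ring.
  - congruence.
Qed.

Lemma csum_reverse (k : nat) (f : nat -> C) :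
  csum (seq 0 (S k)) f = csum (seq 0 (S k)) (fun i => f (k - i)%nat).
Proof.
  rewrite <- (csum_map (fun i => (k - i)%nat) (seq 0 (S k)) f). apply csum_perm.
  apply NoDup_Permutation_bis.
  - apply seq_NoDup.
  - rewrite length_map. auto.
  - intros i Hi. apply in_seq in Hi. apply in_map_iff. exists (k - i)%nat. split. lia. apply in_seq. lia.
Qed.

(** The phase has angle [2 th] with [th = (i - n) PI / m]. From [cos (2 th) = 1] follows
    [sin th = 0], so [m] divides [i - n]; the quotient is split by sign to stay in the natural
    numbers. *)
Lemma root_of_unity_period (m n i : nat) : (1 <= m)%nat -> (i <= 2 * n)%nat ->
  (cexp_i (- (PI / INR m)) ^ (2 * n - i) * cexp_i (PI / INR m) ^ i)%C = RtoC 1 ->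
  exists e, (i = n + m * e)%nat \/ (n = i + m * e)%nat.
Proof.
  intros Hm Hi H. rewrite !cexp_i_pow, <- cexp_i_add in H.
  assert (Hm0 : INR m <> 0) by (apply not_0_INR; lia).
  set (th := (INR i - INR n) * (PI / INR m)).
  replace (INR (2 * n - i) * - (PI / INR m) + INR i * (PI / INR m)) with (2 * th) in H.
  2: { unfold th. rewrite minus_INR, mult_INR by lia. simpl. ring. }
  apply (f_equal fst) in H. unfold cexp_i in H. cbn [fst] in H. change (fst (RtoC 1)) with 1 in H.
  rewrite cos_2a_sin in H.
  assert (Hs : sin th = 0). { apply Rsqr_eq_0. unfold Rsqr. lra. }
  apply sin_eq_0_0 in Hs. destruct Hs as [l Hl]. unfold th in Hl.
  assert (E : INR i - INR n = IZR l * INR m).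
  { apply Rmult_eq_reg_r with (PI / INR m).
    - rewrite Hl. field. auto.
    - apply Rmult_integral_contrapositive_currified. apply PI_neq0. apply Rinv_neq_0_compat; auto. }
  rewrite !INR_IZR_INZ, <- minus_IZR, <- mult_IZR in E. apply eq_IZR in E.
  destruct (Z_le_gt_dec 0 l) as [K | K].
  - exists (Z.to_nat l). left. nia.
  - exists (Z.to_nat (- l)). right. nia.
Qed.

Lemma invariant_InSpan (m n : nat) (v : nat -> C) : (1 <= m)%nat ->
  (forall i, (i <= 2 * n)%nat -> v i = Cmult (Copp Ci ^ (2 * n))%C (v (2 * n - i)%nat) /\
    v i = Cmult (cexp_i (- (PI / INR m)) ^ (2 * n - i) * cexp_i (PI / INR m) ^ i)%C (v i)) ->
  InSpan m (2 * n) (fun A B => csum (seq 0 (S (2 * n))) (fun i => v i * (A ^ (2 * n - i) * B ^ i))%C).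
Proof.
  intros Hm Hv.
  assert (Hi : (Copp Ci ^ (2 * n))%C = eps n).
  { rewrite Cpow_mult_r. unfold eps. rewrite Copp_Ci_sqr. auto. }
  (* By the exchange relation the sum equals half the sum of all monomials completed by their mirror
     images; each of these lies in the span by itself. *)
  assert (K : InSpan m (2 * n) (fun A B => csum (seq 0 (S (2 * n)))
    (fun i => RtoC (/ 2) * v i * (A ^ (2 * n - i) * B ^ i + eps n * (A ^ i * B ^ (2 * n - i))))%C)).
  { apply (InSpan_csum m (2 * n) (seq 0 (S (2 * n)))
      (fun i A B => RtoC (/ 2) * v i * (A ^ (2 * n - i) * B ^ i + eps n * (A ^ i * B ^ (2 * n - i))))%C).
    intros i Hin. apply in_seq in Hin. destruct (Hv i ltac:(lia)) as [_ H2].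
    destruct (classic (v i = RtoC 0)) as [H0 | H0].
    { apply (InSpan_ext _ _ _ _ _ (span_zero m (2 * n))); auto. intros. rewrite H0. ring. }
    assert (H1 : (cexp_i (- (PI / INR m)) ^ (2 * n - i) * cexp_i (PI / INR m) ^ i)%C = RtoC 1).
    { apply (f_equal (fun t => Cdiv t (v i))) in H2.
      replace (Cdiv (v i) (v i)) with (RtoC 1) in H2 by (field; auto). rewrite H2. field. auto. }
    apply root_of_unity_period in H1; auto; [|lia].
    destruct H1 as [e [E | E]].
    (* For [i >= n] the monomial is the second term of the orbit sum, whence the factor [eps n],
       whose square is 1. *)
    - apply (InSpan_ext _ _ _ _ _ (span_scal _ _ (RtoC (/ 2) * v i * eps n)%C _ (InSpan_orbit_sum m n e ltac:(lia)))); auto.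
      intros A B. replace (2 * n - i)%nat with (n - m * e)%nat by lia. rewrite E.
      transitivity (RtoC (/ 2) * v (n + m * e)%nat * (eps n * (A ^ (n + m * e) * B ^ (n - m * e)) + (eps n * eps n) * (A ^ (n - m * e) * B ^ (n + m * e))))%C; [ring|].
      rewrite eps_sqr. ring.
    - apply (InSpan_ext _ _ _ _ _ (span_scal _ _ (RtoC (/ 2) * v i)%C _ (InSpan_orbit_sum m n e ltac:(lia)))); auto.
      intros A B. replace (2 * n - i)%nat with (n + m * e)%nat by lia. replace i with (n - m * e)%nat by lia. auto. }
  apply (InSpan_ext _ _ _ _ _ K); auto. intros A B.
  transitivity (csum (seq 0 (S (2 * n))) (fun i => RtoC (/ 2) * (v i * (A ^ (2 * n - i) * B ^ i)) +
    RtoC (/ 2) * (v (2 * n - i)%nat * (A ^ i * B ^ (2 * n - i))))%C).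
  { apply csum_ext. intros i Hin. apply in_seq in Hin.
    destruct (Hv (2 * n - i)%nat ltac:(lia)) as [H1 _]. rewrite H1, Hi.
    replace (2 * n - (2 * n - i))%nat with i by lia. ring. }
  rewrite csum_plus, !csum_scal.
  rewrite (csum_reverse (2 * n) (fun i => v i * (A ^ (2 * n - i) * B ^ i))%C).
  replace (csum (seq 0 (S (2 * n))) (fun i => v (2 * n - i)%nat * (A ^ i * B ^ (2 * n - i)))%C)
    with (csum (seq 0 (S (2 * n))) (fun i => v (2 * n - i)%nat * (A ^ (2 * n - (2 * n - i)) * B ^ (2 * n - i)))%C).
  - set (X := csum _ _). transitivity ((RtoC (/ 2) + RtoC (/ 2)) * X)%C; [ring|].
    rewrite <- RtoC_plus. replace (/ 2 + / 2) with 1 by field. ring.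
  - apply csum_ext. intros i Hin. apply in_seq in Hin. replace (2 * n - (2 * n - i))%nat with i by lia. auto.
Qed.

(** * Linear independence and counting *)

Definition triples (m k : nat) : list (nat * nat * nat) :=
  flat_map (fun a =>
    flat_map (fun b =>
      flat_map (fun c =>
        if Nat.eqb (4 * a + 2 * m * b + (2 * m + 2) * c) k then (a, b, c) :: nil else nil)
      (0 :: 1 :: nil)%nat)
    (seq 0 (k + 1)))
  (seq 0 (k + 1)).

Lemma flat_map_flat_map {I J K : Type} (f : I -> list J) (g : J -> list K) (l : list I) :
  flat_map g (flat_map f l) = flat_map (fun i => flat_map g (f i)) l.
Proof. induction l as [|i l IH]; simpl; auto. rewrite flat_map_app, IH. auto. Qed.

Lemma Didx_triples (m k : nat) :
  Didx m k = flat_map (fun t => map (fun j => (t, j)) (seq 0 (k + 1))) (triples m k).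
Proof.
  unfold Didx, triples. rewrite flat_map_flat_map. apply flat_map_ext. intros a.
  rewrite flat_map_flat_map. apply flat_map_ext. intros b.
  rewrite flat_map_flat_map. apply flat_map_ext. intros c.
  destruct (Nat.eqb _ k); simpl; auto. rewrite app_nil_r. auto.
Qed.

(** The search range up to [k] loses nothing: as [m >= 1], both [a] and [b] are at most [k]. *)
Lemma in_triples (m k a b c : nat) : (1 <= m)%nat ->
  In (a, b, c) (triples m k) <-> (4 * a + 2 * m * b + (2 * m + 2) * c = k /\ c <= 1)%nat.
Proof.
  intros Hm. unfold triples. rewrite in_flat_map. split.
  - intros [a' [_ H]]. apply in_flat_map in H. destruct H as [b' [_ H]].
    apply in_flat_map in H. destruct H as [c' [Hc H]].
    destruct (Nat.eqb_spec (4 * a' + 2 * m * b' + (2 * m + 2) * c') k) as [E | E]; [|destruct H].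
    destruct H as [H | []]. inversion H; subst. split; auto. simpl in Hc. lia.
  - intros [H Hc]. exists a. split. apply in_seq. nia.
    apply in_flat_map. exists b. split. apply in_seq. nia.
    apply in_flat_map. exists c. split. simpl. lia.
    rewrite H, Nat.eqb_refl. left. auto.
Qed.

Lemma NoDup_flat_map_key {I J : Type} (f : I -> list J) (key : J -> I) (l : list I) :
  NoDup l -> (forall i, In i l -> NoDup (f i)) -> (forall i j, In j (f i) -> key j = i) ->
  NoDup (flat_map f l).
Proof.
  intros Hl Hf Hk. induction Hl as [|i l Hi Hl IH]; simpl. constructor.
  apply NoDup_app.
  - apply Hf. left; auto.
  - apply IH. intros; apply Hf; right; auto.
  - intros j H1 H2. apply in_flat_map in H2. destruct H2 as [i' [Hi' H2]].
    apply Hk in H1. apply Hk in H2. congruence.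
Qed.

Lemma NoDup_triples (m k : nat) : NoDup (triples m k).
Proof.
  apply (NoDup_flat_map_key _ (fun t => fst (fst t))). apply seq_NoDup.
  - intros a _. apply (NoDup_flat_map_key _ (fun t => snd (fst t))). apply seq_NoDup.
    + intros b _. apply (NoDup_flat_map_key _ (fun t => snd t)).
      * repeat constructor; simpl; intuition discriminate.
      * intros c _. destruct (Nat.eqb _ k); repeat constructor. simpl; tauto.
      * intros c t H. destruct (Nat.eqb _ k); [|destruct H]. destruct H as [H | []]. subst; auto.
    + intros b t H. apply in_flat_map in H. destruct H as [c [_ H]].
      destruct (Nat.eqb _ k); [|destruct H]. destruct H as [H | []]. subst; auto.
  - intros a t H. apply in_flat_map in H. destruct H as [b [_ H]].
    apply in_flat_map in H. destruct H as [c [_ H]].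
    destruct (Nat.eqb _ k); [|destruct H]. destruct H as [H | []]. subst; auto.
Qed.

Lemma NoDup_Didx (m k : nat) : NoDup (Didx m k).
Proof.
  rewrite Didx_triples. apply (NoDup_flat_map_key _ (fun p => fst p)). apply NoDup_triples.
  - intros t _. apply FinFun.Injective_map_NoDup; [|apply seq_NoDup]. intros i j H. inversion H; auto.
  - intros t p H. apply in_map_iff in H. destruct H as [j [E _]]. subst; auto.
Qed.

Lemma in_Didx (m k a b c j : nat) :
  In (a, b, c, j) (Didx m k) <-> In (a, b, c) (triples m k) /\ (j <= k)%nat.
Proof.
  rewrite Didx_triples, in_flat_map. split.
  - intros [t [Ht H]]. apply in_map_iff in H. destruct H as [j' [E Hj]]. inversion E; subst.
    split; auto. apply in_seq in Hj. lia.
  - intros [Ht Hj]. exists (a, b, c). split; auto. apply in_map_iff. exists j. split; auto.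
    apply in_seq. lia.
Qed.

(* A solution of 2a + mb + (m+1)c = n is determined by e = b + c, since then
   n - m e = 2a + c; every e <= n/m occurs, except e = 0 when n is odd. *)
Lemma length_triples (m n : nat) : (1 <= m)%nat ->
  (length (triples m (2 * n)) + n mod 2 = n / m + 1)%nat.
Proof.
  intros Hm.
  set (s := (n mod 2)%nat). assert (Hs : (s < 2)%nat) by (apply Nat.mod_upper_bound; lia).
  (* Inverse of [e = b + c]: [a] and [c] are quotient and remainder of [n - m e] by 2. For odd [n]
     the value [e = 0] would need [b = -1], which truncated subtraction hides; hence the range
     starts at [s]. *)
  set (phi := fun e : nat => ((n - m * e) / 2, e - (n - m * e) mod 2, (n - m * e) mod 2)%nat).
  assert (Hsm : (s <= n / m + 1)%nat) by lia.
  assert (P : Permutation (triples m (2 * n)) (map phi (seq s (n / m + 1 - s)))).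
  { apply NoDup_Permutation.
    - apply NoDup_triples.
    - apply FinFun.Injective_map_NoDup_in; [|apply seq_NoDup].
      intros e e' He He' E. apply in_seq in He, He'. unfold phi in E.
      apply pair_equal_spec in E. destruct E as [E E3]. apply pair_equal_spec in E. destruct E as [E1 E2].
      assert (Hme : (m * e <= n)%nat) by (apply (Nat.le_trans _ (m * (n / m))); [nia | apply Nat.Div0.mul_div_le]).
      assert (Hme' : (m * e' <= n)%nat) by (apply (Nat.le_trans _ (m * (n / m))); [nia | apply Nat.Div0.mul_div_le]).
      pose proof (Nat.div_mod_eq (n - m * e) 2). pose proof (Nat.div_mod_eq (n - m * e') 2).
      assert (m * e = m * e')%nat by lia. nia.
    - intros [[a b] c]. rewrite in_triples by auto. rewrite in_map_iff. split.
      + intros [H Hc]. exists (b + c)%nat.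
        assert (E : (n - m * (b + c) = 2 * a + c)%nat) by nia.
        assert (E2 : (n = m * (b + c) + (2 * a + c))%nat) by nia.
        assert (Ed : ((2 * a + c) / 2 = a)%nat).
        { symmetry. apply (Nat.div_unique _ 2 a c); lia. }
        assert (Em : ((2 * a + c) mod 2 = c)%nat).
        { symmetry. apply (Nat.mod_unique _ 2 a c); lia. }
        split. { unfold phi. rewrite E, Ed, Em. repeat f_equal; lia. }
        apply in_seq. split.
        * unfold s. destruct (Nat.eq_dec (b + c) 0) as [Z | Z].
          -- replace n with (0 + a * 2)%nat by nia. rewrite Nat.Div0.mod_add. simpl. lia.
          -- pose proof (Nat.mod_upper_bound n 2). lia.
        * assert ((b + c) <= n / m)%nat by (apply Nat.div_le_lower_bound; lia). lia.
      + intros [e [E He]]. apply in_seq in He. unfold phi in E.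
        apply pair_equal_spec in E. destruct E as [E E3]. apply pair_equal_spec in E. destruct E as [E1 E2].
        rewrite E3 in E2.
        assert (Hme : (m * e <= n)%nat) by (apply (Nat.le_trans _ (m * (n / m))); [nia | apply Nat.Div0.mul_div_le]).
        pose proof (Nat.div_mod_eq (n - m * e) 2) as K. rewrite E1, E3 in K.
        assert (Hc : (c < 2)%nat) by (rewrite <- E3; apply Nat.mod_upper_bound; lia).
        split; [|lia].
        assert (Hce : (c <= e)%nat).
        { destruct (Nat.eq_dec e 0) as [Z | Z]; [|lia].
          assert (s = 0)%nat by lia. subst e. rewrite Nat.mul_0_r, Nat.sub_0_r in E3. fold s in E3. lia. }
        assert (Eb : (e = b + c)%nat) by lia. subst e. nia. }
  rewrite (Permutation_length P), length_map, length_seq. lia.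
Qed.

Lemma length_Didx (m k : nat) : length (Didx m k) = (length (triples m k) * (k + 1))%nat.
Proof.
  rewrite Didx_triples. induction (triples m k) as [|t l IH]; simpl; auto.
  rewrite length_app, length_map, length_seq, IH. lia.
Qed.

Lemma InSpan_coefficients (m k : nat) (f : C -> C -> C) : (1 <= m)%nat -> InSpan m k f ->
  exists kap : nat * nat * nat -> C, forall A B,
    f A B = csum (triples m k) (fun t => let '(a, b, c) := t in Cmult (kap t) (Dval m a b c A B)).
Proof.
  intros Hm. induction 1 as [k | a b c Hc | k f g _ [p Hp] _ [q Hq] | k s f _ [p Hp]].
  - exists (fun _ => RtoC 0). intros. symmetry. apply csum_zero. intros [[a b] c] _. ring.
  - assert (dec : forall t t' : nat * nat * nat, {t = t'} + {t <> t'}) by (repeat decide equality).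
    exists (fun t => if dec t (a, b, c) then RtoC 1 else RtoC 0). intros A B.
    rewrite (csum_single _ _ (a, b, c)).
    + destruct (dec (a, b, c) (a, b, c)); [ring | contradiction].
    + apply NoDup_triples.
    + apply in_triples; auto.
    + intros [[a' b'] c'] _ H. destruct (dec (a', b', c') (a, b, c)); [contradiction | ring].
  - exists (fun t => Cplus (p t) (q t)). intros A B. rewrite Hp, Hq, <- csum_plus.
    apply csum_ext. intros [[a b] c] _. ring.
  - exists (fun t => Cmult s (p t)). intros A B. rewrite Hp, <- csum_scal.
    apply csum_ext. intros [[a b] c] _. ring.
Qed.

Lemma Cmult_integral (p q : C) : Cmult p q = RtoC 0 -> p <> RtoC 0 -> q = RtoC 0.
Proof.
  intros H Hp. apply (f_equal (Cmult (Cinv p))) in H.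
  rewrite Cmult_assoc, Cinv_l, Cmult_1_l, Cmult_0_r in H; auto.
Qed.

(* At alpha = 1 the polynomial of (a, b, c) has order exactly 2a + c in beta. *)
Lemma Dval_independent (m k : nat) (kap : nat * nat * nat -> C) : (1 <= m)%nat ->
  (forall A B, csum (triples m k) (fun t => let '(a, b, c) := t in Cmult (kap t) (Dval m a b c A B)) = RtoC 0) ->
  forall t, In t (triples m k) -> kap t = RtoC 0.
Proof.
  intros Hm H.
  assert (K : forall s a b c, In (a, b, c) (triples m k) -> (2 * a + c = s)%nat -> kap (a, b, c) = RtoC 0).
  { induction s as [s IH] using lt_wf_ind. intros a b c Hin Hs.
    (* The relation at alpha = 1, beta = t, divided by [t^s]. Triples of order below [s] get the
       truncated exponent 0, but their coefficients vanish by induction. *)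
    set (q := fun t : R => csum (triples m k) (fun t' => let '(a, b, c) := t' in
      (kap t' * RtoC t ^ (2 * a + c - s) *
        ((RtoC 1 + eps m * RtoC t ^ (2 * m)) ^ b * (RtoC 1 - eps m * RtoC t ^ (2 * m)) ^ c))%C)).
    assert (Hq : exists l, isCD q 0 l).
    { unfold q.
      assert (Ht : isCD (fun t => RtoC t) 0 (RtoC 1)) by (split; simpl; auto_derive; auto).
      assert (Hu : forall e, isCD (fun t => (RtoC 1 + e * RtoC t ^ (2 * m))%C) 0
         (RtoC 0 + (RtoC 0 * RtoC 0 ^ (2 * m) + e * (Cnat (2 * m) * RtoC 0 ^ (2 * m - 1) * RtoC 1)))%C).
      { intros e. apply isCD_plus. apply isCD_const.
        apply (isCD_mult (fun _ => e) (fun t => (RtoC t ^ (2 * m))%C)). apply isCD_const.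
        apply (isCD_pow (fun t => RtoC t)); auto. }
      clear - Ht Hu. induction (triples m k) as [|[[a' b'] c'] l [L HL]]; simpl.
      - eexists. apply isCD_const.
      - eexists. apply isCD_plus; [|exact HL].
        apply isCD_mult.
        + apply isCD_mult. apply isCD_const. apply (isCD_pow (fun t => RtoC t)); exact Ht.
        + apply (isCD_mult (fun t => ((RtoC 1 + eps m * RtoC t ^ (2 * m)) ^ b')%C)
            (fun t => ((RtoC 1 - eps m * RtoC t ^ (2 * m)) ^ c')%C)).
          * apply (isCD_pow (fun t => (RtoC 1 + eps m * RtoC t ^ (2 * m))%C)). apply Hu.
          * apply (isCD_pow (fun t => (RtoC 1 - eps m * RtoC t ^ (2 * m))%C)).
            assert (E : (fun t => (RtoC 1 - eps m * RtoC t ^ (2 * m))%C) =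
                        (fun t => (RtoC 1 + (Copp (eps m)) * RtoC t ^ (2 * m))%C))
              by (apply functional_extensionality; intro; ring).
            rewrite E. apply Hu. }
    destruct Hq as [l Hl].
    (* For [t <> 0] the factor [t^s] can be cancelled; the value at 0 follows by continuity. *)
    assert (Hq0 : q 0 = RtoC 0).
    { apply (isCD_zero_punctured _ _ _ Hl). intros t Ht.
      apply (Cmult_integral (RtoC t ^ s)%C).
      - rewrite <- (H (RtoC 1) (RtoC t)). unfold q. rewrite <- csum_scal.
        apply csum_ext. intros [[a' b'] c'] Hin'.
        destruct (Nat.lt_ge_cases (2 * a' + c') s) as [L | L].
        + rewrite (IH _ L a' b' c'); auto. ring.
        + unfold Dval. rewrite !Cpow_1_l, !Cmult_1_l.
          replace ((RtoC t * (RtoC 1 - eps m * RtoC t ^ (2 * m))) ^ c')%C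
            with (RtoC t ^ c' * (RtoC 1 - eps m * RtoC t ^ (2 * m)) ^ c')%C by (rewrite Cpow_mult_l; auto).
          rewrite <- (Cpow_mult_r (RtoC t) 2 a').
          transitivity (kap (a', b', c') * (RtoC t ^ s * RtoC t ^ (2 * a' + c' - s)) *
            ((RtoC 1 + eps m * RtoC t ^ (2 * m)) ^ b' * (RtoC 1 - eps m * RtoC t ^ (2 * m)) ^ c'))%C; [ring|].
          rewrite <- Cpow_add_r. replace (s + (2 * a' + c' - s))%nat with (2 * a' + c')%nat by lia.
          rewrite Cpow_add_r. ring.
      - apply Cpow_nz. intros E. apply RtoC_inj in E. auto. }
    assert (E0 : forall n, (0 < n)%nat -> (RtoC 0 ^ n)%C = RtoC 0).
    { intros [|n] Hn; [lia|]. rewrite Cpow_S. ring. }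
    unfold q in Hq0. rewrite (csum_single _ _ (a, b, c)) in Hq0.
    - rewrite <- Hs, Nat.sub_diag, (E0 (2 * m)%nat) in Hq0 by lia.
      rewrite <- Hq0. simpl Cpow. rewrite Cmult_0_r. unfold Cminus.
      replace (RtoC 1 + RtoC 0)%C with (RtoC 1) by ring. replace (RtoC 1 + - RtoC 0)%C with (RtoC 1) by ring.
      rewrite !Cpow_1_l. ring.
    - apply NoDup_triples.
    - auto.
    - intros [[a' b'] c'] Hin' Hne.
      destruct (Nat.lt_ge_cases (2 * a' + c') s) as [L | L].
      { rewrite (IH _ L a' b' c'); auto. ring. }
      destruct (Nat.eq_dec (2 * a' + c') s) as [E | E].
      (* The order [2 a + c] gives [c] by parity and then [a]; the degree [k] gives [b]. *)
      { exfalso. apply Hne. apply in_triples in Hin, Hin'; auto.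
        assert (c = c')%nat by lia. assert (a = a')%nat by lia. subst c' a'.
        assert (2 * m * b = 2 * m * b')%nat by lia. assert (b = b') by nia. subst; auto. }
      rewrite E0 by lia. ring. }
  intros [[a b] c] Hin. apply (K (2 * a + c)%nat a b c); auto.
Qed.

Definition combo (m k : nat) (kap : nat * nat * nat -> C) : poly :=
  flat_map (fun t => let '(a, b, c) := t in scale (kap t) (DpolyF m a b c)) (triples m k).

Lemma ev_combo (m k : nat) (kap : nat * nat * nat -> C) (A A' B B' : C) :
  ev (combo m k kap) A A' B B' =
  csum (triples m k) (fun t => let '(a, b, c) := t in Cmult (kap t) (Dval m a b c A B)).
Proof.
  unfold combo, ev. rewrite csum_flat_map. apply csum_ext. intros [[a b] c] _.
  change (ev (scale (kap (a, b, c)) (DpolyF m a b c)) A A' B B' = Cmult (kap (a, b, c)) (Dval m a b c A B)).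
  rewrite ev_scale, ev_DpolyF. auto.
Qed.

Lemma ab_terms_combo (m k : nat) (kap : nat * nat * nat -> C) : (1 <= m)%nat -> ab_terms k (combo m k kap).
Proof.
  intros Hm t Ht. unfold combo in Ht. apply in_flat_map in Ht. destruct Ht as [[[a b] c] [Hin Ht]].
  apply in_triples in Hin; auto. destruct Hin as [Hk _].
  unfold scale, pmap in Ht. apply in_map_iff in Ht. destruct Ht as [s [E Hs]]. subst t. cbn [snd].
  rewrite <- Hk. apply ab_terms_DpolyF. auto.
Qed.

Lemma coeff_flat_map {I : Type} (f : I -> poly) (l : list I) (i : idx) :
  coeff (flat_map f l) i = csum l (fun t => coeff (f t) i).
Proof. unfold coeff. rewrite csum_flat_map. auto. Qed.

(** Linearity of the iterated twist, obtained by comparing coefficients instead of by induction on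
    [j]. *)
Lemma peval_iter_combo (m k j : nat) (kap : nat * nat * nat -> C) (x y z w : R) : (1 <= m)%nat ->
  peval (Nat.iter j twistF (combo m k kap)) x y z w =
  csum (triples m k) (fun t => let '(a, b, c) := t in
    Cmult (kap t) (peval (Nat.iter j twistF (DpolyF m a b c)) x y z w)).
Proof.
  intros Hm.
  rewrite (peval_ext _ (flat_map (fun t => let '(a, b, c) := t in
    scale (kap t) (Nat.iter j twistF (DpolyF m a b c))) (triples m k))).
  - unfold peval, ev. rewrite csum_flat_map. apply csum_ext. intros [[a b] c] _.
    exact (ev_scale (kap (a, b, c)) (Nat.iter j twistF (DpolyF m a b c)) (x, y) (x, - y) (z, w) (z, - w)).
  - intros [[[a b] c] d]. rewrite coeff_flat_map.
    rewrite coeff_iter_twist by (apply (ab_terms_holomorphic k), ab_terms_combo; auto).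
    unfold combo. rewrite coeff_flat_map.
    destruct (b + d =? j)%nat eqn:E.
    + rewrite Cmult_comm, <- csum_scal. apply csum_ext. intros [[a' b'] c'] _.
      rewrite !coeff_scale, coeff_iter_twist by (eapply ab_terms_holomorphic; apply ab_terms_DpolyF).
      rewrite E. ring.
    + symmetry. apply csum_zero. intros [[a' b'] c'] _.
      rewrite !coeff_scale, coeff_iter_twist by (eapply ab_terms_holomorphic; apply ab_terms_DpolyF).
      rewrite E. ring.
Qed.

(** * The siblings are modes *)

Definition contC (G : fn) (x y z w : R) : Prop :=
  cont4 (fun x y z w => fst (G x y z w)) x y z w /\ cont4 (fun x y z w => snd (G x y z w)) x y z w.

Lemma contC_const (c : C) (x y z w : R) : contC (fun _ _ _ _ => c) x y z w.
Proof. split; apply cont4_const. Qed.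

Lemma contC_plus (F G : fn) (x y z w : R) : contC F x y z w -> contC G x y z w ->
  contC (fun x y z w => Cplus (F x y z w) (G x y z w)) x y z w.
Proof. intros [F1 F2] [G1 G2]. split; simpl; apply cont4_plus; auto. Qed.

Lemma contC_mult (F G : fn) (x y z w : R) : contC F x y z w -> contC G x y z w ->
  contC (fun x y z w => Cmult (F x y z w) (G x y z w)) x y z w.
Proof.
  intros [F1 F2] [G1 G2]. split; simpl; [apply cont4_minus | apply cont4_plus]; apply cont4_mult; auto.
Qed.

Lemma contC_pow (F : fn) (n : nat) (x y z w : R) : contC F x y z w ->
  contC (fun x y z w => (F x y z w ^ n)%C) x y z w.
Proof.
  intros H. induction n. apply (contC_const (RtoC 1)). apply (contC_mult F (fun x y z w => (F x y z w ^ n)%C)); auto.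
Qed.

Lemma contC_peval (P : poly) (x y z w : R) : contC (peval P) x y z w.
Proof.
  unfold peval, ev. induction P as [|[e [[[a b] c] d]] P IH].
  - apply (contC_const (RtoC 0)).
  - simpl csum. apply contC_plus; [|exact IH].
    assert (T : forall s s', cont4 s x y z w -> cont4 s' x y z w ->
      contC (fun x y z w => (s x y z w, s' x y z w)) x y z w) by (intros; split; auto).
    repeat apply contC_mult; try apply contC_const; apply contC_pow; apply T;
      try apply cont4_x; try apply cont4_y; try apply cont4_z; try apply cont4_w;
      apply (cont4_comp Ropp); try apply cont4_y; try apply cont4_w;
      apply (ex_derive_continuous Ropp); auto_derive; auto.
Qed.

Definition coordF (i : nat) : poly :=
  match i with
  | O => (RtoC (/ 2), (1, 0, 0, 0)%nat) :: (RtoC (/ 2), (0, 1, 0, 0)%nat) :: nil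
  | 1%nat => ((0, - / 2), (1, 0, 0, 0)%nat) :: ((0, / 2), (0, 1, 0, 0)%nat) :: nil
  | 2%nat => (RtoC (/ 2), (0, 0, 1, 0)%nat) :: (RtoC (/ 2), (0, 0, 0, 1)%nat) :: nil
  | _ => ((0, - / 2), (0, 0, 1, 0)%nat) :: ((0, / 2), (0, 0, 0, 1)%nat) :: nil
  end.

Definition coord (i : nat) (x y z w : R) : R :=
  match i with O => x | 1%nat => y | 2%nat => z | _ => w end.

Lemma peval_coordF (i : nat) (x y z w : R) : peval (coordF i) x y z w = RtoC (coord i x y z w).
Proof.
  destruct i as [|[|[|i]]]; unfold coordF, coord, peval, ev, mono; simpl;
  unfold Cmult, Cplus, RtoC; simpl; f_equal; field.
Qed.

Definition rhoF : poly := (RtoC 1, (1, 1, 0, 0)%nat) :: (RtoC 1, (0, 0, 1, 1)%nat) :: nil.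

Lemma peval_rhoF (x y z w : R) : peval rhoF x y z w = RtoC (rho x y z w).
Proof.
  unfold rhoF, peval, ev, mono, rho. simpl. unfold Cmult, Cplus, RtoC; simpl; f_equal; ring.
Qed.

(** The derivative of [|p|^kap Q] is [|p|^(kap-2)] times [kap x_i Q + rho dQ/dx_i]; this is the new
    polynomial factor. *)
Definition stepF (kap : R) (i : nat) (Q : poly) : poly :=
  scale (RtoC kap) (pmul (coordF i) Q) ++ pmul rhoF (dF i Q).

Lemma fst_peval_stepF (kap : R) (i : nat) (Q : poly) (x y z w : R) :
  fst (peval (stepF kap i Q) x y z w) =
  kap * coord i x y z w * fst (peval Q x y z w) + rho x y z w * fst (peval (dF i Q) x y z w).
Proof.
  unfold stepF. unfold peval at 1. rewrite ev_app, ev_scale, !ev_pmul.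
  change (fst (Cplus (Cmult (RtoC kap) (Cmult (peval (coordF i) x y z w) (peval Q x y z w)))
    (Cmult (peval rhoF x y z w) (peval (dF i Q) x y z w))) =
    kap * coord i x y z w * fst (peval Q x y z w) + rho x y z w * fst (peval (dF i Q) x y z w)).
  rewrite peval_coordF, peval_rhoF. unfold Cplus. cbn [fst]. rewrite !fst_RtoC_mult. ring.
Qed.

(** The functions that are a power of the norm times a polynomial off the origin. The class is
    closed under partial derivatives, so two steps give the [C^2] property of the extension. *)
Definition repr (kap : R) (Q : poly) (h : rfn) : Prop :=
  forall x y z w, 0 < rho x y z w -> h x y z w = psi kap x y z w * fst (peval Q x y z w).

Lemma psi_minus2 (kap x y z w : R) : 0 < rho x y z w ->
  psi (kap - 2) x y z w = psi kap x y z w / rho x y z w.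
Proof.
  intros H. unfold psi. replace ((kap - 2) / 2) with (kap / 2 + - (1)) by field.
  rewrite Rpower_plus, Rpower_Ropp, Rpower_1; auto.
Qed.

Lemma is_derive_psi_part (kap m s q' : R) (q : R -> R) : 0 < m + s ^ 2 -> is_derive q s q' ->
  is_derive (fun t => Rpower (m + t ^ 2) (kap / 2) * q t) s
    (Rpower (m + s ^ 2) (kap / 2) / (m + s ^ 2) * (kap * s * q s + (m + s ^ 2) * q')).
Proof.
  intros H Hq.
  pose proof (is_derive_mult_R _ _ _ _ _ (is_derive_Rpower_quadratic kap m s H) Hq) as K. cbv beta in K.
  replace (_ / _ * _) with (kap * s * Rpower (m + s ^ 2) (kap / 2) / (m + s ^ 2) * q s
     + Rpower (m + s ^ 2) (kap / 2) * q') by (field; lra).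
  exact K.
Qed.

Lemma repr_derive (kap : R) (Q : poly) (h : rfn) (x y z w : R) : repr kap Q h -> 0 < rho x y z w ->
  is_derive (fun t => h t y z w) x (psi (kap - 2) x y z w * fst (peval (stepF kap 0 Q) x y z w)) /\
  is_derive (fun t => h x t z w) y (psi (kap - 2) x y z w * fst (peval (stepF kap 1 Q) x y z w)) /\
  is_derive (fun t => h x y t w) z (psi (kap - 2) x y z w * fst (peval (stepF kap 2 Q) x y z w)) /\
  is_derive (fun t => h x y z t) w (psi (kap - 2) x y z w * fst (peval (stepF kap 3 Q) x y z w)).
Proof.
  intros Hh Hp. destruct (rho_near _ _ _ _ Hp) as [d [Hd Hn]].
  assert (Z : forall s, Rabs (s - s) < d) by (intros; apply Rabs_diag_lt; auto).
  rewrite psi_minus2, !fst_peval_stepF by auto. unfold coord.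
  assert (T : forall f m s q q', m + s ^ 2 = rho x y z w ->
    (forall t, Rabs (t - s) < d -> f t = Rpower (m + t ^ 2) (kap / 2) * q t) -> is_derive q s q' ->
    is_derive f s (psi kap x y z w / rho x y z w * (kap * s * q s + rho x y z w * q'))).
  { intros f m s q q' E Hf Hq. unfold psi. rewrite <- E.
    apply (is_derive_ext_loc (fun t => Rpower (m + t ^ 2) (kap / 2) * q t)).
    - apply (locally_of_near _ _ d Hd). intros t Ht. symmetry. apply Hf; auto.
    - apply is_derive_psi_part; auto. lra. }
  split; [|split; [|split]].
  - apply (T _ (y ^ 2 + z ^ 2 + w ^ 2) x (fun t => fst (peval Q t y z w))).
    + unfold rho; ring.
    + intros t Ht. rewrite Hh by (apply Hn; unfold near4; auto). unfold psi. apply (f_equal (fun r => Rpower r (kap / 2) * _)). unfold rho; ring.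
    + apply (isCD_dF 0 Q x y z w).
  - apply (T _ (x ^ 2 + z ^ 2 + w ^ 2) y (fun t => fst (peval Q x t z w))).
    + unfold rho; ring.
    + intros t Ht. rewrite Hh by (apply Hn; unfold near4; auto). unfold psi. apply (f_equal (fun r => Rpower r (kap / 2) * _)). unfold rho; ring.
    + apply (isCD_dF 1 Q x y z w).
  - apply (T _ (x ^ 2 + y ^ 2 + w ^ 2) z (fun t => fst (peval Q x y t w))).
    + unfold rho; ring.
    + intros t Ht. rewrite Hh by (apply Hn; unfold near4; auto). unfold psi. apply (f_equal (fun r => Rpower r (kap / 2) * _)). unfold rho; ring.
    + apply (isCD_dF 2 Q x y z w).
  - apply (T _ (x ^ 2 + y ^ 2 + z ^ 2) w (fun t => fst (peval Q x y z t))).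
    + unfold rho; ring.
    + intros t Ht. rewrite Hh by (apply Hn; unfold near4; auto). unfold psi. apply (f_equal (fun r => Rpower r (kap / 2) * _)). unfold rho; ring.
    + apply (isCD_dF 3 Q x y z w).
Qed.

Lemma repr_ex_pd (kap : R) (Q : poly) (h : rfn) (i : nat) (x y z w : R) :
  repr kap Q h -> (i < 4)%nat -> 0 < rho x y z w -> ex_pd i h x y z w.
Proof.
  intros Hh Hi Hp. destruct (repr_derive _ _ _ _ _ _ _ Hh Hp) as [D0 [D1 [D2 D3]]].
  destruct i as [|[|[|[|i]]]]; try lia; eexists; eassumption.
Qed.

Lemma repr_pd (kap : R) (Q : poly) (h : rfn) (i : nat) :
  repr kap Q h -> (i < 4)%nat -> repr (kap - 2) (stepF kap i Q) (pd i h).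
Proof.
  intros Hh Hi x y z w Hp. destruct (repr_derive _ _ _ _ _ _ _ Hh Hp) as [D0 [D1 [D2 D3]]].
  destruct i as [|[|[|[|i]]]]; try lia; apply is_derive_unique; assumption.
Qed.

Lemma repr_cont (kap : R) (Q : poly) (h : rfn) (x y z w : R) :
  repr kap Q h -> 0 < rho x y z w -> cont4 h x y z w.
Proof.
  intros Hh Hp. destruct (rho_near _ _ _ _ Hp) as [d [Hd Hn]].
  apply (cont4_ext_near (fun x y z w => psi kap x y z w * fst (peval Q x y z w)) _ _ _ _ _ d Hd).
  - intros. symmetry. apply Hh. auto.
  - apply cont4_mult; [|apply contC_peval].
    apply (cont4_comp (fun r => Rpower r (kap / 2))). apply cont4_rho.
    apply (ex_derive_continuous (fun r => Rpower r (kap / 2))). unfold Rpower. auto_derive. exact Hp.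
Qed.

Lemma repr_C2r (kap : R) (Q : poly) (h : rfn) : repr kap Q h -> C2r h.
Proof.
  intros Hh x y z w Hp. split.
  - intros i Hi. apply (repr_ex_pd kap Q); auto.
  - intros i j Hi Hj. pose proof (repr_pd _ _ _ i Hh Hi) as H1. pose proof (repr_pd _ _ _ j H1 Hj) as H2.
    split. apply (repr_ex_pd _ _ _ _ _ _ _ _ H1); auto. apply (repr_cont _ _ _ _ _ _ _ H2); auto.
Qed.

(** [homog] restricts coefficients but not terms. So every term is first multiplied by its own
    degree, and the result is compared with [k Q] coefficient by coefficient. *)
Lemma ev_euler (k : nat) (Q : poly) (A A' B B' : C) : homog k Q ->
  Cplus (Cplus (Cmult A (ev (dA Q) A A' B B')) (Cmult A' (ev (dA' Q) A A' B B')))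
        (Cplus (Cmult B (ev (dB Q) A A' B B')) (Cmult B' (ev (dB' Q) A A' B B'))) =
  Cmult (Cnat k) (ev Q A A' B B').
Proof.
  intros Hk. transitivity (ev (pmap (fun i => Cnat (degree i)) (fun i => i) Q) A A' B B').
  - unfold dA, dA', dB, dB'. rewrite !ev_pmap, <- !csum_scal, <- !csum_plus.
    apply csum_ext. intros [e [[[a b] c] d]] _. cbn [fst snd]. unfold degree, mono.
    rewrite !Cnat_plus.
    assert (T : forall (u : C) n, Cmult u (Cmult (Cnat n) (u ^ (n - 1))%C) = Cmult (Cnat n) (u ^ n)%C).
    { intros u [|n]. unfold Cnat; simpl; ring. simpl. rewrite Nat.sub_0_r. ring. }
    pose proof (T A a) as TA. pose proof (T A' b) as TA'. pose proof (T B c) as TB. pose proof (T B' d) as TB'.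
    transitivity (e * (A * (Cnat a * A ^ (a - 1)) * A' ^ b * B ^ c * B' ^ d +
      A' * (Cnat b * A' ^ (b - 1)) * A ^ a * B ^ c * B' ^ d +
      B * (Cnat c * B ^ (c - 1)) * A ^ a * A' ^ b * B' ^ d +
      B' * (Cnat d * B' ^ (d - 1)) * A ^ a * A' ^ b * B ^ c))%C; [ring|].
    rewrite TA, TA', TB, TB'. ring.
  - rewrite <- ev_scale. apply ev_ext. intros i. rewrite coeff_scale.
    rewrite (coeff_pmap _ _ i i (Cnat (degree i))).
    + destruct (Nat.eq_dec (degree i) k) as [E | E]. rewrite E; auto. rewrite Hk by auto. ring.
    + intros j. destruct (idx_dec j i); subst; auto.
Qed.

Lemma fst_euler (k : nat) (Q : poly) (x y z w : R) : homog k Q ->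
  x * fst (peval (dF 0 Q) x y z w) + y * fst (peval (dF 1 Q) x y z w) +
  z * fst (peval (dF 2 Q) x y z w) + w * fst (peval (dF 3 Q) x y z w) = INR k * fst (peval Q x y z w).
Proof.
  intros Hk. pose proof (ev_euler k Q (x, y) (x, - y) (z, w) (z, - w) Hk) as E.
  apply (f_equal fst) in E. unfold Cnat in E. rewrite fst_RtoC_mult in E. unfold peval. rewrite <- E.
  unfold dF. rewrite !ev_app, !ev_scale.
  unfold Cplus, Cmult, Copp, Ci. cbn [fst snd]. ring.
Qed.

Lemma repr_eigen (k : nat) (Q : poly) (h : rfn) (x y z w : R) :
  homog k Q -> (forall i, coeff (lapF Q) i = RtoC 0) -> repr (- INR k) Q h -> rho x y z w = 1 ->
  pd 0 (pd 0 h) x y z w + pd 1 (pd 1 h) x y z w + pd 2 (pd 2 h) x y z w + pd 3 (pd 3 h) x y z w =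
  - (INR k * (INR k + 2)) * fst (peval Q x y z w).
Proof.
  intros Hk Hl Hh H1. assert (Hp : 0 < rho x y z w) by lra.
  destruct (C2r_D2 h (repr_C2r _ _ _ Hh) x y z w Hp) as [A0 [A1 [A2 A3]]].
  assert (L1 : lap h x y z w (pd 0 (pd 0 h) x y z w + pd 1 (pd 1 h) x y z w + pd 2 (pd 2 h) x y z w + pd 3 (pd 3 h) x y z w)).
  { do 8 eexists. split; [exact A0 | split; [exact A1 | split; [exact A2 | split; [exact A3 | reflexivity]]]]. }
  destruct (D2_peval Q x y z w) as [B0 [B1 [B2 B3]]].
  assert (H0 : fst (peval (dF 0 (dF 0 Q)) x y z w) + fst (peval (dF 1 (dF 1 Q)) x y z w) +
    fst (peval (dF 2 (dF 2 Q)) x y z w) + fst (peval (dF 3 (dF 3 Q)) x y z w) = 0).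
  { rewrite fst_peval_lapF, (peval_ext (lapF Q) nil) by auto. simpl. ring. }
  pose proof (lap_psi_mult (- INR k) (fun x y z w => fst (peval Q x y z w)) x y z w _ _ _ _ _ _ _ _
    (INR k) 0 Hp B0 B1 B2 B3 (fst_euler k Q x y z w Hk) H0) as L2.
  destruct (rho_near _ _ _ _ Hp) as [d [Hd Hn]].
  apply (lap_ext_near _ h _ _ _ _ d) in L2; auto.
  2: { intros. symmetry. apply Hh. auto. }
  rewrite (lap_unique _ _ _ _ _ _ _ L1 L2). unfold psi. rewrite H1.
  replace (Rpower 1 (- INR k / 2)) with 1. field.
  unfold Rpower. rewrite ln_1, Rmult_0_r, exp_0. auto.
Qed.

Lemma ext_peval (k : nat) (Q : poly) (x y z w : R) : homog k Q -> 0 < rho x y z w ->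
  ext (peval Q) x y z w = Cmult (RtoC (psi (- INR k) x y z w)) (peval Q x y z w).
Proof.
  intros Hk Hp. unfold ext. cbv zeta. change (x ^ 2 + y ^ 2 + z ^ 2 + w ^ 2) with (rho x y z w).
  assert (Hr := sqrt_lt_R0 _ Hp).
  replace (x / sqrt (rho x y z w)) with (/ sqrt (rho x y z w) * x) by (field; lra).
  replace (y / sqrt (rho x y z w)) with (/ sqrt (rho x y z w) * y) by (field; lra).
  replace (z / sqrt (rho x y z w)) with (/ sqrt (rho x y z w) * z) by (field; lra).
  replace (w / sqrt (rho x y z w)) with (/ sqrt (rho x y z w) * w) by (field; lra).
  rewrite (peval_homog k) by auto. do 2 f_equal.
  rewrite pow_inv, sqrt_pow_psi by auto. unfold psi.
  rewrite <- Rpower_Ropp. f_equal. field.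
Qed.

Lemma peval_mode (m k : nat) (Q : poly) :
  homog k Q -> (forall i, coeff (lapF Q) i = RtoC 0) -> inv_coeffs m Q ->
  is_mode (in_Dstar m) k (peval Q).
Proof.
  intros Hk Hl Hi.
  set (Q' := scale (Copp Ci) Q).
  assert (HQ' : forall x y z w, peval Q' x y z w = Cmult (Copp Ci) (peval Q x y z w)).
  { intros. apply peval_scale. }
  assert (Hk' : homog k Q') by (intros i Hd; unfold Q'; rewrite coeff_scale, Hk by auto; ring).
  assert (Hl' : forall i, coeff (lapF Q') i = RtoC 0).
  { intros i. unfold Q'. rewrite coeff_lapF_scale, Hl. ring. }
  assert (R1 : repr (- INR k) Q (fun x y z w => fst (ext (peval Q) x y z w))).
  { intros x y z w Hp. rewrite (ext_peval k), fst_RtoC_mult by auto. auto. }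
  assert (R2 : repr (- INR k) Q' (fun x y z w => snd (ext (peval Q) x y z w))).
  { intros x y z w Hp. rewrite (ext_peval k), snd_eq_fst, HQ' by auto.
    rewrite <- fst_RtoC_mult. f_equal. ring. }
  split; [|split].
  - apply C2_away0_iff. split; [exact (repr_C2r _ _ _ R1) | exact (repr_C2r _ _ _ R2)].
  - intros x y z w Hs. change (rho x y z w = 1) in Hs. unfold LapS3.
    destruct (lap4_components (ext (peval Q)) x y z w) as [L1 L2]. cbv zeta in L1, L2.
    rewrite (repr_eigen k Q _ x y z w Hk Hl R1 Hs) in L1.
    rewrite (repr_eigen k Q' _ x y z w Hk' Hl' R2 Hs) in L2.
    rewrite HQ', <- snd_eq_fst in L2.
    apply injective_projections.
    + rewrite fst_RtoC_mult. exact L1.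
    + rewrite L2. unfold Cmult, RtoC. cbn [fst snd]. ring.
  - apply inv_coeffs_invariant. auto.
Qed.

(** * The basis theorem *)

(** [Dgen1] squares to minus the identity, which acts by [(-1)^k] in degree [k]. On coefficients
    this is the exchange relation applied twice. *)
Lemma odd_mode_zero (m k : nat) (F : fn) : Nat.odd k = true -> is_mode (in_Dstar m) k F ->
  forall x y z w, on_S3 x y z w -> F x y z w = RtoC 0.
Proof.
  intros Hodd HF x y z w Hs. destruct (mode_polynomial _ _ _ HF) as [P [Hk [_ HP]]].
  pose proof (mode_inv_coeffs m k F P (proj2 (proj2 HF)) Hk HP) as Hi.
  rewrite HP by auto. change (RtoC 0) with (peval nil x y z w).
  rewrite (peval_ext P nil); auto. intros i. change (coeff nil i) with (RtoC 0).
  destruct (Nat.eq_dec (degree i) k) as [E | E]; [|apply Hk; auto].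
  destruct i as [[[a b] c] d]. simpl in E.
  destruct (Hi a b c d) as [H1 _]. destruct (Hi c d a b) as [H2 _].
  rewrite H2 in H1. rewrite (Nat.add_comm c a), (Nat.add_comm d b) in H1.
  assert (Es : ((Copp Ci ^ (a + c) * Ci ^ (b + d)) * (Copp Ci ^ (a + c) * Ci ^ (b + d)) = RtoC (-1))%C).
  { transitivity ((Copp Ci * Copp Ci) ^ (a + c) * (Ci * Ci) ^ (b + d))%C.
    { rewrite !Cpow_mult_l. ring. }
    replace (Copp Ci * Copp Ci)%C with (Ci * Ci)%C by ring. rewrite Ci_sqr, <- Cpow_add_r.
    apply eps_odd. replace (a + c + (b + d))%nat with k by lia.
    unfold Nat.odd in Hodd. destruct (Nat.even k); auto. }
  assert (H3 : coeff P (a, b, c, d) = (RtoC (-1) * coeff P (a, b, c, d))%C).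
  { rewrite <- Es. rewrite H1 at 1. ring. }
  apply (Cmult_integral (RtoC 2)).
  - transitivity (coeff P (a, b, c, d) - RtoC (-1) * coeff P (a, b, c, d))%C.
    + replace (RtoC 2) with (RtoC 1 - RtoC (-1))%C by (rewrite <- RtoC_minus; f_equal; ring). ring.
    + rewrite <- H3. ring.
  - intros K. apply RtoC_inj in K. lra.
Qed.

Lemma Dfamily_peval (m a b c j : nat) :
  Dfamily m (a, b, c, j) = peval (Nat.iter j twistF (DpolyF m a b c)).
Proof. unfold Dfamily. rewrite Dpoly_peval, iter_twist_peval. auto. Qed.

Lemma Dfamily_mode (m k : nat) (i : idx) : (1 <= m)%nat -> In i (Didx m k) ->
  is_mode (in_Dstar m) k (Dfamily m i).
Proof.
  intros Hm Hi. destruct i as [[[a b] c] j]. apply in_Didx in Hi. destruct Hi as [Ht _].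
  apply in_triples in Ht; auto. destruct Ht as [Hk _]. rewrite Dfamily_peval.
  pose proof (ab_terms_DpolyF m a b c) as Hab. rewrite Hk in Hab.
  pose proof (ab_terms_holomorphic _ _ Hab) as Hh. pose proof (ab_terms_homog _ _ Hab) as Hg.
  apply peval_mode.
  - apply homog_iter_twist; auto.
  - intros i. apply lapF_iter_twist; auto.
  - apply inv_holo_iter_twist; auto. apply inv_holo_DpolyF; auto.
Qed.

(** Regrouping by the sibling number [j] puts combinations of the family into the form of the
    harmonic decomposition. *)
Lemma lin_comb_Didx (m k : nat) (coef : idx -> C) (x y z w : R) : (1 <= m)%nat ->
  lin_comb (Didx m k) coef (Dfamily m) x y z w =
  peval (sib_sum k (fun j => combo m k (fun t => coef (t, j)))) x y z w.
Proof.
  intros Hm. rewrite peval_sib_sum.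
  change (csum (Didx m k) (fun i => Cmult (coef i) (Dfamily m i x y z w)) =
    csum (seq 0 (S k)) (fun j => peval (Nat.iter j twistF (combo m k (fun t => coef (t, j)))) x y z w)).
  rewrite Didx_triples, csum_flat_map.
  transitivity (csum (triples m k) (fun t => csum (seq 0 (S k))
    (fun j => Cmult (coef (t, j)) (Dfamily m (t, j) x y z w)))).
  - apply csum_ext. intros t _. rewrite csum_map, Nat.add_1_r. auto.
  - rewrite csum_exchange. apply csum_ext. intros j _. rewrite peval_iter_combo by auto.
    apply csum_ext. intros [[a b] c] _. rewrite Dfamily_peval. auto.
Qed.

Lemma Dfamily_independent (m k : nat) (coef : idx -> C) : (1 <= m)%nat ->
  (forall x y z w, on_S3 x y z w -> lin_comb (Didx m k) coef (Dfamily m) x y z w = RtoC 0) ->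
  forall i, In i (Didx m k) -> coef i = RtoC 0.
Proof.
  intros Hm H i Hi. destruct i as [[[a0 b0] c0] j]. apply in_Didx in Hi. destruct Hi as [Ht Hj].
  set (g := fun j => combo m k (fun t => coef (t, j))).
  assert (Hab : forall j, ab_terms k (g j)) by (intros; apply ab_terms_combo; auto).
  assert (Hh : forall j, holomorphic (g j)) by (intros; apply (ab_terms_holomorphic k); auto).
  assert (Hg : forall j, homog k (g j)) by (intros; apply ab_terms_homog; auto).
  assert (Z : forall i, coeff (sib_sum k g) i = RtoC 0).
  { apply coeff_zero. apply (homog_zero_sphere k).
    - apply homog_sib_sum; auto.
    - intros x y z w Hs. rewrite <- (H x y z w Hs). symmetry. apply lin_comb_Didx; auto. }
  assert (Zj : forall i, coeff (g j) i = RtoC 0).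
  { intros [[[a b] c] d]. destruct (Nat.eq_dec (b + d) 0) as [E | E]; [|apply Hh; auto].
    assert (b = 0)%nat by lia. assert (d = 0)%nat by lia. subst b d.
    destruct (Nat.eq_dec (a + c) k) as [Ek | Ek]; [|apply Hg; simpl; lia].
    (* A table with margins [a], [c] and [j]: its coefficient in the sum is a nonzero multiple of
       that of [alpha^a beta^c] in [g j]. *)
    set (d := Nat.min j a). set (b := (j - d)%nat).
    specialize (Z (a - d, b, c - b, d)%nat).
    rewrite coeff_sib_sum in Z by (auto; unfold b, d; lia).
    replace (b + d)%nat with j in Z by (unfold b, d; lia).
    replace (a - d + d)%nat with a in Z by (unfold d; lia).
    replace (b + (c - b))%nat with c in Z by (unfold b, d; lia).
    rewrite Cmult_comm in Z. apply Cmult_integral in Z; auto. apply table_weight_neq0. }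
  apply (Dval_independent m k (fun t => coef (t, j)) Hm); [|exact Ht].
  intros A B. rewrite <- (ev_combo m k (fun t => coef (t, j)) A (RtoC 0) B (RtoC 0)).
  rewrite (ev_ext _ nil); auto.
Qed.

Lemma ev_sib_poly (k : nat) (v : nat -> C) (A A' B B' : C) :
  ev (sib_poly k v) A A' B B' = csum (seq 0 (S k)) (fun i => v i * (A ^ (k - i) * B ^ i))%C.
Proof.
  unfold ev, sib_poly. rewrite csum_map. apply csum_ext. intros i _. cbn [fst snd]. unfold mono.
  simpl Cpow. ring.
Qed.

Lemma mode_span (m n : nat) (F : fn) : (1 <= m)%nat -> is_mode (in_Dstar m) (2 * n) F ->
  exists coef : idx -> C, forall x y z w, on_S3 x y z w ->
    F x y z w = lin_comb (Didx m (2 * n)) coef (Dfamily m) x y z w.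
Proof.
  intros Hm HF. set (k := (2 * n)%nat) in *.
  destruct (mode_polynomial _ _ _ HF) as [P [Hk [Hl HP]]].
  pose proof (mode_inv_coeffs m k F P (proj2 (proj2 HF)) Hk HP) as Hi.
  set (v := sib_coeff k P).
  assert (HE : forall i, coeff P i = coeff (sib_sum k (fun j => sib_poly k (v j))) i)
    by (intros; apply harmonic_decomposition; auto).
  assert (Hi' : inv_coeffs m (sib_sum k (fun j => sib_poly k (v j)))).
  { intros a b c d. rewrite <- !HE. apply Hi. }
  assert (HS : forall j, exists kap : nat * nat * nat -> C, (j <= k)%nat ->
    forall x y z w, peval (sib_poly k (v j)) x y z w = peval (combo m k kap) x y z w).
  { intros j. destruct (le_dec j k) as [Hj | Hj].
    - pose proof (invariant_InSpan m n (v j) Hm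
        (fun i Hik => inv_coeffs_sib m k j i v Hj Hik Hi')) as HI.
      destruct (InSpan_coefficients m (2 * n) _ Hm HI) as [kap Hkap].
      exists kap. intros _ x y z w. unfold peval. rewrite ev_sib_poly, ev_combo. apply Hkap.
    (* Only [j <= k] occurs in the sum; beyond that any coefficients will do. *)
    - exists (fun _ => RtoC 0). intros; contradiction. }
  set (kap := fun j => proj1_sig (constructive_indefinite_description _ (HS j))).
  assert (Hkap : forall j, (j <= k)%nat ->
    forall x y z w, peval (sib_poly k (v j)) x y z w = peval (combo m k (kap j)) x y z w).
  { intros j Hj. unfold kap. destruct (constructive_indefinite_description _ _) as [q Hq]. exact (Hq Hj). }
  exists (fun i => kap (snd i) (fst i)). intros x y z w Hs.
  rewrite HP, lin_comb_Didx by auto.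
  rewrite (peval_ext P _ HE), !peval_sib_sum. apply csum_ext. intros j Hj. apply in_seq in Hj.
  rewrite <- !iter_twist_peval. cbn [fst snd].
  replace (peval (sib_poly k (v j))) with (peval (combo m k (fun t => kap j t))); auto.
  repeat (apply functional_extensionality; intro). symmetry. apply Hkap. lia.
Qed.

(** * Dimension from a basis indexed by a list *)

Fixpoint position (i : idx) (l : list idx) : nat :=
  match l with nil => O | j :: l => if idx_dec i j then O else S (position i l) end.

Lemma position_spec (i d : idx) (l : list idx) : In i l ->
  (position i l < length l)%nat /\ nth (position i l) l d = i.
Proof.
  induction l as [|j l IH]; simpl; [tauto|]. intros H.
  destruct (idx_dec i j) as [E | E]. { split; [lia | auto]. }
  destruct H as [H | H]; [congruence|]. destruct (IH H). split; [lia | auto].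
Qed.

Lemma csum_nth {I : Type} (l : list I) (d : I) (f : I -> C) :
  csum l f = csum (seq 0 (length l)) (fun i => f (nth i l d)).
Proof.
  induction l as [|j l IH]; simpl; auto. rewrite IH, <- seq_shift, csum_map. auto.
Qed.

(** The basis is reindexed by positions in the list. Independence needs the inverse map [position],
    which is well behaved because the list has no duplicates. *)
Lemma basis_has_dim (P : fn -> Prop) (L : list idx) (f : idx -> fn) :
  is_basis P L f -> has_dim P (length L).
Proof.
  intros [HN [HP [HI HS]]]. set (d := (0, 0, 0, 0)%nat : idx).
  exists (fun i => f (nth i L d)). split; [apply seq_NoDup | split; [|split]].
  - intros i Hi. apply in_seq in Hi. apply HP. apply nth_In. lia.
  - intros coef H i Hi. apply in_seq in Hi.
    assert (Hpos : forall i, (i < length L)%nat -> position (nth i L d) L = i).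
    { intros i' Hi'. destruct (position_spec (nth i' L d) d L) as [K1 K2]; [apply nth_In; auto|].
      apply (proj1 (NoDup_nth L d) HN); auto. }
    rewrite <- (Hpos i) by lia. apply (HI (fun x => coef (position x L))); [|apply nth_In; lia].
    intros x y z w Hs. rewrite <- (H x y z w Hs).
    change (csum L (fun i => Cmult (coef (position i L)) (f i x y z w)) =
      csum (seq 0 (length L)) (fun i => Cmult (coef i) (f (nth i L d) x y z w))).
    rewrite (csum_nth L d). apply csum_ext. intros i' Hi'. apply in_seq in Hi'. rewrite Hpos by lia. auto.
  - intros F HF. destruct (HS F HF) as [coef Hc]. exists (fun i => coef (nth i L d)).
    intros x y z w Hs. rewrite (Hc x y z w Hs).
    exact (csum_nth L d (fun i => Cmult (coef i) (f i x y z w))).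
Qed.

Theorem theorem13p4 (m k : nat) :
  (1 <= m)%nat ->
  (Nat.odd k = true ->
     forall F : fn, is_mode (in_Dstar m) k F ->
       forall x y z w : R, on_S3 x y z w -> F x y z w = RtoC 0) /\
  (Nat.even k = true ->
     is_basis (is_mode (in_Dstar m) k) (Didx m k) (Dfamily m) /\
     exists n : nat, has_dim (is_mode (in_Dstar m) k) n /\
       Z.of_nat n =
         ((2 * ((Z.of_nat k / 2) / 2) + (Z.of_nat k / 2) / Z.of_nat m
           - Z.of_nat k / 2 + 1) * (Z.of_nat k + 1))%Z).
Proof.
  intros Hm. split.
  - intros Hodd F HF. apply (odd_mode_zero m k F Hodd HF).
  - intros Heven. apply Nat.even_spec in Heven. destruct Heven as [n ->].
    assert (HB : is_basis (is_mode (in_Dstar m) (2 * n)) (Didx m (2 * n)) (Dfamily m)).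
    { split; [apply NoDup_Didx | split; [|split]].
      - intros i Hi. apply Dfamily_mode; auto.
      - intros coef. apply Dfamily_independent; auto.
      - intros F HF. apply mode_span; auto. }
    split; auto. exists (length (Didx m (2 * n))). split; [apply (basis_has_dim _ _ _ HB)|].
    rewrite length_Didx, Nat2Z.inj_mul.
    (* There are [n / m + 1 - n mod 2] triples, and [n mod 2 = n - 2 (n / 2)] turns this into the
       stated formula with [n = k / 2]. *)
    pose proof (length_triples m n Hm) as HL.
    assert (E : (Z.of_nat (2 * n) / 2)%Z = Z.of_nat n).
    { rewrite Nat2Z.inj_mul, Z.mul_comm, Z.div_mul; lia. }
    rewrite E, <- Nat2Z.inj_div.
    assert (E2 : (Z.of_nat n / 2)%Z = Z.of_nat (n / 2)) by (rewrite Nat2Z.inj_div; auto).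
    rewrite E2. pose proof (Nat.div_mod_eq n 2).
    f_equal; lia.
Qed.
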